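(* Let $\psi$ be an admissible vector of the form $\mathcal F\psi(\xi_1,\xi_2)=\mathcal F\psi_1(\xi_1)\,\mathcal F\psi_2(\xi_2/\xi_1)$ for $\xi_1\neq 0$, with $\psi_1,\psi_2\in L^2(\mathbb R)$, such that the function $\chi_1$ defined by $\mathcal F\chi_1(\tau)=|\tau|\,\mathcal F\psi_1(\tau)$ belongs to $\mathcal S_0(\mathbb R)$ and $\phi_2=\mathcal F\psi_2$ belongs to $\mathcal S(\mathbb R)$. For $f\in\mathcal S_0'(\mathbb R^2)$ define the shearlet transform $\mathcal S_\psi f$ by $$(\mathcal S_\psi f,\Phi)=(f,\mathcal S^t_{\overline\psi}\Phi),\qquad \Phi\in\mathcal S(\mathbb S).$$ Then $\mathcal S_\psi$ is a continuous and linear map from $\mathcal S_0'(\mathbb R^2)$ into $\mathcal S'(\mathbb S)$.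
   Context: Fourier transform: $\mathcal F f(\xi)=\int_{\mathbb R^d} f(x)e^{-2\pi i\xi\cdot x}\,dx$, extended to $L^2(\mathbb R^d)$. $\mathbb R^\times=\mathbb R\setminus\{0\}$, $\langle x\rangle=(1+|x|^2)^{1/2}$, $\mathbb N=\{0,1,2,\dots\}$. Lizorkin space: $\mathcal S_0(\mathbb R^d)=\{\varphi\in\mathcal S(\mathbb R^d):\int_{\mathbb R^d}x^m\varphi(x)\,dx=0\ \ \forall m\in\mathbb N^d\}$, with the topology inherited from the Schwartz space $\mathcal S(\mathbb R^d)$. The space $\mathcal S(\mathbb S)$: $\mathbb S=\mathbb R^2\times\mathbb R\times\mathbb R^\times$, and $\mathcal S(\mathbb S)$ is the space of $\Phi\in C^\infty(\mathbb S)$ for which all seminorms $$\sup_{((b_1,b_2),s,a)\in\mathbb S}\langle b_1\rangle^{k_1}\langle b_2\rangle^{k_2}\langle s\rangle^{l}\Big(|a|^m+\frac1{|a|^m}\Big)\big|\partial_a^\gamma\partial_s^\beta\partial_{b_2}^{\alpha_2}\partial_{b_1}^{\alpha_1}\Phi((b_1,b_2),s,a)\big|,$$ $k_1,k_2,l,m,\alpha_1,\alpha_2,\beta,\gamma\in\mathbb N$, are finite; its topology is defined by these seminorms. $\mathcal S_0'(\mathbb R^2)$ (Lizorkin distributions) and $\mathcal S'(\mathbb S)$ are the topological duals of $\mathcal S_0(\mathbb R^2)$ and $\mathcal S(\mathbb S)$, both with the strong dual topology; $(\cdot,\cdot)$ denotes the (bilinear) dual pairing. For $(b,s,a)\in\mathbb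 S$ put $S_s=\begin{pmatrix}1&-s\\0&1\end{pmatrix}$, $A_a=a\begin{pmatrix}1&0\\0&|a|^{-1/2}\end{pmatrix}$, and $S_{b,s,a}\psi(x)=|a|^{-3/4}\psi(A_a^{-1}S_s^{-1}(x-b))$. A vector $\psi\in L^2(\mathbb R^2)$ is admissible if $0<\int_{\mathbb R^2}\frac{|\mathcal F\psi(\xi)|^2}{|\xi_1|^2}\,d\xi<+\infty$. For $\psi$ of the form in the claim, $\mathcal F\psi$ extends to a Schwartz function on $\mathbb R^2$ (all of whose derivatives vanish at $0$), and $\psi$ denotes the corresponding Schwartz function on $\mathbb R^2$. Shearlet synthesis operator with respect to $\overline\psi$: for $\Phi\in\mathcal S(\mathbb S)$, $$\mathcal S_{\overline\psi}^t\Phi(x)=\int_{\mathbb R^\times}\int_{\mathbb R}\int_{\mathbb R^2}\Phi(b,s,a)\,\overline{S_{b,s,a}\psi(x)}\,\frac{db\,ds\,da}{|a|^3},\qquad x\in\mathbb R^2,$$ which belongs to $\mathcal S_0(\mathbb R^2)$. *)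

(* Defs.v *)
From HB Require Import structures.
From mathcomp Require Import all_boot all_order all_algebra.
From mathcomp Require Import all_classical all_reals all_analysis.
From mathcomp Require Import complex measurable_realfun lra.

Set Implicit Arguments.
Unset Strict Implicit.
Unset Printing Implicit Defensive.

Import Order.TTheory GRing.Theory Num.Theory.
Import numFieldNormedType.Exports.
Local Open Scope classical_set_scope.
Local Open Scope ring_scope.

Notation cmod := ComplexField.Normc.normc.

Section partial_derivatives.
Context {R : realType} {V : normedModType R}.
Implicit Types (f g : V -> R[i]^o) (v : V) (s E : seq V) (U : set V).

Definition cpartial v f : V -> R[i]^o := fun x =>
  ('D_v (fun y => complex.Re (f y) : R^o) x
   +i* 'D_v (fun y => complex.Im (f y) : R^o) x)%C.

Definition cpartials s f : V -> R[i]^o := foldr cpartial f s.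

Definition cderivable f x v :=
  derivable (fun y => complex.Re (f y) : R^o) x v /\
  derivable (fun y => complex.Im (f y) : R^o) x v.

(* f is C^oo on U, with respect to the coordinate vectors listed in E *)
Definition smooth_on E U f := forall s, {subset s <= E} -> forall x, U x ->
  {for x, continuous (cpartials s f)} /\
  forall v, v \in E -> cderivable (cpartials s f) x v.

Definition wsup U (w : V -> R) f : \bar R :=
  ereal_sup [set (w x * cmod (f x))%:E | x in U].

End partial_derivatives.

Section complex_integral.
Context d {T : measurableType d} {R : realType}.
Variable mu : {measure set T -> \bar R}.

Definition cintegral (D : set T) (f : T -> R[i]) : R[i] :=
  ((\int[mu]_(x in D) complex.Re (f x))
   +i* (\int[mu]_(x in D) complex.Im (f x)))%C.

Definition Lpnorm (p : \bar R) (f : T -> R[i]) : \bar R :=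
  'N[mu]_p[(fun x => (cmod (f x))%:E)]%E.

Definition inLp (p : \bar R) (f : T -> R[i]) :=
  [/\ measurable_fun setT (fun x => complex.Re (f x)),
      measurable_fun setT (fun x => complex.Im (f x)) &
      (Lpnorm p f < +oo)%E].

(* g is (a version of) the image of f by the continuous extension to L^2 of
   the integral operator F, given on the dense subspace L^1 `&` L^2 *)
Definition L2_extension (F : (T -> R[i]) -> T -> R[i]) (f g : T -> R[i]) :=
  [/\ inLp 2%:E f, inLp 2%:E g &
      exists u : nat -> T -> R[i],
        [/\ forall n, inLp 1%:E (u n) /\ inLp 2%:E (u n),
            (fun n => Lpnorm 2%:E (fun x => u n x - f x)) @ \oo --> 0%E &
            (fun n => Lpnorm 2%:E (fun x => F (u n) x - g x)) @ \oo --> 0%E]].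

End complex_integral.

Section euclidean.
Context {R : realType}.

Definition leb1 : {measure set (measurableTypeR R) -> \bar R} :=
  lebesgue_measure.
Definition leb2 :
  {measure set (measurableTypeR R * measurableTypeR R) -> \bar R} :=
  (lebesgue_measure \x lebesgue_measure)%E.

Definition cexpi (t : R) : R[i] := (cos t +i* sin t)%C.

Definition fourier1 (f : R -> R[i]) (xi : R) : R[i] :=
  cintegral leb1 setT (fun x => f x * cexpi (- (2 * pi * (xi * x)))).

Definition fourier2 (f : R * R -> R[i]) (xi : R * R) : R[i] :=
  cintegral leb2 setT
    (fun x => f x * cexpi (- (2 * pi * (xi.1 * x.1 + xi.2 * x.2)))).

Definition is_fourierL2_1 := L2_extension leb1 fourier1.
Definition is_fourierL2_2 := L2_extension leb2 fourier2.

Definition jap1 (x : R) : R := Num.sqrt (1 + x ^+ 2).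
Definition jap2 (x : R * R) : R := Num.sqrt (1 + (x.1 ^+ 2 + x.2 ^+ 2)).

Definition coord2_1 : R * R := (1, 0).
Definition coord2_2 : R * R := (0, 1).

Definition multi2 (al : nat * nat) : seq (R * R) :=
  nseq al.2 coord2_2 ++ nseq al.1 coord2_1.

Definition schwartz1_norm (i : nat * nat) (f : R -> R[i]^o) :=
  wsup setT (fun x => jap1 x ^+ i.1) (cpartials (nseq i.2 (1 : R)) f).

Definition is_schwartz1 (f : R -> R[i]^o) :=
  smooth_on [:: (1 : R)] setT f /\ forall i, (schwartz1_norm i f < +oo)%E.

Definition is_lizorkin1 (f : R -> R[i]^o) := is_schwartz1 f /\
  forall m : nat, cintegral leb1 setT (fun x => (x ^+ m)%:C%C * f x) = 0.

Definition schwartz2_norm (i : nat * (nat * nat)) (f : R * R -> R[i]^o) :=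
  wsup setT (fun x => jap2 x ^+ i.1) (cpartials (multi2 i.2) f).

Definition is_schwartz2 (f : R * R -> R[i]^o) :=
  smooth_on [:: coord2_1; coord2_2] setT f /\
  forall i, (schwartz2_norm i f < +oo)%E.

Definition vanishing_moments2 (f : R * R -> R[i]^o) := forall m : nat * nat,
  cintegral leb2 setT (fun x => (x.1 ^+ m.1 * x.2 ^+ m.2)%:C%C * f x) = 0.

(* a point ((b1, b2), s, a) of R^2 x R x R^x is seen in R * R * R * R *)
Definition shdom : set (R * R * R * R) := [set p | p.2 != 0].

Definition coordb1 : R * R * R * R := (1, 0, 0, 0).
Definition coordb2 : R * R * R * R := (0, 1, 0, 0).
Definition coords : R * R * R * R := (0, 0, 1, 0).
Definition coorda : R * R * R * R := (0, 0, 0, 1).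

Definition shnorm_index : Type :=
  ((nat * nat * nat * nat) * (nat * nat * nat * nat))%type.

Definition shnorm (i : shnorm_index) (Phi : R * R * R * R -> R[i]^o) :=
  let: ((k1, k2, l, m), (al1, al2, be, ga)) := i in
  wsup shdom
    (fun p => let: (b1, b2, s, a) := p in
       jap1 b1 ^+ k1 * jap1 b2 ^+ k2 * jap1 s ^+ l
       * (`|a| ^+ m + (`|a| ^+ m)^-1))
    (cpartials (nseq ga coorda ++ nseq be coords
                ++ nseq al2 coordb2 ++ nseq al1 coordb1) Phi).

(* A function on R^2 x R x R^x is represented by its extension by 0 to
   R * R * R * R, so that equal functions have equal representatives; the
   smoothness and the seminorms only involve its values where a != 0. *)
Definition is_shschwartz (Phi : R * R * R * R -> R[i]^o) :=
  [/\ forall p, ~ shdom p -> Phi p = 0,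
      smooth_on [:: coordb1; coordb2; coords; coorda] shdom Phi &
      forall i, (shnorm i Phi < +oo)%E].

End euclidean.

(* Subbase of the topology defined by a family of seminorms *)
Definition seminorm_subbase {R : realType} {V : zmodType} {I : Type}
    (p : I -> V -> \bar R) : set (set V) :=
  [set B | exists i u (e : R), 0 < e /\ B = [set v | (p i (v - u)%R < e%:E)%E]].

(* Stated for an abstract K because canonical structure inference on cvgD
   and cvgZr is impractical for K = R[i]; instantiate it explicitly *)
Lemma regular_cvg_lin (K : numFieldType) (T : Type) (F : set_system T)
    (FF : Filter F) (a : K) (f g : T -> K^o) (l m : K^o) :
  f @ F --> l -> g @ F --> m ->
  (fun x => a *: f x + g x) @ F --> a *: l + m.
Proof. by move=> fl gm; apply: cvgD => //; exact: cvgZr. Qed.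

Section smooth_lemmas.
Context {R : realType} {V : normedModType R}.
Implicit Types (f g : V -> R[i]^o) (v : V) (s E : seq V) (U : set V).

Let ReD (a : R[i]) (x y : R[i]^o) : complex.Re (a *: x + y) =
  complex.Re a * complex.Re x - complex.Im a * complex.Im x + complex.Re y.
Proof. by case: a x y => [? ?] [? ?] [? ?]. Qed.

Let ImD (a : R[i]) (x y : R[i]^o) : complex.Im (a *: x + y) =
  complex.Re a * complex.Im x + complex.Im a * complex.Re x + complex.Im y.
Proof. by case: a x y => [? ?] [? ?] [? ?]. Qed.

Let is_derive_Re (a : R[i]) f g x v :
  cderivable f x v -> cderivable g x v ->
  is_derive x v (fun y => complex.Re ((a *: f + g) y) : R^o)
    (complex.Re (a *: cpartial v f x + cpartial v g x)).
Proof.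
move=> [/derivableP fR /derivableP fI] [/derivableP gR /derivableP gI].
rewrite (_ : (fun y => _) = complex.Re a \*: (fun y => complex.Re (f y) : R^o)
  - complex.Im a \*: (fun y => complex.Im (f y) : R^o)
  + (fun y => complex.Re (g y) : R^o)); last by apply/funext => y; exact: ReD.
by rewrite ReD; apply: is_deriveD.
Qed.

Let is_derive_Im (a : R[i]) f g x v :
  cderivable f x v -> cderivable g x v ->
  is_derive x v (fun y => complex.Im ((a *: f + g) y) : R^o)
    (complex.Im (a *: cpartial v f x + cpartial v g x)).
Proof.
move=> [/derivableP fR /derivableP fI] [/derivableP gR /derivableP gI].
rewrite (_ : (fun y => _) = complex.Re a \*: (fun y => complex.Im (f y) : R^o)
  + complex.Im a \*: (fun y => complex.Re (f y) : R^o)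
  + (fun y => complex.Im (g y) : R^o)); last by apply/funext => y; exact: ImD.
by rewrite ImD; apply: is_deriveD.
Qed.

Lemma cderivable_lin (a : R[i]) f g x v :
  cderivable f x v -> cderivable g x v -> cderivable (a *: f + g) x v.
Proof.
move=> df dg; split; [have h := is_derive_Re a df dg|
  have h := is_derive_Im a df dg]; exact: ex_derive.
Qed.

Lemma cpartial_lin (a : R[i]) f g x v :
  cderivable f x v -> cderivable g x v ->
  cpartial v (a *: f + g) x = a *: cpartial v f x + cpartial v g x.
Proof.
move=> df dg; rewrite {1}/cpartial.
have h1 := is_derive_Re a df dg; have h2 := is_derive_Im a df dg.
by rewrite !derive_val; case: (a *: _ + _).
Qed.

Lemma near_eq_cpartial f g x v :
  (\forall y \near x, f y = g y) -> cpartial v f x = cpartial v g x.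
Proof.
move=> fg; rewrite /cpartial.
by congr (_ +i* _)%C; apply: near_eq_derive; apply: filterS fg => y ->.
Qed.

Lemma cpartials_lin E U s (a : R[i]) f g x : open U ->
  smooth_on E U f -> smooth_on E U g -> {subset s <= E} -> U x ->
  cpartials s (a *: f + g) x = a *: cpartials s f x + cpartials s g x.
Proof.
move=> oU sf sg; elim: s x => [//|v s ih] x sE Ux /=.
have sE' : {subset s <= E} by move=> y ys; apply: sE; rewrite inE ys orbT.
have vE : v \in E by apply: sE; rewrite inE eqxx.
have [_ df] := sf s sE' x Ux; have [_ dg] := sg s sE' x Ux.
rewrite -(cpartial_lin _ (df _ vE) (dg _ vE)); apply: near_eq_cpartial.
by apply: filterS (open_nbhs_nbhs (conj oU Ux)) => y; exact: ih.
Qed.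

Lemma smooth_on_lin E U (a : R[i]) f g : open U ->
  smooth_on E U f -> smooth_on E U g -> smooth_on E U (a *: f + g).
Proof.
move=> oU sf sg s sE x Ux.
have nx : \forall y \near x,
    (a *: cpartials s f + cpartials s g) y = cpartials s (a *: f + g) y.
  apply: filterS (open_nbhs_nbhs (conj oU Ux)) => y Uy.
  by rewrite (cpartials_lin _ oU sf sg).
have [cf df] := sf s sE x Ux; have [cg dg] := sg s sE x Ux; split.
- rewrite /prop_for /continuous_at -(nbhs_singleton nx).
  apply: cvg_trans; first by apply: near_eq_cvg; exact: nx.
  exact: (@regular_cvg_lin R[i] V (nbhs x) _ a (cpartials s f)
    (cpartials s g) _ _ cf cg).
- move=> v vE.
  have [h1 h2] := cderivable_lin a (df _ vE) (dg _ vE); split.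
    by apply: near_eq_derivable h1; apply: filterS nx => y ->.
  by apply: near_eq_derivable h2; apply: filterS nx => y ->.
Qed.

Lemma cpartial0 v : cpartial v (0 : V -> R[i]^o) = 0.
Proof.
apply/funext => x; rewrite /cpartial.
have -> : (fun y => complex.Re ((0 : V -> R[i]^o) y) : R^o) = cst 0 by [].
by rewrite derive_cst.
Qed.

Lemma cpartials0 s : cpartials s (0 : V -> R[i]^o) = 0.
Proof. by elim: s => [//|v s /= ->]; exact: cpartial0. Qed.

Lemma smooth_on0 E U : smooth_on E U 0.
Proof.
move=> s _ x _; rewrite cpartials0; split; first exact: cst_continuous.
by move=> v _; split; exact: derivable_cst.
Qed.

Lemma wsup_ltyP U (w : V -> R) f : (wsup U w f < +oo)%E <->
  exists M : R, forall x, U x -> w x * cmod (f x) <= M.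
Proof.
split=> [|[M fM]].
  case h : (wsup U w f) => [r| |] // _.
    exists r => x Ux; rewrite -lee_fin -h.
    by apply: ereal_sup_ubound; exists x.
  exists 0 => x Ux; rewrite -lee_fin; apply: le_trans (leNye _); rewrite -h.
  by apply: ereal_sup_ubound; exists x.
apply: le_lt_trans (ltry M); apply: ge_ereal_sup => _ [x Ux <-].
by rewrite lee_fin; exact: fM.
Qed.

Lemma wsup_lin U (w : V -> R) (a : R[i]) f g h : (forall x, 0 <= w x) ->
  (forall x, U x -> h x = a *: f x + g x) ->
  (wsup U w f < +oo)%E -> (wsup U w g < +oo)%E -> (wsup U w h < +oo)%E.
Proof.
move=> w0 hfg /wsup_ltyP[M fM] /wsup_ltyP[N gN]; apply/wsup_ltyP.
exists (cmod a * M + N) => x Ux; rewrite hfg//.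
have a0 : 0 <= cmod a by case: (a) => ? ?; exact: sqrtr_ge0.
apply: (@le_trans _ _ (w x * (cmod a * cmod (f x) + cmod (g x)))).
  apply: ler_wpM2l => //; rewrite -ComplexField.Normc.normcM; exact: le_normcD.
by rewrite mulrDr mulrCA lerD ?gN// ler_wpM2l// fM.
Qed.

Lemma wsup0 U (w : V -> R) : (wsup U w (0 : V -> R[i]^o)%R < +oo)%E.
Proof.
apply/wsup_ltyP; exists 0 => x _.
by rewrite (_ : cmod _ = 0) ?mulr0//; exact: ComplexField.Normc.normc0.
Qed.

End smooth_lemmas.

Section integrability.
Context {R : realType}.
Local Notation mR := (measurableTypeR R).
Implicit Types (f g : R * R -> R[i]^o).

Lemma open_measurable2 (U : set (R * R)) :
  open U -> measurable (U : set (mR * mR)).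
Proof.
move=> oU.
pose box (p : (rat * rat) * (rat * rat)) : set (mR * mR) :=
  `]ratr p.1.1, ratr p.1.2[%classic `*` `]ratr p.2.1, ratr p.2.2[%classic.
pose A n : set (mR * mR) := if unpickle n is Some p then
  if `[< box p `<=` U >] then box p else set0 else set0.
rewrite (_ : U = \bigcup_n A n).
  apply: bigcupT_measurable => n; rewrite /A.
  case: unpickle => [p|]; last exact: measurable0.
  case: ifPn => _; last exact: measurable0.
  by apply: measurableX; exact: measurable_itv.
apply/seteqP; split => [[x y] Uxy|x [n _]]; last first.
  by rewrite /A; case: unpickle => // p; case: asboolP => // pU /pU.
have /nbhs_ballP[e /= e0 eU] : nbhs (x, y) U by exact: open_nbhs_nbhs.
have rat2 (z : R) : exists p : rat * rat,
    [/\ z - e < ratr p.1, ratr p.1 < z, z < ratr p.2 & ratr p.2 < z + e].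
  have /rat_in_itvoo[p /itvP hp] : z - e < z by rewrite ltrBlDr ltrDl.
  have /rat_in_itvoo[q /itvP hq] : z < z + e by rewrite ltrDl.
  by exists (p, q); rewrite !(hp, hq).
have [p [p1 p2 p3 p4]] := rat2 x; have [q [q1 q2 q3 q4]] := rat2 y.
exists (pickle (p, q)); [exact: I|]; rewrite /A pickleK; case: asboolP => [_|nU].
  by rewrite /box /= !in_itv /= p2 p3 q2 q3.
exfalso; apply: nU => -[u v] /=; rewrite /box /= !in_itv /=.
move=> [/andP[u1 u2] /andP[v1 v2]]; apply: eU; split => /=.
  by rewrite /ball /= ltr_norml; apply/andP; split; lra.
by rewrite /ball /= ltr_norml; apply/andP; split; lra.
Qed.

Lemma continuous_measurable_fun2 (h : R * R -> R) : continuous h ->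
  measurable_fun setT (h : mR * mR -> R).
Proof.
move=> /continuousP ch; apply: (measurability _ (RGenOpens.measurableE R)).
move=> _ [_ [a [b ->] <-]]; rewrite setTI; apply: open_measurable2.
exact/ch/interval_open.
Qed.

Lemma integral_oneDsqrV : (\int[leb1]_x ((1 + x ^+ 2)^-1 : R)%:E < +oo)%E.
Proof.
rewrite /leb1 (@ge0_symfun_integralT R (fun x => (1 + x ^+ 2)^-1)).
- have := @integral0y_oneDsqr R; rewrite /oneDsqr.
  rewrite (_ : [set x | 0 <= x] = `[0, +oo[%classic).
    by move=> ->; rewrite -EFinM ltry.
  by apply/seteqP; split => x /=; rewrite in_itv /= andbT.
- by move=> x; rewrite invr_ge0 addr_ge0// sqr_ge0.
- exact: continuous_oneDsqrV.
- by move=> x /=; rewrite sqrrN.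
Qed.


Let w (x : R) := (1 + x ^+ 2)^-1.

Let w_ge0 x : 0 <= w x.
Proof. by rewrite invr_ge0 addr_ge0// sqr_ge0. Qed.

Let cw : continuous w. Proof. exact: continuous_oneDsqrV. Qed.

Let mw2 : measurable_fun setT (fun x : mR * mR => w x.1 * w x.2).
Proof.
have mw : measurable_fun setT (w : mR -> R) by exact: continuous_measurable_fun.
by apply: measurable_funM; apply: (measurableT_comp mw);
  [exact: measurable_fst|exact: measurable_snd].
Qed.

Lemma integrable_oneDsqrV2 (M : R) :
  leb2.-integrable setT (fun x : mR * mR => (M * (w x.1 * w x.2))%:E).
Proof.
under eq_fun do rewrite EFinM.
apply: integrableZl => //; apply/integrableP; split; first exact/measurable_EFinP.
under eq_integral do rewrite gee0_abs ?lee_fin ?mulr_ge0//.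
rewrite /leb2 fubini_tonelli1//=; last 2 first.
- exact/measurable_EFinP.
- by move=> x; rewrite lee_fin mulr_ge0.
rewrite /fubini_F /=.
have mw : measurable_fun setT (EFin \o w : mR -> \bar R).
  by apply/measurable_EFinP; exact: (continuous_measurable_fun cw).
have J := integral_oneDsqrV; rewrite /leb1 -/w in J.
have J0 : (0 <= \int[lebesgue_measure]_x (w x)%:E)%E.
  by apply: integral_ge0 => x _; rewrite lee_fin.
rewrite (eq_integral (fun x : mR => (w x)%:E *
    \int[lebesgue_measure]_y (w y)%:E)%E); last first.
  move=> x _; under eq_integral do rewrite EFinM.
  by rewrite ge0_integralZl ?lee_fin// => y _; rewrite lee_fin.
rewrite ge0_integralZr//; last by move=> y _; rewrite lee_fin.
by apply: lte_mul_pinfty => //; rewrite ge0_fin_numE.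
Qed.

Lemma cRe_continuous : continuous (fun z : R[i]^o => complex.Re z : R^o).
Proof.
move=> z; apply/(@cvgrPdist_lt R R^o _ _ (@nbhs_filter R[i]^o z)) => e e0.
have : \forall t \near (z : R[i]^o), `|z - t| < (e%:C)%C.
  apply: (@nbhsx_ballx R[i] R[i]^o z (e%:C)%C).
  by rewrite ltcR.
apply: (@filterS _ _ (@nbhs_filter R[i]^o z)) => t; rewrite normc_def ltcR; apply: le_lt_trans.
rewrite -sqrtr_sqr; case: z t => [a b] [c d] /=.
by apply: ler_wsqrtr; rewrite lerDl sqr_ge0.
Qed.

Lemma cIm_continuous : continuous (fun z : R[i]^o => complex.Im z : R^o).
Proof.
move=> z; apply/(@cvgrPdist_lt R R^o _ _ (@nbhs_filter R[i]^o z)) => e e0.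
have : \forall t \near (z : R[i]^o), `|z - t| < (e%:C)%C.
  apply: (@nbhsx_ballx R[i] R[i]^o z (e%:C)%C).
  by rewrite ltcR.
apply: (@filterS _ _ (@nbhs_filter R[i]^o z)) => t; rewrite normc_def ltcR; apply: le_lt_trans.
rewrite -sqrtr_sqr; case: z t => [a b] [c d] /=.
by apply: ler_wsqrtr; rewrite lerDr sqr_ge0.
Qed.

Lemma schwartz2_bound f (m : nat * nat) : is_schwartz2 f ->
  exists M : R, forall x, `|x.1 ^+ m.1 * x.2 ^+ m.2| * cmod (f x) <= M * (w x.1 * w x.2).
Proof.
move=> [_ /(_ (m.1 + m.2 + 4, (0, 0))%N) /wsup_ltyP[M fM]]; exists M => -[x y].
have {fM} /= fM := fM (x, y) I.
set j := jap2 (x, y).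
have j1 : 1 <= j.
  by rewrite -[leLHS]sqrtr1 ler_wsqrtr// lerDl addr_ge0// sqr_ge0.
have j2 : j ^+ 2 = 1 + (x ^+ 2 + y ^+ 2).
  by rewrite sqr_sqrtr// !addr_ge0// sqr_ge0.
have xj : `|x| <= j.
  by rewrite -sqrtr_sqr ler_wsqrtr//= addrCA lerDl addr_ge0// sqr_ge0.
have yj : `|y| <= j.
  by rewrite -sqrtr_sqr ler_wsqrtr//= addrA lerDr addr_ge0// sqr_ge0.
have f0 : 0 <= cmod (f (x, y)) by case: (f _) => ? ?; exact: sqrtr_ge0.
rewrite /w -invfM ler_pdivlMr; last first.
  by rewrite mulr_gt0// ltr_wpDr// sqr_ge0.
apply: le_trans fM; rewrite mulrAC ler_wpM2r// !exprD normrM !normrX -!mulrA.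
have j0 : 0 <= j by exact: le_trans j1.
rewrite -/j ler_pM ?mulr_ge0 ?exprn_ge0 ?addr_ge0 ?sqr_ge0// ?lerXn2r//.
rewrite ler_pM ?mulr_ge0 ?exprn_ge0 ?addr_ge0 ?sqr_ge0// ?lerXn2r//.
rewrite (_ : 4 = 2 + 2)%N// exprD j2.
by rewrite ler_pM ?addr_ge0 ?sqr_ge0// lerD2l ?lerDl ?lerDr sqr_ge0.
Qed.


Lemma schwartz2_moment_integrable f (m : nat * nat) : is_schwartz2 f ->
  leb2.-integrable setT (fun x : mR * mR =>
    (complex.Re ((x.1 ^+ m.1 * x.2 ^+ m.2)%:C%C * f x))%:E) /\
  leb2.-integrable setT (fun x : mR * mR =>
    (complex.Im ((x.1 ^+ m.1 * x.2 ^+ m.2)%:C%C * f x))%:E).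
Proof.
move=> Sf; have [M fM] := schwartz2_bound m Sf.
have [sf _] := Sf.
have cf : continuous f.
  by move=> x; have [//|] := sf [::] _ x I.
have mfR : measurable_fun setT (fun x : mR * mR => complex.Re (f x)).
  apply: continuous_measurable_fun2 => x.
  exact: (continuous_comp (cf x) (@cRe_continuous _)).
have mfI : measurable_fun setT (fun x : mR * mR => complex.Im (f x)).
  apply: continuous_measurable_fun2 => x.
  exact: (continuous_comp (cf x) (@cIm_continuous _)).
have mp : measurable_fun setT (fun x : mR * mR => x.1 ^+ m.1 * x.2 ^+ m.2).
  by apply: measurable_funM; apply: measurable_funX;
    [exact: measurable_fst|exact: measurable_snd].
have RE (r : R) (z : R[i]) : complex.Re (r%:C%C * z) = r * complex.Re z.
  by case: z => a b /=; rewrite mul0r subr0.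
have IE (r : R) (z : R[i]) : complex.Im (r%:C%C * z) = r * complex.Im z.
  by case: z => a b /=; rewrite mul0r addr0.
split; apply: le_integrable (integrable_oneDsqrV2 M) => //.
- by apply/measurable_EFinP; under eq_fun do rewrite RE; exact: measurable_funM.
- move=> x _; rewrite RE /= lee_fin normrM; apply: le_trans (ler_norm _).
  apply: le_trans (fM x); rewrite ler_wpM2l//.
  by case: (f x) => a b /=; rewrite -sqrtr_sqr ler_wsqrtr// lerDl sqr_ge0.
- by apply/measurable_EFinP; under eq_fun do rewrite IE; exact: measurable_funM.
- move=> x _; rewrite IE /= lee_fin normrM; apply: le_trans (ler_norm _).
  apply: le_trans (fM x); rewrite ler_wpM2l//.
  by case: (f x) => a b /=; rewrite -sqrtr_sqr ler_wsqrtr// lerDr sqr_ge0.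
Qed.

Lemma cintegral_lin d (T : measurableType d) (mu : {measure set T -> \bar R})
    (a : R[i]) (f g : T -> R[i]^o) :
  mu.-integrable setT (fun x => (complex.Re (f x))%:E) ->
  mu.-integrable setT (fun x => (complex.Im (f x))%:E) ->
  mu.-integrable setT (fun x => (complex.Re (g x))%:E) ->
  mu.-integrable setT (fun x => (complex.Im (g x))%:E) ->
  cintegral mu setT (fun x => a * f x + g x) =
  a * cintegral mu setT f + cintegral mu setT g.
Proof.
case: a => a1 a2 fR fI gR gI; rewrite /cintegral.
have E1 x : complex.Re ((a1 +i* a2)%C * f x + g x) =
    a1 * complex.Re (f x) - a2 * complex.Im (f x) + complex.Re (g x).
  by case: (f x) (g x) => ? ? [].
have E2 x : complex.Im ((a1 +i* a2)%C * f x + g x) =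
    a1 * complex.Im (f x) + a2 * complex.Re (f x) + complex.Im (g x).
  by case: (f x) (g x) => ? ? [].
have Z (b : R) (h : T -> R) : mu.-integrable setT (fun x => (h x)%:E) ->
    mu.-integrable setT (fun x => (b * h x)%:E).
  by move=> ih; under eq_fun do rewrite EFinM; exact: integrableZl.
have B (h k : T -> R) : mu.-integrable setT (fun x => (h x)%:E) ->
    mu.-integrable setT (fun x => (k x)%:E) ->
    mu.-integrable setT (fun x => (h x - k x)%:E).
  by move=> ih ik; under eq_fun do rewrite EFinB; exact: integrableB.
have D (h k : T -> R) : mu.-integrable setT (fun x => (h x)%:E) ->
    mu.-integrable setT (fun x => (k x)%:E) ->
    mu.-integrable setT (fun x => (h x + k x)%:E).
  by move=> ih ik; under eq_fun do rewrite EFinD; exact: integrableD.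
under eq_Rintegral do rewrite E1.
under [X in (_ +i* X)%C]eq_Rintegral do rewrite E2.
rewrite RintegralD//; [|exact: B (Z _ _ fR) (Z _ _ fI)].
rewrite RintegralB//; [|exact: Z|exact: Z].
rewrite !RintegralZl//.
rewrite RintegralD//; [|exact: D (Z _ _ fI) (Z _ _ fR)].
rewrite RintegralD//; [|exact: Z|exact: Z].
by rewrite !RintegralZl.
Qed.

End integrability.

Section schwartz2_space.
Context {R : realType}.
Implicit Types (f g : R * R -> R[i]^o).

Let jap2_ge0 (k : nat) (x : R * R) : 0 <= jap2 x ^+ k.
Proof. by rewrite exprn_ge0// sqrtr_ge0. Qed.

Lemma is_schwartz2_lin (a : R[i]) f g :
  is_schwartz2 f -> is_schwartz2 g -> is_schwartz2 (a *: f + g).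
Proof.
move=> [sf nf] [sg ng]; split; first exact: (smooth_on_lin a openT sf sg).
move=> i; apply: (wsup_lin (a := a) _ _ (nf i) (ng i)) => // x _.
apply: (cpartials_lin a openT sf sg) => //; rewrite /multi2 => v.
by rewrite mem_cat !mem_nseq !inE; case/orP => /andP[_ ->]; rewrite ?orbT.
Qed.

Lemma is_schwartz20 : is_schwartz2 (0 : R * R -> R[i]^o).
Proof.
split=> [|i]; first exact: smooth_on0.
by rewrite /schwartz2_norm cpartials0; exact: wsup0.
Qed.

Definition schwartz2_pred : {pred R * R -> R[i]^o} :=
  mem [set f | is_schwartz2 f].

Lemma schwartz2_pred_submod : submod_closed schwartz2_pred.
Proof.
split=> [|a f g]; rewrite !inE; first exact: is_schwartz20.
exact: is_schwartz2_lin.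
Qed.

HB.instance Definition _ := GRing.isSubmodClosed.Build _ _ schwartz2_pred
  schwartz2_pred_submod.

End schwartz2_space.

Record schwartz2 (R : realType) := Schwartz2 {
  schwartz2_fun :> R * R -> R[i]^o ;
  _ : schwartz2_fun \in schwartz2_pred }.

Section schwartz2_structures.
Context {R : realType}.
HB.instance Definition _ := [isSub for @schwartz2_fun R].
HB.instance Definition _ := [Choice of schwartz2 R by <:].
HB.instance Definition _ := [SubChoice_isSubLmodule of schwartz2 R by <:].
HB.instance Definition _ := @isSubBaseTopological.Build (schwartz2 R)
  (set (schwartz2 R))
  (seminorm_subbase (fun i (f : schwartz2 R) => schwartz2_norm i f)) id.
End schwartz2_structures.

Section lizorkin2_pred.
Context {R : realType}.

Definition lizorkin2_pred : {pred schwartz2 R} :=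
  mem [set f : schwartz2 R | vanishing_moments2 f].

Lemma lizorkin2_pred_submod : submod_closed lizorkin2_pred.
Proof.
have zE m : (fun x : R * R => (x.1 ^+ m.1 * x.2 ^+ m.2)%:C%C
    * (0 : schwartz2 R) x) = fun=> 0.
  by apply/funext => x; exact: mulr0.
split=> [|a f g].
  rewrite inE => m; rewrite zE /cintegral.
  by congr (_ +i* _)%C; rewrite /Rintegral integral0_eq.
rewrite !inE => f0 g0 m; have /set_mem Sf := valP f; have /set_mem Sg := valP g.
have [fR fI] := schwartz2_moment_integrable m Sf.
have [gR gI] := schwartz2_moment_integrable m Sg.
have := cintegral_lin a fR fI gR gI.
rewrite f0 g0 mulr0 addr0 => <-; congr (cintegral _ _ _).
apply/funext => x; rewrite mulrCA -mulrDr; congr (_ * _).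
Qed.

HB.instance Definition _ := GRing.isSubmodClosed.Build _ _ lizorkin2_pred
  lizorkin2_pred_submod.

End lizorkin2_pred.

Record lizorkin2 (R : realType) := Lizorkin2 {
  lizorkin2_schwartz :> schwartz2 R ;
  _ : lizorkin2_schwartz \in lizorkin2_pred }.

Section lizorkin2_structures.
Context {R : realType}.
HB.instance Definition _ := [isSub for @lizorkin2_schwartz R].
HB.instance Definition _ := [Choice of lizorkin2 R by <:].
HB.instance Definition _ := [SubChoice_isSubLmodule of lizorkin2 R by <:].
HB.instance Definition _ := Topological.copy (lizorkin2 R)
  (initial_topology (@lizorkin2_schwartz R)).
End lizorkin2_structures.

Section shschwartz_pred.
Context {R : realType}.
Local Notation S := (R * R * R * R)%type.

Lemma shdom_open : open (@shdom R).
Proof.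
rewrite (_ : shdom = snd @^-1` [set~ 0]).
  apply: open_comp; last exact/closed_openC/closed_eq.
  by move=> p _; exact: cvg_snd.
by apply/seteqP; split => p /= /eqP.
Qed.

Definition shschwartz_pred : {pred S -> R[i]^o} :=
  mem [set Phi | is_shschwartz Phi].

Lemma shschwartz_pred_submod : submod_closed shschwartz_pred.
Proof.
split=> [|c f g]; rewrite !inE.
  split=> // [|[[[[k1 k2] l] m] [[[al1 al2] be] ga]]]; first exact: smooth_on0.
  by rewrite /shnorm cpartials0; exact: wsup0.
move=> [f0 sf nf] [g0 sg ng]; split=> [p Np||].
- have -> : (c *: f + g) p = c * f p + g p :> R[i] by [].
  by rewrite f0// g0// mulr0 addr0.
- exact: (smooth_on_lin c shdom_open sf sg).
- move=> i; have := nf i; have := ng i.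
  case: i => [[[[k1 k2] l] m] [[[al1 al2] be] ga]] /= ni mi.
  apply: (wsup_lin (a := c) _ _ mi ni) => [[[[b1 b2] s] a]|x xS].
    by rewrite !mulr_ge0 ?exprn_ge0 ?sqrtr_ge0// addr_ge0// ?invr_ge0 exprn_ge0.
  apply: (cpartials_lin c shdom_open sf sg) => // v.
  rewrite !mem_cat !mem_nseq !inE.
  by case/or4P => /andP[_ ->]; rewrite ?orbT.
Qed.

HB.instance Definition _ := GRing.isSubmodClosed.Build _ _ shschwartz_pred
  shschwartz_pred_submod.

End shschwartz_pred.

Record shschwartz (R : realType) := ShSchwartz {
  shschwartz_fun :> R * R * R * R -> R[i]^o ;
  _ : shschwartz_fun \in shschwartz_pred }.

Section shschwartz_structures.
Context {R : realType}.
HB.instance Definition _ := [isSub for @shschwartz_fun R].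
HB.instance Definition _ := [Choice of shschwartz R by <:].
HB.instance Definition _ := [SubChoice_isSubLmodule of shschwartz R by <:].
HB.instance Definition _ := @isSubBaseTopological.Build (shschwartz R)
  (set (shschwartz R))
  (seminorm_subbase (fun i (f : shschwartz R) => shnorm i f)) id.
End shschwartz_structures.

(* von Neumann boundedness: B is absorbed by every neighbourhood of 0 *)
Definition vn_bounded {K : numFieldType} {E : preTopologicalLmodType K} :
    set (set E) :=
  [set B | forall U : set E, nbhs 0 U ->
    exists2 r : K, 0 < r & forall a : K, r <= `|a| ->
      B `<=` [set a *: u | u in U]].

Section dual_pred.
Context {K : numFieldType} (E : preTopologicalLmodType K).

Definition dual_pred : {pred E -> K^o} :=
  mem [set f : E -> K^o | linear f /\ continuous f].

Lemma dual_pred_submod : submod_closed dual_pred.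
Proof.
split=> [|a f g]; rewrite !inE.
  by split=> [b u v|]; [rewrite /= scaler0 addr0|exact: cst_continuous].
move=> [lf cf] [lg cg]; split=> [b u v|x].
  rewrite [LHS]/(a *: f (b *: u + v) + g (b *: u + v)) lf lg.
  suff : a * (b * f u + f v) + (b * g u + g v) =
    b * (a * f u + g u) + (a * f v + g v) :> K by [].
  by rewrite !mulrDr mulrCA addrACA.
exact: (@regular_cvg_lin K E (nbhs x) (nbhs_filter x) a f g _ _ (cf x) (cg x)).
Qed.

HB.instance Definition _ := GRing.isSubmodClosed.Build _ _ dual_pred
  dual_pred_submod.

End dual_pred.

Record dual (K : numFieldType) (E : preTopologicalLmodType K) := Dual {
  dual_fun :> E -> K^o ;
  _ : dual_fun \in @dual_pred K E }.

Section dual_structures.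
Context {K : numFieldType} (E : preTopologicalLmodType K).
HB.instance Definition _ := [isSub for @dual_fun K E].
HB.instance Definition _ := [Choice of dual E by <:].
HB.instance Definition _ := [SubChoice_isSubLmodule of dual E by <:].
(* strong dual topology: uniform convergence on the bounded sets *)
HB.instance Definition _ := Topological.copy (dual E)
  (initial_topology
    (@dual_fun K E : dual E -> {family vn_bounded, E -> K^o})).
End dual_structures.

Section shearlet.
Context {R : realType}.
Implicit Types (psi : R * R -> R[i]^o).

Definition admissible psi := inLp leb2 2%:E psi /\
  exists2 g, is_fourierL2_2 psi g &
    (0 < \int[leb2]_xi (cmod (g xi) ^+ 2 / `|xi.1| ^+ 2)%:E < +oo)%E.

Definition mx22 (a b c d : R) : 'M[R]_2 := \matrix_(i < 2, j < 2)
  if i == 0 then (if j == 0 then a else b) else (if j == 0 then c else d).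

Definition shear_mx (s : R) : 'M[R]_2 := mx22 1 (- s) 0 1.

Definition dilation_mx (a : R) : 'M[R]_2 :=
  a *: mx22 1 0 0 (`|a| `^ (- 2^-1)).

Definition mx_app (M : 'M[R]_2) (x : R * R) : R * R :=
  (M 0 0 * x.1 + M 0 1 * x.2, M 1 0 * x.1 + M 1 1 * x.2).

Definition shearlet psi (b : R * R) (s a : R) (x : R * R) : R[i] :=
  ((`|a| `^ (- (3 / 4)))%:C)%C *
  psi (mx_app (invmx (dilation_mx a)) (mx_app (invmx (shear_mx s)) (x - b))).

(* the synthesis operator with respect to the complex conjugate of psi *)
Definition synthesis psi (Phi : R * R * R * R -> R[i]) (x : R * R) : R[i] :=
  cintegral leb1 [set a | a != 0] (fun a =>
    cintegral leb1 setT (fun s =>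
      cintegral leb2 setT (fun b =>
        Phi (b, s, a) * (shearlet psi b s a x)^*%C / ((`|a| ^+ 3)%:C)%C))).

End shearlet.

(* Main.v *)
(* The shearlet transform is the transpose of the synthesis operator St.  Once
   St maps S(SS) linearly into S_0(R^2) with every Schwartz seminorm of St Phi
   dominated by one seminorm of Phi, St sends bounded sets to bounded sets, and
   its transpose is continuous for the strong dual topologies.

   Seminorms: St Phi is the integral of Phi against the kernels
   c(p) (d^n psi)(A_a^-1 S_s^-1 (x - b)), where c grows at most polynomially in
   the weight <b1><b2><s>(|a| + 1/|a|).  This family of kernels is stable under
   the partial derivatives in x, and the decay of Phi pays for the weight.

   Moments: by Fubini and an affine change of variables, the moments of St Phi
   vanish as soon as those of psi do.  All the moments of chi_1 vanish, so
   F chi_1(tau) = O(|tau|^N) for every N; hence F psi_1(tau) = O(|tau|^N) almost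
   everywhere, and F psi(xi) = O(|xi_1|^N) everywhere, as F psi is continuous and
   F psi_2 is bounded.  Along each ray (t, t v) the integrals of (x_1 + v x_2)^k psi
   are, up to factors, the Taylor coefficients at t = 0 of F psi, so they vanish,
   for every v.

   The L^2 Fourier transform of psi (resp. chi_1) is a limit in the mean; it is
   compared with the Fourier integral by pairing both with indicators of boxes,
   whose own Fourier integrals are explicit and square integrable. *)

Require Import Defs.
From HB Require Import structures.
From mathcomp Require Import all_boot all_order all_algebra.
From mathcomp Require Import all_classical all_reals all_analysis.
From mathcomp Require Import complex finmap measurable_realfun lra ring.

Set Implicit Arguments.
Unset Strict Implicit.
Unset Printing Implicit Defensive.

Import Order.TTheory GRing.Theory Num.Theory.
Import numFieldNormedType.Exports.
Local Open Scope classical_set_scope.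
Local Open Scope ring_scope.

(** * Transposes of maps bounded in seminorms *)

(** Integrals here are those of real functions, so complex identities are split into real and
    imaginary parts; this is why kernels, transforms and Taylor coefficients come in pairs. The
    Fourier hypotheses are existential: some unspecified sequence converges to the function while
    its transforms converge to the given version. What survives this limit is the multiplication
    formula, which moves the transform from the function to a test function h, as soon as h and its
    transform are both square integrable. The indicator of an interval qualifies because its
    transform is bounded and O(1/|x|). Equality of integrals over boxes then returns pointwise
    information: almost everywhere on the line, by differentiating primitives, and everywhere on the
    plane, for an inequality satisfied by a continuous function. A bound by powers of |xi_1| is what
    a ray (t, t v) can use, t being the expansion parameter; the freedom in v separates the
    monomials of a given degree. In the estimates of the synthesis, exponents and constants are
    chosen before Phi, which makes them bounds between seminorms. *)

Section seminorm_topology.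
Context {R : realType}.

Lemma open_shnorm_ball (i : shnorm_index) (u : shschwartz R) (e : R) : 0 < e ->
  open [set v : shschwartz R | (shnorm i ((v - u)%R : shschwartz R) < e%:E)%E].
Proof.
move=> e0.
set B := [set v : shschwartz R | _].
exists [set B]; last by rewrite bigcup_set1.
move=> _ ->; exists [fset B]%fset.
  by move=> C /[!inE] /eqP ->; apply/mem_set; exists i, u, e.
rewrite predeqE => v; split=> [h|Bv C /=]; last by rewrite inE => /eqP ->.
by apply: (h B); rewrite /= inE.
Qed.

(** A neighbourhood contains a finite intersection of members of the subbase around the point, so
    continuity can be tested on single seminorm balls. Their centres [u] are arbitrary, as in
    [seminorm_subbase]. *)
Lemma continuous_to_schwartz2 (T : topologicalType) (g : T -> schwartz2 R) :
  (forall i u (e : R), 0 < e ->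
     open [set t | (schwartz2_norm i ((g t - u)%R : schwartz2 R) < e%:E)%E]) ->
  continuous g.
Proof.
move=> H t A /=; rewrite nbhsE => -[_ [[D sD <-] [B DB Bt]] sA].
apply: (filterS sA); apply: (@filterS _ (g @ t) _ B) => [s Bs|]; first by exists B.
have /sD [F sF FB] := DB; rewrite -FB.
apply: filter_bigI => C CF.
have /sF /set_mem [i [u [e [e0 CE]]]] := CF.
have oC := H i u e e0.
apply: (open_nbhs_nbhs (conj _ _)); first by rewrite CE; exact: oC.
by move: Bt; rewrite -FB; apply.
Qed.

Lemma continuous_to_lizorkin2 (T : topologicalType) (g : T -> lizorkin2 R) :
  continuous (fun t => lizorkin2_schwartz (g t)) -> continuous g.
Proof.
by move=> cg; apply: (@continuous_comp_initial _ T _ (@lizorkin2_schwartz R) g).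
Qed.

Lemma schwartz2_normD (i : nat * (nat * nat)) (f g : schwartz2 R) :
  (schwartz2_norm i ((f + g)%R : schwartz2 R) <=
   schwartz2_norm i f + schwartz2_norm i g)%E.
Proof.
have /set_mem [sf _] := valP f; have /set_mem [sg _] := valP g.
apply: ge_ereal_sup => _ [x _ <-].
have -> : schwartz2_fun (f + g) = (1 : R[i]) *: schwartz2_fun f + schwartz2_fun g.
  by rewrite scale1r.
rewrite (cpartials_lin 1 openT sf sg) //; last first.
  move=> v; rewrite mem_cat !mem_nseq !inE.
  by case/orP => /andP[_ ->]; rewrite ?orbT.
apply: (@le_trans _ _ ((jap2 x ^+ i.1 * cmod (cpartials (multi2 i.2) f x))%:E +
  (jap2 x ^+ i.1 * cmod (cpartials (multi2 i.2) g x))%:E)%E).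
  rewrite -EFinD lee_fin -mulrDr ler_wpM2l ?exprn_ge0 ?sqrtr_ge0//.
  by rewrite scale1r; exact: le_normcD.
by apply: leeD; apply: ereal_sup_ubound; exists x.
Qed.

Lemma schwartz2_norm_ge0 (i : nat * (nat * nat)) (f : R * R -> R[i]^o) :
  (0 <= schwartz2_norm i f)%E.
Proof.
apply: (@le_trans _ _ (jap2 (0, 0) ^+ i.1 * cmod (cpartials (multi2 i.2) f (0, 0)))%:E).
  rewrite lee_fin mulr_ge0 ?exprn_ge0 ?sqrtr_ge0//.
  by case: (cpartials _ _ _) => ? ?; exact: sqrtr_ge0.
by apply: ereal_sup_ubound; exists (0, 0).
Qed.

Variable St : shschwartz R -> lizorkin2 R.
Hypothesis St_lin : linear St.
Hypothesis St_bound : forall i, exists j (C : R), 0 <= C /\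
  forall Phi : shschwartz R,
    (schwartz2_norm i (lizorkin2_schwartz (St Phi)) <= C%:E * shnorm j Phi)%E.

(** Subbasic balls need not be centred at the image point, so openness of the preimage at [Phi0]
    exploits the gap left between the seminorm of [St Phi0 - u] and [e]. *)
Lemma seminorm_bound_continuous : continuous St.
Proof.
apply: continuous_to_lizorkin2; apply: continuous_to_schwartz2 => i u e e0.
have [j [C [C0 SC]]] := St_bound i.
rewrite openE => Phi0 /=; set p0 := schwartz2_norm i _ => p0e.
have p00 : (0 <= p0)%E by exact: schwartz2_norm_ge0.
have p0f : p0 \is a fin_num by rewrite ge0_fin_numE// (lt_trans p0e)// ltry.
(* Division by [C + 1] keeps the radius positive even when [C = 0]. *)
pose d := (e - fine p0) / (C + 1).
have d0 : 0 < d.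
  apply: divr_gt0; last by rewrite ltr_wpDl.
  by rewrite subr_gt0 -lte_fin fineK.
have nP : nbhs Phi0 [set v : shschwartz R | (shnorm j ((v - Phi0)%R : shschwartz R) < d%:E)%E].
  apply: open_nbhs_nbhs; split; first exact: open_shnorm_ball.
  rewrite /= subrr; case: (j) => [[[[k1 k2] l] m] [[[al1 al2] be] ga]] /=.
  rewrite cpartials0 /wsup; apply: le_lt_trans (_ : (0%:E < _)%E); last by rewrite lte_fin.
  apply: ge_ereal_sup => _ [x _ <-]; rewrite lee_fin.
  by rewrite (_ : cmod _ = 0) ?mulr0//; exact: ComplexField.Normc.normc0.
apply: filterS nP => Phi /= Pd.
rewrite -[X in schwartz2_norm i X]/(schwartz2_fun (lizorkin2_schwartz (St Phi) - u)).
have -> : (lizorkin2_schwartz (St Phi) - u)%R =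
   (lizorkin2_schwartz (St (Phi - Phi0)) + (lizorkin2_schwartz (St Phi0) - u))%R.
  have -> : St (Phi - Phi0) = St Phi - St Phi0.
    by rewrite addrC -scaleN1r St_lin scaleN1r addrC.
  rewrite addrA; congr (_ - _).
  by rewrite -[LHS](subrK (lizorkin2_schwartz (St Phi0))).
apply: le_lt_trans (schwartz2_normD _ _ _) _.
rewrite -/p0 -(fineK p0f) -lteBrDr// -EFinB.
apply: le_lt_trans (SC _) _.
have [->|Cn0] := eqVneq C 0; first by rewrite mul0e lte_fin subr_gt0 -lte_fin fineK.
have Cp : 0 < C by rewrite lt_neqAle eq_sym Cn0.
rewrite -lte_pdivlMl//; apply: lt_le_trans Pd _.
rewrite -EFinM lee_fin /d mulrC ler_pM2r ?subr_gt0 -?lte_fin ?fineK//.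
by rewrite lef_pV2 ?posrE ?ltr_wpDl// lerDl.
Qed.

(** The preimage of a neighbourhood of 0 is a neighbourhood of 0, and linearity carries the
    absorption of [B] by it over to the image, with the same radius. *)
Lemma vn_bounded_image (B : set (shschwartz R)) :
  vn_bounded B -> vn_bounded (St @` B).
Proof.
move=> bB U nU.
have S0 : St 0 = 0 by have := St_lin (-1) 0 0; rewrite scaler0 addr0 scaleN1r addNr.
have nV : nbhs (0 : shschwartz R) (St @^-1` U).
  by apply: seminorm_bound_continuous; rewrite S0.
have [r r0 rB] := bB _ nV; exists r => // a ra _ [u Bu <-].
have [v Uv <-] := rB a ra u Bu; exists (St v) => //.
by have := St_lin a v 0; rewrite S0 !addr0.
Qed.

Lemma dual_comp_subproof (f : dual (lizorkin2 R)) :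
  (fun Phi => f (St Phi) : R[i]^o) \in @dual_pred R[i] (shschwartz R).
Proof.
have /set_mem [lf cf] := valP f; apply/mem_set; split=> [a u v|x].
  by rewrite St_lin lf.
apply: (@continuous_comp _ _ _ St f); first exact: seminorm_bound_continuous.
exact: cf.
Qed.

Definition dual_comp (f : dual (lizorkin2 R)) : dual (shschwartz R) :=
  Dual (dual_comp_subproof f).

Lemma dual_comp_linear : linear dual_comp.
Proof. by move=> a f g; apply: val_inj. Qed.

(** A bounded set [A] has a bounded image under [St], and uniform closeness of two functionals on
    this image is uniform closeness of their transposes on [A]. *)
Lemma dual_comp_continuous : continuous dual_comp.
Proof.
apply: (@continuous_comp_initial (dual (shschwartz R)) (dual (lizorkin2 R))
  {family vn_bounded, shschwartz R -> R[i]^o} (@dual_fun R[i] (shschwartz R)) dual_comp).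
move=> f; apply/fam_cvgP; first exact: (@fmap_filter _ _ _ (nbhs f) (nbhs_filter f)).
move=> A bA.
have := @initial_continuous (dual (lizorkin2 R))
  {family vn_bounded, lizorkin2 R -> R[i]^o} (@dual_fun R[i] (lizorkin2 R)) f.
move=> /(fam_cvgP _ _ (@fmap_filter _ _ _ (nbhs f) (nbhs_filter f))).
move=> /(_ _ (vn_bounded_image bA)) cfA.
move=> P /uniform_nbhs [E [entE sE]].
have := cfA [set h | forall y, (St @` A) y -> E (f y, h y)].
rewrite !nbhs_simpl /= => /(_ _)/filterS; apply; last first.
  by apply/uniform_nbhs; exists E; split.
by move=> g /= Eg; apply: sE => y Ay; apply: Eg; exists y.
Qed.
End seminorm_topology.

Lemma integrable_EFinZl d (T : measurableType d) (R : realType)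
    (m : {measure set T -> \bar R}) (D : set T) (r : R) (f : T -> R) : measurable D ->
  m.-integrable D (EFin \o f) -> m.-integrable D (EFin \o (fun x => r * f x)).
Proof.
move=> mD intf; rewrite (_ : _ \o _ = (fun x => r%:E * (EFin \o f) x)%E)//.
exact: integrableZl.
Qed.

(** * Integration and differentiation on R, R^2 and R^4 *)

Section parametric_integrals.
Context d1 d2 (T1 : measurableType d1) (T2 : measurableType d2) (R : realType).

(** Tonelli applies separately to the positive and negative parts; their difference, and its real
    value [fine], remain measurable even where an integral is infinite. *)
Lemma measurable_param_Rintegral (m : {sigma_finite_measure set T2 -> \bar R})
    (G : T1 * T2 -> R) : measurable_fun setT G ->
  measurable_fun setT (fun x => \int[m]_y G (x, y)).
Proof.
move=> mG.
have mE : measurable_fun setT (EFin \o G) by exact/measurable_EFinP.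
apply: (@measurableT_comp _ _ _ _ _ _ (@fine R)) => //.
rewrite [X in measurable_fun _ X](_ : _ = fun x =>
  (\int[m]_y ((EFin \o G)^\+ (x, y)) - \int[m]_y ((EFin \o G)^\- (x, y)))%E).
  apply: emeasurable_funB.
  - apply: (measurable_fun_fubini_tonelli_F (m2 := m) (EFin \o G)^\+%E) => //.
    exact: measurable_funepos.
  - apply: (measurable_fun_fubini_tonelli_F (m2 := m) (EFin \o G)^\-%E) => //.
    exact: measurable_funeneg.
apply/funext => x; rewrite [LHS]integralE.
by congr (_ - _)%E; apply: eq_integral => y _; rewrite ?funeposE ?funenegE.
Qed.

Variables (m1 : {sigma_finite_measure set T1 -> \bar R})
  (m2 : {sigma_finite_measure set T2 -> \bar R}).

(* The library's sigma-finite instance on [_ \x _] is hidden by the one for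
   subprobabilities, hence this named copy. *)
Definition sprod : set (T1 * T2) -> \bar R := (m1 \x m2)%E.

HB.instance Definition _ := Measure.on sprod.

Let sprod_sigma_finite : sigma_finite setT sprod.
Proof.
have /sigma_finiteP[F [TF ndF Foo]] := sigma_finiteT m1.
have /sigma_finiteP[G [TG ndG Goo]] := sigma_finiteT m2.
exists (fun n => F n `*` G n) => [|n].
  apply/seteqP; split=> // -[x y] _.
  have [i _ Fx] : (\bigcup_i F i) x by rewrite -TF.
  have [j _ Gy] : (\bigcup_i G i) y by rewrite -TG.
  exists (maxn i j) => //; split => /=.
    by have /subsetPset := ndF _ _ (leq_maxl i j); exact.
  by have /subsetPset := ndG _ _ (leq_maxr i j); exact.
have [mF Fn] := Foo n; have [mG Gn] := Goo n; split; first exact: measurableX.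
rewrite /sprod /= product_measure1E//.
by apply: lte_mul_pinfty => //; rewrite ge0_fin_numE.
Qed.

HB.instance Definition _ := Measure_isSigmaFinite.Build _ _ _ sprod
  sprod_sigma_finite.

(** The inner extended integral is finite for almost every [y] only, so passing to real values
    inside the outer integral is an equality almost everywhere. *)
Lemma Rintegral_fubini21 (f : T1 * T2 -> R) :
  sprod.-integrable setT (EFin \o f) ->
  \int[m2]_y \int[m1]_x f (x, y) = \int[sprod]_z f z.
Proof.
move=> intf; rewrite /Rintegral -(integral21_prod_meas1 intf).
congr fine; apply: ae_eq_integral => //.
- apply/measurable_EFinP/(@measurableT_comp _ _ _ _ _ _ (@fine R)) => //.
  exact: (measurable_fubini_G intf).
- exact: (measurable_fubini_G intf).
have := ae_integrable2 intf; apply: filterS => y iy _.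
by rewrite fineK //; exact: integrable_fin_num.
Qed.

Lemma Rintegral_fubini12 (f : T1 * T2 -> R) :
  sprod.-integrable setT (EFin \o f) ->
  \int[m1]_x \int[m2]_y f (x, y) = \int[sprod]_z f z.
Proof.
move=> intf; rewrite /Rintegral -(integral12_prod_meas1 intf).
congr fine; apply: ae_eq_integral => //.
- apply/measurable_EFinP/(@measurableT_comp _ _ _ _ _ _ (@fine R)) => //.
  exact: (measurable_fubini_F intf).
- exact: (measurable_fubini_F intf).
have := ae_integrable1 intf; apply: filterS => y iy _.
by rewrite fineK //; exact: integrable_fin_num.
Qed.

Lemma integrable_tensor (f : T1 -> R) (g : T2 -> R) :
  m1.-integrable setT (EFin \o f) -> m2.-integrable setT (EFin \o g) ->
  sprod.-integrable setT (EFin \o (fun x => f x.1 * g x.2)).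
Proof.
move=> intf intg.
have mf : measurable_fun setT f by exact/measurable_EFinP/(measurable_int m1).
have mg : measurable_fun setT g by exact/measurable_EFinP/(measurable_int m2).
have mfg : measurable_fun setT (fun x : T1 * T2 => f x.1 * g x.2).
  apply: measurable_funM.
    exact: (measurableT_comp mf measurable_fst).
  exact: (measurableT_comp mg measurable_snd).
apply/integrable12ltyP; first exact/measurable_EFinP.
have /integrableP[_ f1] := intf; have /integrableP[_ g1] := intg.
rewrite (eq_integral (fun x => `|(f x)%:E| * \int[m2]_y `|(g y)%:E|)%E).
  rewrite ge0_integralZr//; last by apply: integral_ge0.
    by apply: lte_mul_pinfty => //; [exact: integral_ge0|rewrite ge0_fin_numE// integral_ge0].
  by apply: measurableT_comp => //; exact/measurable_EFinP.
move=> x _; rewrite -ge0_integralZl//.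
  by apply: eq_integral => y _ /=; rewrite -EFinM normrM.
by apply: measurableT_comp => //; exact/measurable_EFinP.
Qed.

Lemma Rintegral_tensor (f : T1 -> R) (g : T2 -> R) :
  m1.-integrable setT (EFin \o f) -> m2.-integrable setT (EFin \o g) ->
  \int[sprod]_z (f z.1 * g z.2) = (\int[m1]_x f x) * (\int[m2]_y g y).
Proof.
move=> intf intg; rewrite -Rintegral_fubini12; last exact: integrable_tensor.
rewrite -RintegralZr//.
by apply: eq_Rintegral => x _ /=; rewrite RintegralZl.
Qed.

End parametric_integrals.

(** * Affine changes of variable on the line *)

Section affine_change_of_variables.
Context {R : realType}.
Local Notation mu := (@lebesgue_measure R).
Local Notation mR := (measurableTypeR R).
Variables (c d : R).
Hypothesis c0 : c != 0.

Let phi (x : mR) : mR := c * x + d.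

Let mphi : measurable_fun setT phi.
Proof. by apply: measurable_funD => //; exact: measurable_funM. Qed.

Let normc_ge0 : 0 <= `|c|. Proof. exact: normr_ge0. Qed.

Definition affine_pushforward : set mR -> \bar R := pushforward mu phi.

Let nu0 : affine_pushforward set0 = 0%E.
Proof. by rewrite /affine_pushforward /pushforward preimage_set0 measure0. Qed.

Let nu_ge0 A : (0 <= affine_pushforward A)%E.
Proof. exact: measure_ge0. Qed.

Let nu_sigma_additive : semi_sigma_additive affine_pushforward.
Proof.
move=> F mF tF mUF; rewrite /affine_pushforward /pushforward.
have mp n : measurable (phi @^-1` F n) by rewrite -[X in measurable X]setTI; exact: mphi.
rewrite preimage_bigcup.
apply: measure_semi_sigma_additive => //; last exact: bigcupT_measurable.
apply/trivIsetP => /= i j _ _ ij; rewrite -preimage_setI.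
by move/trivIsetP : tF => /(_ _ _ _ _ ij) ->//; rewrite preimage_set0.
Qed.

HB.instance Definition _ := isMeasure.Build _ _ _ affine_pushforward
  nu0 nu_ge0 nu_sigma_additive.

(** Lebesgue measure is determined by its values on half-open intervals. For [c < 0] the preimage is
    closed on the other side, which leaves its length unchanged. *)
Lemma lebesgue_measure_affine (A : set mR) : measurable A ->
  mu A = mscale (NngNum normc_ge0) affine_pushforward A.
Proof.
apply: lebesgue_measure_unique => _ [[a b] _ <-] /=.
rewrite /mscale /= /affine_pushforward /pushforward.
have [cp|cn] : 0 < c \/ c < 0.
  by move: c0; rewrite neq_lt => /orP[->|->]; [right|left].
- rewrite (_ : _ @^-1` _ = `](a - d) / c, (b - d) / c]%classic); last first.
    apply/seteqP; split=> x; rewrite /= !in_itv /= ltr_pdivrMr// ler_pdivlMr//.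
      by rewrite ltrBlDr lerBrDr mulrC.
    by rewrite ltrBlDr lerBrDr mulrC.
  rewrite !lebesgue_measure_itv /= !lte_fin ltr_pM2r ?invr_gt0// ltrD2r.
  case: ifPn => _; last by rewrite mule0.
  rewrite -!EFinB -EFinM gtr0_norm//; congr EFin; field.
  by rewrite gt_eqF.
- rewrite (_ : _ @^-1` _ = `[(b - d) / c, (a - d) / c[%classic); last first.
    apply/seteqP; split=> x; rewrite /= !in_itv /= ltr_ndivlMr// ler_ndivrMr//.
      by rewrite ltrBlDr lerBrDr mulrC andbC.
    by rewrite ltrBlDr lerBrDr mulrC andbC.
  rewrite !lebesgue_measure_itv /= !lte_fin ltr_nM2r ?invr_lt0// ltrD2r.
  case: ifPn => _; last by rewrite mule0.
  rewrite -!EFinB -EFinM ltr0_norm//; congr EFin; field.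
  by rewrite lt_eqF.
Qed.

Lemma ge0_integral_affine (f : mR -> \bar R) : measurable_fun setT f ->
  (forall x, 0 <= f x)%E ->
  (\int[mu]_x f x = `|c|%:E * \int[mu]_x f (c * x + d)%R)%E.
Proof.
move=> mf f0.
rewrite (eq_measure_integral (mscale (NngNum normc_ge0) affine_pushforward)); last first.
  by move=> A mA _; exact: lebesgue_measure_affine.
rewrite ge0_integral_mscale//; congr (_ * _)%E.
exact: (ge0_integral_pushforward mphi mu measurableT mf (fun x _ => f0 x)).
Qed.

(** The nonnegative case applies to both parts of [f]; integrability after the substitution makes
    the two integrals finite, so that their real values can be subtracted. *)
Lemma Rintegral_affine (f : mR -> R) : measurable_fun setT f ->
  mu.-integrable setT (fun x => (f (c * x + d))%:E) ->
  \int[mu]_x f x = `|c| * \int[mu]_x f (c * x + d).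
Proof.
move=> mf intf; rewrite /Rintegral integralE [in RHS]integralE.
have mE : measurable_fun setT (EFin \o f) by exact/measurable_EFinP.
rewrite (@ge0_integral_affine (EFin \o f)^\+%E)//; last exact: measurable_funepos.
rewrite (@ge0_integral_affine (EFin \o f)^\-%E)//; last exact: measurable_funeneg.
have ip : (\int[mu]_x (EFin \o f)^\+ (c * x + d)%R)%E \is a fin_num.
  rewrite (_ : integral _ _ _ = (\int[mu]_x ((fun x => (f (c * x + d))%:E)^\+ x))%E).
    exact: (integrable_pos_fin_num (@measurableT _ _) intf).
  by apply: eq_integral => x _; rewrite !funeposE.
have iN : (\int[mu]_x (EFin \o f)^\- (c * x + d)%R)%E \is a fin_num.
  rewrite (_ : integral _ _ _ = (\int[mu]_x ((fun x => (f (c * x + d))%:E)^\- x))%E).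
    exact: (integrable_neg_fin_num (@measurableT _ _) intf).
  by apply: eq_integral => x _; rewrite !funenegE.
rewrite fineB ?fin_numM// !fineM// -mulrBr; congr (_ * _).
by rewrite -fineB//; congr (fine (_ - _)); apply: eq_integral => x _; rewrite ?funeposE ?funenegE.
Qed.

End affine_change_of_variables.

(** * Measurability on R^4 *)

Section continuous_measurable4.
Context {R : realType}.
Local Notation mR := (measurableTypeR R).

(** An open set is the union of the boxes with rational endpoints that it contains. These boxes are
    enumerated by their codes; the remaining codes give the empty set. *)
Lemma open_measurable4 (U : set (R * R * R * R)) :
  open U -> measurable (U : set (mR * mR * mR * mR)).
Proof.
move=> oU.
pose box (p : (rat * rat) * (rat * rat) * (rat * rat) * (rat * rat)) :
    set (mR * mR * mR * mR) :=
  `]ratr p.1.1.1.1, ratr p.1.1.1.2[%classic `*` `]ratr p.1.1.2.1, ratr p.1.1.2.2[%classic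
  `*` `]ratr p.1.2.1, ratr p.1.2.2[%classic `*` `]ratr p.2.1, ratr p.2.2[%classic.
pose A n : set (mR * mR * mR * mR) := if choice.unpickle n is Some p then
  if `[< box p `<=` U >] then box p else set0 else set0.
rewrite (_ : U = \bigcup_n A n).
  apply: bigcupT_measurable => n; rewrite /A.
  case: choice.unpickle => [p|]; last exact: measurable0.
  case: ifPn => _; last exact: measurable0.
  apply: measurableX; last exact: measurable_itv.
  apply: measurableX; last exact: measurable_itv.
  by apply: measurableX; exact: measurable_itv.
apply/seteqP; split => [[[[x y] z] t] Uxy|x [n _]]; last first.
  by rewrite /A; case: choice.unpickle => // p; case: asboolP => // pU /pU.
have /nbhs_ballP[e /= e0 eU] : nbhs (x, y, z, t) U by exact: open_nbhs_nbhs.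
have rat2 (w : R) : exists p : rat * rat,
    [/\ w - e < ratr p.1, ratr p.1 < w, w < ratr p.2 & ratr p.2 < w + e].
  have /rat_in_itvoo[p /itvP hp] : w - e < w by rewrite ltrBlDr ltrDl.
  have /rat_in_itvoo[q /itvP hq] : w < w + e by rewrite ltrDl.
  by exists (p, q); rewrite !(hp, hq).
have [p1 [p1a p1b p1c p1d]] := rat2 x; have [p2 [p2a p2b p2c p2d]] := rat2 y.
have [p3 [p3a p3b p3c p3d]] := rat2 z; have [p4 [p4a p4b p4c p4d]] := rat2 t.
exists (choice.pickle (p1, p2, p3, p4)); [exact: I|]; rewrite /A choice.pickleK.
case: asboolP => [_|nU].
  by rewrite /box /= !in_itv /= p1b p1c p2b p2c p3b p3c p4b p4c.
exfalso; apply: nU => -[[[u1 u2] u3] u4] /=; rewrite /box /= !in_itv /=.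
move=> [[[/andP[u1a u1b] /andP[u2a u2b]] /andP[u3a u3b]] /andP[u4a u4b]].
have B (a b : R) : a - e < b -> b < a + e -> ball a e b.
  by move=> h1 h2; rewrite /ball /= ltr_norml; apply/andP; split; lra.
apply: eU; do !split => /=; apply: B; lra.
Qed.

(** The preimage of an open interval is an open subset of [shdom], plus the whole complement of
    [shdom] exactly when the interval contains 0. *)
Lemma shdom_continuous_measurable (P : R * R * R * R -> R) :
  (forall p, ~ shdom p -> P p = 0) ->
  (forall p, shdom p -> {for p, continuous P}) ->
  measurable_fun setT (P : mR * mR * mR * mR -> R).
Proof.
move=> P0 cP; apply: (measurability _ (RGenOpens.measurableE R)).
move=> _ [_ [a [b ->] <-]]; rewrite setTI.
set V := `]a, b[%classic.
have mS : measurable (shdom : set (mR * mR * mR * mR)).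
  by apply: open_measurable4; exact: shdom_open.
rewrite (_ : P @^-1` V = (shdom `&` P @^-1` V) `|` (~` shdom `&` [set p | V 0])).
  apply: measurableU.
    apply: open_measurable4; rewrite openE => p [Sp Op].
    apply: filterI; first by apply: open_nbhs_nbhs; split => //; exact: shdom_open.
    by apply: (cP p Sp); apply: open_nbhs_nbhs; split => //; exact: interval_open.
  apply: measurableI; first exact: measurableC.
  have [Oz|nOz] := pselect (V 0).
    by rewrite (_ : [set _ | _] = setT)//; apply/seteqP; split.
  by rewrite (_ : [set _ | _] = set0)//; apply/seteqP; split.
apply/seteqP; split=> [p Op|p [[]//|[Np Oz]]]; last by rewrite /= P0.
have [Sp|Np] := pselect (shdom p); [by left|right; split => //].
by rewrite /= -(P0 p Np).
Qed.

End continuous_measurable4.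

(** * Directional derivatives and calculus on the plane *)

Section line_derivative.
Context {R : realType} {V : normedModType R}.

(** Restriction to a line makes the one-variable mean value theorem and differentiation under the
    integral sign available for functions on [V]. *)
Lemma is_derive_lineP (f : V -> R^o) (x v : V) (t d : R) :
  is_derive (x + t *: v) v f d <->
  is_derive t 1 (fun s : R => f (x + s *: v)) d.
Proof.
have E : (fun h : R => h^-1 *: ((f \o shift (x + t *: v)) (h *: v) - f (x + t *: v))) =
  (fun h : R => h^-1 *: (((fun s : R => f (x + s *: v)) \o shift t) (h *: 1) -
     (fun s : R => f (x + s *: v)) t)).
  apply/funext => h /=; congr (_ *: (f _ - _)).
  by rewrite scalerDl -scalerA addrCA scale1r.
by split=> -[H1 H2]; split; move: H1 H2; rewrite /derivable /derive E.
Qed.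

End line_derivative.

Section plane_calculus.
Context {R : realType}.
Implicit Types (f g : R * R -> R^o) (x v : R * R).

(** Locating [c] by its distance to [a] makes the statement independent of the order of [a] and
    [b]. *)
Lemma MVT_between (g dg : R -> R) (a b : R) :
  (forall t : R, is_derive t (1 : R) (g : R -> R^o) (dg t)) ->
  exists c, `|c - a| <= `|b - a| /\ g b - g a = dg c * (b - a).
Proof.
move=> gd; have cg : continuous g.
  by move=> t; apply/differentiable_continuous/derivable1_diffP; case: (gd t).
have [ab|/ltW ba] := leP a b.
  have [c cab E] := @MVT_segment _ g dg a b ab (fun t _ => gd t) (continuous_subspaceT cg).
  exists c; split => //; move: cab; rewrite in_itv /= => /andP[ac cb].
  by rewrite !ger0_norm ?subr_ge0// lerB.
have [c cab E] := @MVT_segment _ g dg b a ba (fun t _ => gd t) (continuous_subspaceT cg).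
exists c; split; last by rewrite -opprB E -mulrN opprB.
move: cab; rewrite in_itv /= => /andP[bc ca].
by rewrite !ler0_norm ?subr_le0// lerN2 lerB.
Qed.

Lemma is_derive_line1 f (df : R * R -> R) (a y : R) :
  (forall x, is_derive x coord2_1 f (df x)) ->
  is_derive a 1 (fun t : R => f (t, y) : R^o) (df (a, y)).
Proof.
move=> /(_ (a, y)) H; have := (is_derive_lineP f (0, y) coord2_1 a (df (a, y))).1.
have E t : (0, y) + t *: coord2_1 = (t, y) :> R * R.
  rewrite -[LHS]/(0 + t * 1, y + t * 0).
  by rewrite add0r mulr1 mulr0 addr0.
by rewrite E => /(_ H); under eq_fun do rewrite E.
Qed.

Lemma is_derive_line2 f (df : R * R -> R) (a y : R) :
  (forall x, is_derive x coord2_2 f (df x)) ->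
  is_derive a 1 (fun t : R => f (y, t) : R^o) (df (y, a)).
Proof.
move=> /(_ (y, a)) H; have := (is_derive_lineP f (y, 0) coord2_2 a (df (y, a))).1.
have E t : (y, 0) + t *: coord2_2 = (y, t) :> R * R.
  rewrite -[LHS]/(y + t * 0, 0 + t * 1).
  by rewrite add0r mulr1 mulr0 addr0.
by rewrite E => /(_ H); under eq_fun do rewrite E.
Qed.

Lemma continuous_box f x (e : R) : {for x, continuous f} -> 0 < e ->
  exists2 d : R, 0 < d & forall y : R * R,
    `|y.1 - x.1| < d -> `|y.2 - x.2| < d -> `|f y - f x| < e.
Proof.
move=> /(@cvgrPdist_lt _ R^o) /(_ _ _)/[apply] /nbhs_ballP [d /= d0 H].
exists d => // y y1 y2; rewrite distrC; apply: H.
by split => /=; rewrite /ball /= distrC.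
Qed.

(** The increment along [v] splits into a vertical and a horizontal step; the mean value theorem on
    each evaluates the partial derivatives at points that tend to [x]. *)
Lemma is_derive_C1 f (f1 f2 : R * R -> R) x v :
  (forall y, is_derive y coord2_1 f (f1 y)) ->
  (forall y, is_derive y coord2_2 f (f2 y)) ->
  {for x, continuous f1} -> {for x, continuous f2} ->
  is_derive x v f (v.1 * f1 x + v.2 * f2 x).
Proof.
move=> d1 d2 c1 c2.
suff H : (fun h : R => h^-1 *: ((f \o shift x) (h *: v) - f x)) @ 0^' -->
    (v.1 * f1 x + v.2 * f2 x : R^o).
  by apply: DeriveDef; [apply/cvg_ex; eexists; exact: H|exact: cvg_lim H].
apply/cvgrPdist_lt => e e0.
(* Both steps have length at most [|h| * w], and the error is at most [(|v.1| + |v.2|) * (e / w)],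
   below [e]; the added 1 keeps [w] positive when [v = 0]. *)
pose w := `|v.1| + `|v.2| + 1.
have w0 : 0 < w by rewrite ltr_wpDl// addr_ge0.
have [r1 r10 H1] := continuous_box c1 (divr_gt0 e0 w0).
have [r2 r20 H2] := continuous_box c2 (divr_gt0 e0 w0).
pose r := Num.min r1 r2 / w.
have r0 : 0 < r by rewrite divr_gt0// lt_min r10.
near=> h.
have hr : `|h| < r.
  by near: h; apply: dnbhs0_lt.
have hn0 : h != 0 by near: h; exact: nbhs_dnbhs_neq.
have [a [Ha Ea]] := MVT_between (x.1) (h * v.1 + x.1)
  (fun t => is_derive_line1 t (h * v.2 + x.2) d1).
have [b [Hb Eb]] := MVT_between (x.2) (h * v.2 + x.2)
  (fun t => is_derive_line2 t x.1 d2).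
have -> : h^-1 *: ((f \o shift x) (h *: v) - f x) =
    v.1 * f1 (a, h * v.2 + x.2) + v.2 * f2 (x.1, b).
  rewrite /= (_ : h *: v + x = (h * v.1 + x.1, h * v.2 + x.2))//.
  rewrite -(subrKA (f (x.1, h * v.2 + x.2))) Ea.
  rewrite [in f x](surjective_pairing x) Eb !addrK.
  by rewrite /GRing.scale /=; field.
have hw : `|h| * w < r1 /\ `|h| * w < r2.
  move: hr; rewrite /r ltr_pdivlMr// lt_min => /andP[]; by split.
have v1w : `|h * v.1| <= `|h| * w.
  by rewrite normrM ler_wpM2l// /w -addrA lerDl addr_ge0.
have v2w : `|h * v.2| <= `|h| * w.
  by rewrite normrM ler_wpM2l// /w addrAC lerDr addr_ge0.
have A1 : `|f1 (a, h * v.2 + x.2) - f1 x| < e / w.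
  apply: H1 => /=; last by rewrite addrK (le_lt_trans v2w)//; case: hw.
  by apply: le_lt_trans Ha _; rewrite addrK (le_lt_trans v1w)//; case: hw.
have A2 : `|f2 (x.1, b) - f2 x| < e / w.
  apply: H2 => /=; first by rewrite subrr normr0.
  by apply: le_lt_trans Hb _; rewrite addrK (le_lt_trans v2w)//; case: hw.
rewrite distrC opprD addrACA -!mulrBr.
apply: le_lt_trans (ler_normD _ _) _; rewrite !normrM.
apply: (@le_lt_trans _ _ ((`|v.1| + `|v.2|) * (e / w))).
  by rewrite mulrDl lerD// ler_wpM2l// ltW.
by rewrite mulrCA gtr_pMr// ltr_pdivrMr// mul1r /w ltrDl.
Unshelve. all: by end_near. Qed.

(** The second difference of [f] over a square of side [h] is evaluated by two mean values in either
    order: it is [h ^+ 2] times [f12] at one point and times [f21] at another, both close to [x]. *)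
Lemma clairaut f (f1 f2 f12 f21 : R * R -> R) x :
  (forall y, is_derive y coord2_1 f (f1 y)) ->
  (forall y, is_derive y coord2_2 f (f2 y)) ->
  (forall y, is_derive y coord2_2 (f1 : _ -> R^o) (f12 y)) ->
  (forall y, is_derive y coord2_1 (f2 : _ -> R^o) (f21 y)) ->
  {for x, continuous f12} -> {for x, continuous f21} -> f12 x = f21 x.
Proof.
move=> d1 d2 d12 d21 c1 c2; apply/eqP; rewrite -subr_eq0 -normr_le0.
apply/ler_addgt0Pr => e e0; rewrite add0r.
have [r1 r10 H1] := continuous_box c1 (divr_gt0 e0 (@ltr0n R 2)).
have [r2 r20 H2] := continuous_box c2 (divr_gt0 e0 (@ltr0n R 2)).
pose h := Num.min r1 r2 / 2.
have h0 : 0 < h by rewrite divr_gt0// lt_min r10.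
have [hr1 hr2] : h < r1 /\ h < r2.
  have /andP[] : (h < r1) && (h < r2); last by split.
  by rewrite -lt_min /h ltr_pdivrMr// ltr_pMr ?ltr1n// lt_min r10.
have fx : f x = f (x.1, x.2) by rewrite -surjective_pairing.
pose D := f (x.1 + h, x.2 + h) - f (x.1 + h, x.2) - (f (x.1, x.2 + h) - f x).
have [p [p1 p2 Ep]] : exists p : R * R, [/\ `|p.1 - x.1| < r1, `|p.2 - x.2| < r1 &
    D = f12 p * h * h].
  have dd (t : R) : is_derive t (1 : R) (fun t : R => f (t, x.2 + h) - f (t, x.2) : R^o)
      (f1 (t, x.2 + h) - f1 (t, x.2)).
    by apply: is_deriveB; exact: is_derive_line1.
  have [a [Ha Ea]] := MVT_between x.1 (x.1 + h) dd.
  have [b [Hb Eb]] := MVT_between x.2 (x.2 + h) (fun t => is_derive_line2 t a d12).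
  exists (a, b); split => /=.
  - by apply: le_lt_trans Ha _; rewrite addrC addKr gtr0_norm.
  - by apply: le_lt_trans Hb _; rewrite addrC addKr gtr0_norm.
  - by rewrite /D fx Ea Eb ![_ + h - _]addrAC !subrr !add0r.
have [q [q1 q2 Eq]] : exists q : R * R, [/\ `|q.1 - x.1| < r2, `|q.2 - x.2| < r2 &
    D = f21 q * h * h].
  have dd (t : R) : is_derive t (1 : R) (fun t : R => f (x.1 + h, t) - f (x.1, t) : R^o)
      (f2 (x.1 + h, t) - f2 (x.1, t)).
    by apply: is_deriveB; exact: is_derive_line2.
  have [a [Ha Ea]] := MVT_between x.2 (x.2 + h) dd.
  have [b [Hb Eb]] := MVT_between x.1 (x.1 + h) (fun t => is_derive_line1 t a d21).
  exists (b, a); split => /=.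
  - by apply: le_lt_trans Hb _; rewrite addrC addKr gtr0_norm.
  - by apply: le_lt_trans Ha _; rewrite addrC addKr gtr0_norm.
  - have -> : D = f (x.1 + h, x.2 + h) - f (x.1, x.2 + h) - (f (x.1 + h, x.2) - f x).
      by rewrite /D; ring.
    by rewrite fx Ea Eb ![_ + h - _]addrAC !subrr !add0r.
have E : f12 p = f21 q.
  by apply: (mulIf (lt0r_neq0 h0)); apply: (mulIf (lt0r_neq0 h0)); rewrite -Ep -Eq.
have := H1 p p1 p2; have := H2 q q1 q2; rewrite -E => a2 a1.
rewrite -(subrKA (f12 p)) (le_trans (ler_normD _ _))// distrC (splitr e).
by rewrite lerD// ltW.
Qed.

End plane_calculus.

Lemma complex_ext (R : realType) (z w : R[i]) :
  complex.Re z = complex.Re w -> complex.Im z = complex.Im w -> z = w.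
Proof. by case: z w => [a b] [c d] /= -> ->. Qed.

Lemma cmod_ge0 (R : realType) (z : R[i]) : 0 <= cmod z.
Proof. by case: z => a b; exact: sqrtr_ge0. Qed.

Lemma normr_Re_le (R : realType) (z : R[i]) : `|complex.Re z| <= cmod z.
Proof. by case: z => a b /=; rewrite -sqrtr_sqr ler_wsqrtr// lerDl sqr_ge0. Qed.

Lemma normr_Im_le (R : realType) (z : R[i]) : `|complex.Im z| <= cmod z.
Proof. by case: z => a b /=; rewrite -sqrtr_sqr ler_wsqrtr// lerDr sqr_ge0. Qed.

Lemma cmod_le (R : realType) (z : R[i]) : cmod z <= `|complex.Re z| + `|complex.Im z|.
Proof.
case: z => a b /=; rewrite -[leRHS]ger0_norm ?addr_ge0// -sqrtr_sqr ler_wsqrtr//.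
by rewrite sqrrD !real_normK ?num_real// lerD2r lerDl mulrn_wge0// mulr_ge0.
Qed.

(** * Schwartz functions as families of real partial derivatives *)

Section schwartz_jets.
Context {R : realType}.

(** A real function [q 0 0] given together with its partial derivatives, [q n1 n2] being of orders
    [n1] and [n2] in the two variables, so that differentiating shifts an index. *)
Definition schwartz_jet (q : nat -> nat -> R * R -> R) :=
  [/\ forall n1 n2 x, is_derive x coord2_1 (q n1 n2 : _ -> R^o) (q n1.+1 n2 x),
      forall n1 n2 x, is_derive x coord2_2 (q n1 n2 : _ -> R^o) (q n1 n2.+1 x),
      forall n1 n2, continuous (q n1 n2) &
      forall n1 n2 k, exists M, forall x, jap2 x ^+ k * `|q n1 n2 x| <= M].

Variable f : R * R -> R[i]^o.
Hypothesis Sf : is_schwartz2 f.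

Let cE := [:: (@coord2_1 R); coord2_2].

Let multi2E n : {subset multi2 n <= cE}.
Proof.
move=> v; rewrite mem_cat !mem_nseq !inE.
by case/orP => /andP[_ ->]; rewrite ?orbT.
Qed.

Let is_derive_Re s v x : {subset s <= cE} -> v \in cE ->
  is_derive x v (fun y => complex.Re (cpartials s f y) : R^o)
    (complex.Re (cpartial v (cpartials s f) x)).
Proof.
move=> sE vE; have [sf _] := Sf; have [_ /(_ v vE) [h1 h2]] := sf s sE x I.
exact/derivableP.
Qed.

Let is_derive_Im s v x : {subset s <= cE} -> v \in cE ->
  is_derive x v (fun y => complex.Im (cpartials s f y) : R^o)
    (complex.Im (cpartial v (cpartials s f) x)).
Proof.
move=> sE vE; have [sf _] := Sf; have [_ /(_ v vE) [h1 h2]] := sf s sE x I.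
exact/derivableP.
Qed.

Let continuous_Re s : {subset s <= cE} ->
  continuous (fun y => complex.Re (cpartials s f y)).
Proof.
move=> sE x; have [sf _] := Sf; have [h _] := sf s sE x I.
exact: (continuous_comp h (@cRe_continuous _ _)).
Qed.

Let continuous_Im s : {subset s <= cE} ->
  continuous (fun y => complex.Im (cpartials s f y)).
Proof.
move=> sE x; have [sf _] := Sf; have [h _] := sf s sE x I.
exact: (continuous_comp h (@cIm_continuous _ _)).
Qed.

Let sub_cons v s : v \in cE -> {subset s <= cE} -> {subset v :: s <= cE}.
Proof. by move=> vE sE u; rewrite inE => /orP[/eqP ->|/sE]. Qed.

Let e1E : coord2_1 \in cE. Proof. by rewrite inE eqxx. Qed.
Let e2E : coord2_2 \in cE. Proof. by rewrite !inE eqxx orbT. Qed.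

Lemma cpartial_comm s : {subset s <= cE} ->
  cpartial coord2_1 (cpartial coord2_2 (cpartials s f)) =
  cpartial coord2_2 (cpartial coord2_1 (cpartials s f)).
Proof.
move=> sE; apply/funext => x.
have s1 := sub_cons e1E sE; have s2 := sub_cons e2E sE.
have s21 := sub_cons e2E s1; have s12 := sub_cons e1E s2.
have R12 : complex.Re (cpartial coord2_2 (cpartial coord2_1 (cpartials s f)) x) =
   complex.Re (cpartial coord2_1 (cpartial coord2_2 (cpartials s f)) x).
  apply: (clairaut (fun y => is_derive_Re y sE e1E) (fun y => is_derive_Re y sE e2E)
    (fun y => is_derive_Re y s1 e2E) (fun y => is_derive_Re y s2 e1E)).
    exact: (continuous_Re s21).
  exact: (continuous_Re s12).
have I12 : complex.Im (cpartial coord2_2 (cpartial coord2_1 (cpartials s f)) x) =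
   complex.Im (cpartial coord2_1 (cpartial coord2_2 (cpartials s f)) x).
  apply: (clairaut (fun y => is_derive_Im y sE e1E) (fun y => is_derive_Im y sE e2E)
    (fun y => is_derive_Im y s1 e2E) (fun y => is_derive_Im y s2 e1E)).
    exact: (continuous_Im s21).
  exact: (continuous_Im s12).
exact: complex_ext (esym R12) (esym I12).
Qed.

(** [multi2] applies the derivatives in the second variable last, so a new derivative in the first
    variable has to be moved inside past them. *)
Lemma cpartial1_multi2 n1 n2 :
  cpartial coord2_1 (cpartials (multi2 (n1, n2)) f) = cpartials (multi2 (n1.+1, n2)) f.
Proof.
elim: n2 => [//|n2 IH].
have -> m : cpartials (multi2 (m, n2.+1)) f =
   cpartial coord2_2 (cpartials (multi2 (m, n2)) f) by [].
by rewrite cpartial_comm ?IH.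
Qed.

Let bound n1 n2 k : exists M, forall x,
  jap2 x ^+ k * cmod (cpartials (multi2 (n1, n2)) f x) <= M.
Proof.
have [_ /(_ (k, (n1, n2))) /wsup_ltyP [M H]] := Sf.
by exists M => x; exact: (H x I).
Qed.

Lemma schwartz_jet_Re :
  schwartz_jet (fun n1 n2 x => complex.Re (cpartials (multi2 (n1, n2)) f x)).
Proof.
split=> [n1 n2 x|n1 n2 x|n1 n2|n1 n2 k].
- by rewrite -cpartial1_multi2; exact: is_derive_Re.
- exact: is_derive_Re.
- exact: continuous_Re.
- have [M H] := bound n1 n2 k; exists M => x; apply: le_trans (H x).
  by rewrite ler_wpM2l ?normr_Re_le// exprn_ge0// sqrtr_ge0.
Qed.

Lemma schwartz_jet_Im :
  schwartz_jet (fun n1 n2 x => complex.Im (cpartials (multi2 (n1, n2)) f x)).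
Proof.
split=> [n1 n2 x|n1 n2 x|n1 n2|n1 n2 k].
- by rewrite -cpartial1_multi2; exact: is_derive_Im.
- exact: is_derive_Im.
- exact: continuous_Im.
- have [M H] := bound n1 n2 k; exists M => x; apply: le_trans (H x).
  by rewrite ler_wpM2l ?normr_Im_le// exprn_ge0// sqrtr_ge0.
Qed.

End schwartz_jets.

(** * The synthesis operator as an integral operator with rapidly decaying kernel *)

Section weights.
Context {R : realType}.
Local Notation mR := (measurableTypeR R).
Local Notation mu := (@lebesgue_measure R).
Local Notation S := (R * R * R * R)%type.
Local Notation mS := (mR * mR * mR * mR)%type.

Definition lebesgue2 : {sigma_finite_measure set (mR * mR)%type -> \bar R} := sprod mu mu.
Definition lebesgue3 : {sigma_finite_measure set (mR * mR * mR)%type -> \bar R} :=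
  sprod lebesgue2 mu.
Definition lebesgue4 : {sigma_finite_measure set (mR * mR * mR * mR)%type -> \bar R} :=
  sprod lebesgue3 mu.

(** The common integrable majorant: two powers of [shweight] pay for its product over R^4, four
    powers of [jap2] for its product over R^2. *)
Definition cauchy_weight (x : R) : R := (1 + x ^+ 2)^-1.

Lemma cauchy_weight_gt0 x : 0 < cauchy_weight x.
Proof. by rewrite invr_gt0 ltr_pwDl// sqr_ge0. Qed.

Lemma integrable_cauchy_weight : mu.-integrable setT (EFin \o cauchy_weight).
Proof.
apply/integrableP; split.
  by apply/measurable_EFinP; exact: (continuous_measurable_fun (@continuous_oneDsqrV R)).
under eq_integral do rewrite /= ger0_norm ?(ltW (cauchy_weight_gt0 _))//.
exact: integral_oneDsqrV.
Qed.

Definition cauchy_weight4 (p : S) : R :=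
  cauchy_weight p.1.1.1 * cauchy_weight p.1.1.2 * cauchy_weight p.1.2 * cauchy_weight p.2.

Lemma cauchy_weight4_gt0 p : 0 < cauchy_weight4 p.
Proof. by rewrite !mulr_gt0 ?cauchy_weight_gt0. Qed.

Lemma integrable_cauchy_weight2 :
  lebesgue2.-integrable setT (EFin \o (fun x : mR * mR => cauchy_weight x.1 * cauchy_weight x.2)).
Proof. by apply: integrable_tensor; exact: integrable_cauchy_weight. Qed.

Lemma integrable_cauchy_weight3 :
  lebesgue3.-integrable setT (EFin \o (fun x : mR * mR * mR =>
     cauchy_weight x.1.1 * cauchy_weight x.1.2 * cauchy_weight x.2)).
Proof.
exact: (@integrable_tensor _ _ _ _ R lebesgue2 mu _ _ integrable_cauchy_weight2
  integrable_cauchy_weight).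
Qed.

Lemma integrable_cauchy_weight4 :
  lebesgue4.-integrable setT (EFin \o (cauchy_weight4 : mS -> R)).
Proof.
exact: (@integrable_tensor _ _ _ _ R lebesgue3 mu _ _ integrable_cauchy_weight3
  integrable_cauchy_weight).
Qed.

Lemma jap1_ge1 (t : R) : 1 <= jap1 t.
Proof. by rewrite -[leLHS]sqrtr1 ler_wsqrtr// lerDl sqr_ge0. Qed.

Lemma ler_norm_jap1 (t : R) : `|t| <= jap1 t.
Proof. by rewrite -sqrtr_sqr ler_wsqrtr// lerDr. Qed.

Lemma sqr_jap1 (t : R) : jap1 t ^+ 2 = 1 + t ^+ 2.
Proof. by rewrite sqr_sqrtr// addr_ge0// sqr_ge0. Qed.

Lemma jap2_ge1 (x : R * R) : 1 <= jap2 x.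
Proof. by rewrite -[leLHS]sqrtr1 ler_wsqrtr// lerDl addr_ge0// sqr_ge0. Qed.

Lemma ler_norm1_jap2 (x : R * R) : `|x.1| <= jap2 x.
Proof. by rewrite -sqrtr_sqr ler_wsqrtr// addrCA lerDl addr_ge0// sqr_ge0. Qed.

Lemma ler_norm2_jap2 (x : R * R) : `|x.2| <= jap2 x.
Proof. by rewrite -sqrtr_sqr ler_wsqrtr// addrA lerDr addr_ge0// sqr_ge0. Qed.

Lemma jap2_le (x : R * R) : jap2 x <= 1 + `|x.1| + `|x.2|.
Proof.
rewrite -[leRHS]ger0_norm ?addr_ge0// -sqrtr_sqr ler_wsqrtr//.
have := normr_ge0 x.1; have := normr_ge0 x.2.
rewrite -[x.1 ^+ 2]real_normK ?num_real// -[x.2 ^+ 2]real_normK ?num_real//.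
by move: `|x.1| `|x.2| => u v v0 u0; nra.
Qed.

Definition shweight (p : S) : R :=
  jap1 p.1.1.1 * jap1 p.1.1.2 * jap1 p.1.2 * (`|p.2| + `|p.2|^-1).

Let D (t : R) := `|t| + `|t|^-1.

Let D_ge1 t : t != 0 -> 1 <= D t.
Proof.
move=> t0; rewrite /D; have : 0 < `|t| by rewrite normr_gt0.
move: `|t| => u u0; have [u1|u1] := leP 1 u.
  by rewrite (le_trans u1)// lerDl invr_ge0 ltW.
apply: (@le_trans _ _ u^-1); first by rewrite invf_ge1// ltW.
by rewrite lerDr ltW.
Qed.

(** On [shdom] all four factors are at least 1, so each one is bounded by the product. *)
Lemma shweight_bounds (p : S) : shdom p ->
  [/\ 1 <= shweight p, `|p.1.1.1| <= shweight p, `|p.1.1.2| <= shweight p,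
      `|p.1.2| <= shweight p & `|p.2| + `|p.2|^-1 <= shweight p].
Proof.
case: p => [[[b1 b2] s] a] /= a0; rewrite /shweight /=.
have := jap1_ge1 b1; have := jap1_ge1 b2; have := jap1_ge1 s; have := D_ge1 a0.
have := ler_norm_jap1 b1; have := ler_norm_jap1 b2; have := ler_norm_jap1 s.
rewrite -/(D a).
move: (jap1 b1) (jap1 b2) (jap1 s) (D a) => u1 u2 u3 u4 h1 h2 h3 k4 k3 k2 k1.
have g12 : 1 <= u1 * u2 by nra.
have g123 : 1 <= u1 * u2 * u3 by nra.
have l1 : u1 <= u1 * u2 by nra.
have l2 : u2 <= u1 * u2 by nra.
have l12 : u1 * u2 <= u1 * u2 * u3 by nra.
have l3 : u3 <= u1 * u2 * u3 by nra.
have l4 : u4 <= u1 * u2 * u3 * u4 by nra.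
have l123 : u1 * u2 * u3 <= u1 * u2 * u3 * u4 by nra.
split=> //; lra.
Qed.

Lemma shweight_ge1 (p : S) : shdom p -> 1 <= shweight p.
Proof. by case/shweight_bounds. Qed.

Lemma shweight_scale (p : S) : shdom p ->
  [/\ `|p.2| <= shweight p, `|p.2|^-1 <= shweight p & Num.sqrt `|p.2| <= shweight p].
Proof.
move=> Sp; have [h1 _ _ _] := shweight_bounds Sp.
have : 0 < `|p.2| by rewrite normr_gt0.
move: `|p.2| (shweight p) h1 => u om h1 u0 h.
have ui0 : 0 < u^-1 by rewrite invr_gt0.
split; [lra|lra|].
have [u1|u1] := leP 1 u; last first.
  by apply: le_trans h1; rewrite -sqrtr1 ler_wsqrtr// ltW.
apply: (@le_trans _ _ u); last lra.
by rewrite -[leRHS](ger0_norm (ltW u0)) -sqrtr_sqr ler_wsqrtr// expr2 ler_peMl// ltW.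
Qed.

(** Factor by factor. For the scale, the square of |a| + 1/|a| is a^2 + 2 + 1/a^2, which exceeds 1 +
    a^2. *)
Lemma shweight2V_le (p : S) : shdom p -> (shweight p ^+ 2)^-1 <= cauchy_weight4 p.
Proof.
case: p => [[[b1 b2] s] a] /= a0; rewrite /shweight /cauchy_weight4 /= -!invfM.
have p1 (t : R) : 0 < 1 + t ^+ 2 by rewrite ltr_pwDl// sqr_ge0.
have j1 (t : R) : 0 < jap1 t by exact: lt_le_trans ltr01 (jap1_ge1 t).
have D0 : 0 < D a by exact: lt_le_trans ltr01 (D_ge1 a0).
rewrite -/(D a) lef_pV2; last 2 first.
- by rewrite posrE exprn_gt0// !mulr_gt0.
- by rewrite posrE !mulr_gt0.
rewrite !exprMn !sqr_jap1 ler_wpM2l ?mulr_ge0 ?(ltW (p1 _))//.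
rewrite /D; have : 0 < `|a| by rewrite normr_gt0.
rewrite -[a ^+ 2]real_normK ?num_real//.
move: `|a| => u u0; have ui : u * u^-1 = 1 by rewrite mulfV// gt_eqF.
have ui0 : 0 < u^-1 by rewrite invr_gt0.
rewrite sqrrD ui; have := sqr_ge0 u^-1; lra.
Qed.

End weights.

(** * Integral operators whose kernels are stable under differentiation *)

Section shearlet_kernels.
Context {R : realType}.
Local Notation mR := (measurableTypeR R).
Local Notation mu := (@lebesgue_measure R).
Local Notation S := (R * R * R * R)%type.
Local Notation mS := (mR * mR * mR * mR)%type.
Implicit Types (p : S) (x v : R * R) (P : S -> R) (K : S -> R * R -> R).

(* [shear_coord p x] is [A_a^-1 S_s^-1 (x - b)] for [p = (b, s, a)] *)
Definition shear_lin p v : R * R :=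
  ((v.1 + p.1.2 * v.2) / p.2, v.2 * (Num.sqrt `|p.2| / p.2)).
Definition shear_coord p x : R * R := shear_lin p (x - p.1.1).

Lemma shear_coordD p x v (t : R) :
  shear_coord p (x + t *: v) = shear_coord p x + t *: shear_lin p v.
Proof.
rewrite /shear_coord /shear_lin; apply/pair_equal_spec; split => /=; rewrite /GRing.scale /=; ring.
Qed.

(** Kernels are differentiated in [x] only, so their coefficients in [p] carry just measurability
    and polynomial growth. *)
Definition tempered (c : S -> R) := measurable_fun setT (c : mS -> R) /\
  exists N C, 0 <= C /\ forall p, shdom p -> `|c p| <= C * shweight p ^+ N.

Lemma temperedM c1 c2 : tempered c1 -> tempered c2 ->
  tempered (fun p => c1 p * c2 p).
Proof.
move=> [m1 [N1 [C1 [C10 H1]]]] [m2 [N2 [C2 [C20 H2]]]]; split.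
  exact: measurable_funM.
exists (N1 + N2)%N, (C1 * C2); split; first exact: mulr_ge0.
by move=> p Sp; rewrite normrM exprD mulrACA ler_pM// ?H1// H2.
Qed.

Let measurable_proj1 : measurable_fun setT (fun p : mS => p.1.1).
Proof. exact: measurableT_comp measurable_fst measurable_fst. Qed.

Let measurable_projs : measurable_fun setT (fun p : mS => p.1.2).
Proof. exact: measurableT_comp measurable_snd measurable_fst. Qed.

Let measurable_inv_proja : measurable_fun setT (fun p : mS => p.2^-1 : mR).
Proof.
apply: shdom_continuous_measurable => [p /negP|p Sp].
  (* At scale 0 the inverse takes its default value 0, which is the value required off [shdom]. *)
  by rewrite negbK => /eqP ->; rewrite invr0.
by apply: cvgV => //; exact: cvg_snd.
Qed.

Let measurable_sqrt_proja :
  measurable_fun setT (fun p : mS => Num.sqrt `|p.2| / p.2 : mR).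
Proof.
apply: shdom_continuous_measurable => [p /negP|p Sp].
  by rewrite negbK => /eqP ->; rewrite invr0 mulr0.
apply: cvgM; last by apply: cvgV => //; exact: cvg_snd.
apply: continuous_cvg; first exact: sqrt_continuous.
by apply: cvg_norm; exact: cvg_snd.
Qed.

Lemma tempered_inv : tempered (fun p => p.2^-1).
Proof.
split; first exact: measurable_inv_proja.
exists 1%N, 1; split => // p Sp; rewrite mul1r expr1 normfV.
by have [] := shweight_scale Sp.
Qed.

Lemma tempered_s : tempered (fun p => p.1.2).
Proof.
split; first exact: measurable_projs.
exists 1%N, 1; split => // p Sp; rewrite mul1r expr1.
by have [] := shweight_bounds Sp.
Qed.

Lemma tempered_sqrt : tempered (fun p => Num.sqrt `|p.2| / p.2).
Proof.
split; first exact: measurable_sqrt_proja.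
exists 2%N, 1; split => // p Sp; rewrite mul1r normrM normfV expr2.
have [_ h1 h2] := shweight_scale Sp.
by rewrite ler_pM// ger0_norm ?sqrtr_ge0.
Qed.

Lemma measurable_shear_coord :
  measurable_fun setT (fun z : mS * (mR * mR) => shear_coord z.1 z.2 : mR * mR).
Proof.
have m1 : measurable_fun setT (fun z : mS * (mR * mR) => z.2.1 - z.1.1.1.1 : mR).
  apply: measurable_funB; first exact: measurableT_comp measurable_fst measurable_snd.
  apply: (measurableT_comp measurable_fst).
  exact: (measurableT_comp measurable_proj1 measurable_fst).
have m2 : measurable_fun setT (fun z : mS * (mR * mR) => z.2.2 - z.1.1.1.2 : mR).
  apply: measurable_funB; first exact: measurableT_comp measurable_snd measurable_snd.
  apply: (measurableT_comp measurable_snd).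
  exact: (measurableT_comp measurable_proj1 measurable_fst).
apply: measurable_fun_pair.
  apply: measurable_funM.
    apply: measurable_funD => //; apply: measurable_funM => //.
    exact: (measurableT_comp measurable_projs measurable_fst).
  exact: (measurableT_comp measurable_inv_proja measurable_fst).
apply: measurable_funM => //.
exact: (measurableT_comp measurable_sqrt_proja measurable_fst).
Qed.

(* The scale dilates [x - b] at most polynomially in the weight, so decay in
   the sheared coordinate transfers to decay in [x]. *)
Lemma jap2_shear_coord p x : shdom p ->
  jap2 x <= 6 * shweight p ^+ 2 * jap2 (shear_coord p x).
Proof.
move=> Sp; have [w1 wb1 wb2 ws _] := shweight_bounds Sp.
have [wa _ wr] := shweight_scale Sp.
have j1 := jap2_ge1 (shear_coord p x).
have y1 := ler_norm1_jap2 (shear_coord p x).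
have y2 := ler_norm2_jap2 (shear_coord p x).
set y := shear_coord p x in j1 y1 y2 *.
have a0 : p.2 != 0 := Sp.
have r0 : Num.sqrt `|p.2| != 0 by rewrite sqrtr_eq0 -ltNge normr_gt0.
have aE : `|p.2| = Num.sqrt `|p.2| ^+ 2 by rewrite sqr_sqrtr.
have z2 : x.2 - p.1.1.2 = y.2 * (p.2 / Num.sqrt `|p.2|).
  by rewrite /y /= mulrA; field; rewrite a0 r0.
have z1 : x.1 - p.1.1.1 = y.1 * p.2 - p.1.2 * (x.2 - p.1.1.2).
  by rewrite /y /=; field.
have nz2 : `|x.2 - p.1.1.2| = `|y.2| * Num.sqrt `|p.2|.
  rewrite z2; move: (y.2) => Y; rewrite !normrM normfV (ger0_norm (sqrtr_ge0 _)).
  by congr (_ * _); rewrite [X in X / _]aE expr2 mulfK.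
have n2 : `|x.2| <= `|p.1.1.2| + `|y.2| * Num.sqrt `|p.2|.
  by rewrite -nz2 -{1}(subrK p.1.1.2 x.2) addrC ler_normD.
have n1 : `|x.1| <= `|p.1.1.1| + (`|y.1| * `|p.2| + `|p.1.2| * (`|y.2| * Num.sqrt `|p.2|)).
  rewrite -nz2 -{1}(subrK p.1.1.1 x.1) addrC (le_trans (ler_normD _ _))//.
  by rewrite lerD2l z1 (le_trans (ler_normB _ _))// !normrM.
apply: le_trans (jap2_le x) _.
have := sqrtr_ge0 `|p.2|.
move: n1 n2 wa wr wb1 wb2 ws y1 y2 j1 w1.
have := normr_ge0 y.1; have := normr_ge0 y.2; have := normr_ge0 p.1.2; have := normr_ge0 p.2.
move: `|x.1| `|x.2| `|p.1.1.1| `|p.1.1.2| `|y.1| `|y.2| `|p.2| (Num.sqrt `|p.2|) `|p.1.2|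
  (jap2 y) (shweight p) => X1 X2 B1 B2 Y1 Y2 A r s j w.
move=> A0 s0 Y20 Y10 n1 n2 wa wr wb1 wb2 ws y1 y2 j1 w1 r_0.
(* The constant 6 counts the terms 1, [B1], [B2], [Y1 * A], [Y2 * r] and [s * (Y2 * r)], each at
   most [w ^+ 2 * j]. *)
have wj : w <= w * j by nra.
have ww : w <= w ^+ 2 by nra.
have wwj : w * j <= w ^+ 2 * j by nra.
have h1 : Y1 * A <= w * j by rewrite mulrC ler_pM.
have h2 : Y2 * r <= w * j by rewrite mulrC ler_pM.
have h3 : s * (Y2 * r) <= w ^+ 2 * j by rewrite expr2 -mulrA ler_pM// mulr_ge0.
lra.
Qed.

(** Sums are included because a derivative in the second variable moves both sheared coordinates and
    yields two terms. Induction on this shape replaces formulas for iterated derivatives. *)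
Inductive shkernel : (S -> R * R -> R) -> Prop :=
| shkernel_jet c q n1 n2 : tempered c -> schwartz_jet q ->
    shkernel (fun p x => c p * q n1 n2 (shear_coord p x))
| shkernelD K1 K2 : shkernel K1 -> shkernel K2 ->
    shkernel (fun p x => K1 p x + K2 p x).

Lemma shkernel_measurable K : shkernel K ->
  measurable_fun setT (fun z : mS * (mR * mR) => K z.1 z.2).
Proof.
elim=> [c q n1 n2 [mc _] [_ _ cq _]|K1 K2 _ m1 _ m2]; last exact: measurable_funD.
apply: measurable_funM; first exact: measurableT_comp mc measurable_fst.
exact: measurableT_comp (continuous_measurable_fun2 (cq n1 n2)) measurable_shear_coord.
Qed.

Lemma shkernel_measurable1 K x : shkernel K ->
  measurable_fun setT (fun p : mS => K p x).
Proof.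
move=> /shkernel_measurable mK.
have m : measurable_fun setT (fun p : mS => (p, x : mR * mR)).
  exact: measurable_fun_pair.
exact: (measurableT_comp mK m).
Qed.

(** Each power of [jap2 x] is traded for one of [jap2] at the sheared point, absorbed by the jet,
    and two of the weight. For a sum the exponents are added, powers of a number at least 1 being
    monotone. *)
Lemma shkernel_bound K (k : nat) : shkernel K -> exists N C, 0 <= C /\
  forall p x, shdom p -> jap2 x ^+ k * `|K p x| <= C * shweight p ^+ N.
Proof.
elim=> [c q n1 n2 [_ [N [C [C0 cC]]]] [_ _ _ /(_ n1 n2 k) [M qM]]|
  K1 K2 _ [N1 [C1 [C10 H1]]] _ [N2 [C2 [C20 H2]]]].
- have M0 : 0 <= M.
    by apply: le_trans (qM (0, 0)); rewrite mulr_ge0// exprn_ge0// sqrtr_ge0.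
  exists (2 * k + N)%N, (6 ^+ k * M * C); split; first by rewrite !mulr_ge0// exprn_ge0.
  move=> p x Sp; rewrite normrM.
  have jx : jap2 x ^+ k <= 6 ^+ k * shweight p ^+ (2 * k) * jap2 (shear_coord p x) ^+ k.
    rewrite exprM -!exprMn lerXn2r ?nnegrE ?sqrtr_ge0// ?jap2_shear_coord//.
    by rewrite !mulr_ge0// ?exprn_ge0 ?sqrtr_ge0// (le_trans ler01)// shweight_ge1.
  have w0 : 0 <= shweight p by rewrite (le_trans ler01)// shweight_ge1.
  apply: (@le_trans _ _ (6 ^+ k * shweight p ^+ (2 * k) * jap2 (shear_coord p x) ^+ k *
      (C * shweight p ^+ N * `|q n1 n2 (shear_coord p x)|))).
    rewrite ler_pM ?exprn_ge0 ?sqrtr_ge0 ?mulr_ge0//.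
    by rewrite ler_wpM2r// cC.
  rewrite exprD [leLHS](_ : _ = 6 ^+ k * shweight p ^+ (2 * k) * C * shweight p ^+ N *
    (jap2 (shear_coord p x) ^+ k * `|q n1 n2 (shear_coord p x)|)); last by ring.
  rewrite [leRHS](_ : _ = 6 ^+ k * shweight p ^+ (2 * k) * C * shweight p ^+ N * M); last by ring.
  by rewrite ler_wpM2l// !mulr_ge0// exprn_ge0.
- exists (N1 + N2)%N, (C1 + C2); split; first exact: addr_ge0.
  move=> p x Sp; have w1 := shweight_ge1 Sp.
  apply: (@le_trans _ _ (jap2 x ^+ k * `|K1 p x| + jap2 x ^+ k * `|K2 p x|)).
    by rewrite -mulrDr ler_wpM2l ?exprn_ge0 ?sqrtr_ge0// ler_normD.
  rewrite mulrDl lerD//.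
    by apply: le_trans (H1 p x Sp) _; rewrite ler_wpM2l// ler_weXn2l// leq_addr.
  by apply: le_trans (H2 p x Sp) _; rewrite ler_wpM2l// ler_weXn2l// leq_addl.
Qed.

(** Chain rule: along [v] the sheared point moves with velocity [shear_lin p v], whose coordinates
    are tempered. At scale 0 the default inverse makes the sheared point constant, so the formula
    holds there too. *)
Lemma shkernel_derive K v : shkernel K -> v \in [:: coord2_1; coord2_2] ->
  exists2 K', shkernel K' & forall p x, is_derive x v (K p : _ -> R^o) (K' p x).
Proof.
move=> sK; elim: sK v => [c q n1 n2 tc jq|K1 K2 _ IH1 _ IH2] v vE; last first.
  have [K1' s1 d1] := IH1 v vE; have [K2' s2 d2] := IH2 v vE.
  exists (fun p x => K1' p x + K2' p x); first exact: shkernelD.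
  by move=> p x; exact: is_deriveD.
have [d1 d2 cq _] := jq.
pose L p := shear_lin p v.
have D p x : is_derive x v (fun x => c p * q n1 n2 (shear_coord p x) : R^o)
    (c p * ((L p).1 * q n1.+1 n2 (shear_coord p x) + (L p).2 * q n1 n2.+1 (shear_coord p x))).
  have H : is_derive (shear_coord p x) (L p) (q n1 n2 : _ -> R^o)
      ((L p).1 * q n1.+1 n2 (shear_coord p x) + (L p).2 * q n1 n2.+1 (shear_coord p x)).
    by apply: is_derive_C1 => //; exact: cq.
  have H1 : is_derive x v (fun x => q n1 n2 (shear_coord p x) : R^o)
      ((L p).1 * q n1.+1 n2 (shear_coord p x) + (L p).2 * q n1 n2.+1 (shear_coord p x)).
    rewrite -[x in is_derive x](addr0 x) -(scale0r v); apply/is_derive_lineP.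
    under eq_fun do rewrite shear_coordD.
    have := (is_derive_lineP (q n1 n2 : _ -> R^o) (shear_coord p x) (L p) 0
      ((L p).1 * q n1.+1 n2 (shear_coord p x) + (L p).2 * q n1 n2.+1 (shear_coord p x))).1.
    by rewrite scale0r addr0 => /(_ H).
  exact: (is_deriveZ (c p) H1).
move: vE; rewrite !inE => /orP[] /eqP vE.
- exists (fun p x => (c p * p.2^-1) * q n1.+1 n2 (shear_coord p x)).
    by apply: shkernel_jet => //; apply: temperedM tempered_inv.
  move=> p x; have := D p x; rewrite /L /shear_lin vE /=.
  by rewrite mulr0 addr0 !mul0r addr0 div1r mulrA.
- exists (fun p x => (c p * (p.1.2 * p.2^-1)) * q n1.+1 n2 (shear_coord p x) +
     (c p * (Num.sqrt `|p.2| / p.2)) * q n1 n2.+1 (shear_coord p x)).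
    apply: shkernelD; apply: shkernel_jet => //; apply: temperedM => //.
      by apply: temperedM tempered_inv; exact: tempered_s.
    exact: tempered_sqrt.
  move=> p x; have := D p x; rewrite /L /shear_lin vE /=.
  by rewrite mulr1 add0r mul1r mulrDr !mulrA.
Qed.

(** What the estimates keep of a component of [Phi], the derivatives in [x] falling on the
    kernel. *)
Definition rapid P := [/\ measurable_fun setT (P : mS -> R),
  forall p, ~ shdom p -> P p = 0 &
  forall N, exists C, forall p, shdom p -> shweight p ^+ N * `|P p| <= C].

Definition shoperator P K x : R := \int[lebesgue4]_p (P p * K p x).

(** Of the [N + 2] powers of the weight, [N] compensate the growth of the kernel and 2 produce the
    integrable factor [cauchy_weight4]. *)
Lemma shoperator_integrand_bound P K (k N : nat) (C A : R) :
  (forall p, ~ shdom p -> P p = 0) ->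
  (forall p x, shdom p -> jap2 x ^+ k * `|K p x| <= C * shweight p ^+ N) ->
  0 <= C -> (forall p, shdom p -> shweight p ^+ (N + 2) * `|P p| <= A) ->
  forall p x, jap2 x ^+ k * `|P p * K p x| <= C * A * cauchy_weight4 p.
Proof.
move=> P0 HK C0 HP p x.
have [Sp|nSp] := pselect (shdom p); last first.
  (* [A] is given as an upper bound on [shdom]; its sign is read off at a point of scale 1. *)
  have A0 : 0 <= A.
    have S1 : shdom (0, 0, 0, 1 : R) by rewrite /shdom /= oner_eq0.
    apply: le_trans (HP _ S1); rewrite mulr_ge0// exprn_ge0//.
    by rewrite (le_trans ler01)// shweight_ge1.
  rewrite P0// mul0r normr0 mulr0; apply: mulr_ge0; first exact: mulr_ge0.
  exact/ltW/cauchy_weight4_gt0.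
have w1 := shweight_ge1 Sp; have w0 : 0 < shweight p by exact: lt_le_trans w1.
rewrite normrM mulrCA; apply: (@le_trans _ _ (`|P p| * (C * shweight p ^+ N))).
  by rewrite ler_wpM2l// HK.
apply: (@le_trans _ _ (C * A * (shweight p ^+ 2)^-1)); last first.
  rewrite ler_wpM2l ?shweight2V_le// mulr_ge0//.
  by apply: le_trans (HP p Sp); rewrite mulr_ge0// exprn_ge0// ltW.
rewrite mulrCA -mulrA ler_wpM2l// ler_pdivlMr ?exprn_gt0//.
by rewrite -mulrA -exprD mulrC HP.
Qed.

Lemma measurable_shoperator_integrand P K x : rapid P -> shkernel K ->
  measurable_fun setT (fun p : mS => P p * K p x).
Proof. by move=> [mP _ _] sK; apply: measurable_funM => //; exact: shkernel_measurable1. Qed.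

Lemma shoperator_dominated P K : rapid P -> shkernel K ->
  exists C, 0 <= C /\ forall p x, `|P p * K p x| <= C * cauchy_weight4 p.
Proof.
move=> [mP P0 HP] sK; have [N [C [C0 HK]]] := shkernel_bound 0 sK.
have [A HA] := HP (N + 2)%N.
exists (C * A); split.
  rewrite mulr_ge0//; have S1 : shdom (0, 0, 0, 1 : R) by rewrite /shdom /= oner_eq0.
  apply: le_trans (HA _ S1); rewrite mulr_ge0// exprn_ge0//.
  by rewrite (le_trans ler01)// shweight_ge1.
move=> p x; have := shoperator_integrand_bound P0 HK C0 HA p x.
by rewrite expr0 mul1r.
Qed.

Lemma integrable_cauchy_weight4Z (C : R) :
  lebesgue4.-integrable setT (EFin \o (fun p : mS => C * cauchy_weight4 p)).
Proof.
by apply: integrable_EFinZl => //; exact: integrable_cauchy_weight4.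
Qed.

Lemma shoperator_integrable P K x : rapid P -> shkernel K ->
  lebesgue4.-integrable setT (EFin \o (fun p : mS => P p * K p x)).
Proof.
move=> rP sK; have [C [C0 H]] := shoperator_dominated rP sK.
apply: (le_integrable _ _ _ (integrable_cauchy_weight4Z C)) => //.
  by apply/measurable_EFinP; exact: measurable_shoperator_integrand.
move=> p _; rewrite /= lee_fin [leRHS]ger0_norm ?H//.
by rewrite mulr_ge0// ltW// cauchy_weight4_gt0.
Qed.

(** Along the line through [x], the derivative of the integrand is dominated by a multiple of
    [cauchy_weight4], uniformly in the parameter; the interval from -1 to 1 serves as a
    neighbourhood of 0. *)
Lemma is_derive_shoperator P K K' v : rapid P -> shkernel K -> shkernel K' ->
  (forall p x, is_derive x v (K p : _ -> R^o) (K' p x)) ->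
  forall x, is_derive x v (shoperator P K : _ -> R^o) (shoperator P K' x).
Proof.
move=> rP sK sK' dK x.
have [C [C0 H]] := shoperator_dominated rP sK'.
pose f (t : R) (p : mS) := P p * K p (x + t *: v).
have df (t : R) p : is_derive t (1 : R) (fun t => f t p : R^o) (P p * K' p (x + t *: v)).
  have := (is_derive_lineP (K p : _ -> R^o) x v t (K' p (x + t *: v))).1 (dK p _).
  exact: is_deriveZ.
have d1 t p : partial1of2 f t p = P p * K' p (x + t *: v).
  by rewrite partial1of2E; have [_ ->] := df t p.
have I0 : `](-1 : R), 1[%classic (0 : R) by rewrite /= in_itv /= ltrN10 ltr01.
have if_ (t : R) : lebesgue4.-integrable setT (EFin \o f t).
  exact: shoperator_integrable.
have G0 (p : mS) : 0 <= C * cauchy_weight4 p.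
  by rewrite mulr_ge0// ltW// cauchy_weight4_gt0.
have Gub (t : R) (p : mS) : `](-1 : R), 1[%classic t -> setT p ->
    `|partial1of2 f t p| <= C * cauchy_weight4 p.
  by move=> _ _; rewrite d1 H.
have dd (t : R) (p : mS) : `](-1 : R), 1[%classic t -> setT p -> derivable (f^~ p) t 1.
  by move=> _ _; have [] := df t p.
have D1 := derivable_under_integral measurableT I0 (fun t _ => if_ t) dd G0
  (integrable_cauchy_weight4Z C) Gub.
have D2 := differentiation_under_integral measurableT I0 (fun t _ => if_ t) dd G0
  (integrable_cauchy_weight4Z C) Gub.
rewrite -[x in is_derive x](addr0 x) -(scale0r v); apply/is_derive_lineP.
apply: DeriveDef; first exact: D1.
rewrite -derive1E D2; apply: eq_Rintegral => p _ /=.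
by rewrite d1 scale0r addr0.
Qed.

(** The exponent and the constant come from the kernel alone; once the pointwise bound is divided by
    the power of [jap2 x], the only new factor is the integral of [cauchy_weight4]. *)
Lemma shoperator_bound K (k : nat) : shkernel K -> exists N C, 0 <= C /\
  forall P A, rapid P -> (forall p, shdom p -> shweight p ^+ N * `|P p| <= A) ->
  forall x, jap2 x ^+ k * `|shoperator P K x| <= C * A.
Proof.
move=> sK; have [N [C [C0 HK]]] := shkernel_bound k sK.
pose I4 : R := \int[lebesgue4]_p cauchy_weight4 p.
exists (N + 2)%N, (C * I4); split.
  by rewrite mulr_ge0//; apply: Rintegral_ge0 => p _; rewrite ltW// cauchy_weight4_gt0.
move=> P A rP HP x; have [_ P0 _] := rP.
have H := shoperator_integrand_bound P0 HK C0 HP.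
have iPK := shoperator_integrable x rP sK.
have j0 : 0 < jap2 x by exact: lt_le_trans (jap2_ge1 x).
rewrite mulrC -ler_pdivlMr ?exprn_gt0//.
apply: le_trans (le_normr_Rintegral measurableT iPK) _.
have -> : C * I4 * A / jap2 x ^+ k =
    \int[lebesgue4]_p (C * A / jap2 x ^+ k * cauchy_weight4 p).
  rewrite RintegralZl//; last exact: integrable_cauchy_weight4.
  by rewrite /I4; ring.
apply: le_Rintegral => //.
- have /integrable_abse := iPK.
  by apply: eq_integrable => //.
- exact: integrable_cauchy_weight4Z.
- move=> p _; rewrite mulrAC ler_pdivlMr ?exprn_gt0// mulrC; exact: H.
Qed.

(** Both partial derivatives are given by operators of the same kind, hence bounded, and two mean
    values make the function Lipschitz. *)
Lemma continuous_shoperator P K : rapid P -> shkernel K ->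
  continuous (shoperator P K : R * R -> R).
Proof.
move=> rP sK x.
have E v : v \in [:: coord2_1; coord2_2] -> exists df, exists2 M, 0 < M &
   forall y, is_derive y v (shoperator P K : _ -> R^o) (df y) /\ `|df y| <= M.
  move=> vE; have [K' sK' dK] := shkernel_derive sK vE.
  have [N [C [C0 H]]] := shoperator_bound 0 sK'.
  have [_ _ /(_ N) [A HA]] := rP.
  exists (shoperator P K'), (`|C * A| + 1); first by rewrite ltr_wpDl.
  move=> y; split; first exact: is_derive_shoperator.
  have := H P A rP HA y; rewrite expr0 mul1r => /le_trans; apply.
  by rewrite (le_trans (ler_norm _))// lerDl.
have e1 : coord2_1 \in [:: (@coord2_1 R); coord2_2] by rewrite inE eqxx.
have e2 : coord2_2 \in [:: (@coord2_1 R); coord2_2] by rewrite !inE eqxx orbT.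
have [d1 [M1 M10 H1]] := E _ e1.
have [d2 [M2 M20 H2]] := E _ e2.
apply/(@cvgrPdist_lt _ R^o) => e e0.
have M0 : 0 < M1 + M2 by exact: addr_gt0.
exists (ball x.1 (e / (M1 + M2)), ball x.2 (e / (M1 + M2))) => /=.
  by split; apply: nbhsx_ballx; exact: divr_gt0.
move=> y [/= y1 y2].
set T := shoperator P K.
have [a [_ Ea]] := MVT_between y.1 x.1 (fun t => is_derive_line1 t y.2 (fun z => (H1 z).1)).
have [b [_ Eb]] := MVT_between y.2 x.2 (fun t => is_derive_line2 t x.1 (fun z => (H2 z).1)).
rewrite (_ : T x - T y = d1 (a, y.2) * (x.1 - y.1) + d2 (x.1, b) * (x.2 - y.2)); last first.
  rewrite -Ea -Eb -!surjective_pairing; rewrite /T; ring.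
apply: le_lt_trans (ler_normD _ _) _; rewrite !normrM.
have -> : e = M1 * (e / (M1 + M2)) + M2 * (e / (M1 + M2)).
  by field; rewrite gt_eqF.
apply: ltrD.
  apply: (@le_lt_trans _ _ (M1 * `|x.1 - y.1|)); last by rewrite ltr_pM2l.
  by rewrite ler_wpM2r// (H1 _).2.
apply: (@le_lt_trans _ _ (M2 * `|x.2 - y.2|)); last by rewrite ltr_pM2l.
by rewrite ler_wpM2r// (H2 _).2.
Qed.

End shearlet_kernels.

(** * Complex-valued operators and their seminorms *)

Section synthesis_pairs.
Context {R : realType}.
Local Notation mR := (measurableTypeR R).
Local Notation mu := (@lebesgue_measure R).
Local Notation S := (R * R * R * R)%type.
Local Notation mS := (mR * mR * mR * mR)%type.
Implicit Types (p : S) (x v : R * R) (Phi : S -> R[i]) (K : S -> R * R -> R).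

Lemma continuous_complex (T : topologicalType) (f : T -> R[i]^o) (x : T) :
  {for x, continuous (fun y => complex.Re (f y) : R)} ->
  {for x, continuous (fun y => complex.Im (f y) : R)} ->
  {for x, continuous f}.
Proof.
move=> cR cI; apply/(@cvgrPdist_lt R[i] R[i]^o _ _ (nbhs_filter x)) => e e0.
(* In the order of [R[i]] a positive number has zero imaginary part. *)
have [er ei] : 0 < complex.Re e /\ complex.Im e = 0.
  by move: e0; case: e => a b; rewrite ltcE /= => /andP[/eqP -> ->].
have eE : e = ((complex.Re e)%:C)%C by case: (e) ei => a b /= ->.
have e2 : 0 < complex.Re e / 2 by rewrite divr_gt0.
have /(@cvgrPdist_lt _ R^o)/(_ _ e2) nR := cR.
have /(@cvgrPdist_lt _ R^o)/(_ _ e2) nI := cI.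
apply: filterS2 nR nI => y yR yI.
rewrite eE; move: (f x) (f y) yR yI => [a1 b1] [a2 b2] /= yR yI; rewrite normc_def ltcR /=.
apply: le_lt_trans (cmod_le ((a1 - a2) +i* (b1 - b2))%C) _.
by rewrite /= [ltRHS]splitr; exact: ltrD.
Qed.

Definition rapidc Phi := rapid (fun p => complex.Re (Phi p)) /\
  rapid (fun p => complex.Im (Phi p)).

(** The integral of [Phi] times the complex conjugate of [K1 + i K2], written with real
    integrals. *)
Definition shpair K1 K2 Phi x : R[i]^o :=
  ((shoperator (fun p => complex.Re (Phi p)) K1 x +
    shoperator (fun p => complex.Im (Phi p)) K2 x)
   +i* (shoperator (fun p => complex.Im (Phi p)) K1 x -
    shoperator (fun p => complex.Re (Phi p)) K2 x))%C.

Lemma continuous_shpair K1 K2 Phi : shkernel K1 -> shkernel K2 -> rapidc Phi ->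
  continuous (shpair K1 K2 Phi).
Proof.
move=> s1 s2 [r1 r2] x; apply: continuous_complex.
  by apply: cvgD; exact: continuous_shoperator.
by apply: cvgB; exact: continuous_shoperator.
Qed.

(** The new kernels are chosen before [Phi], so that the bounds obtained for them are uniform in
    [Phi]. *)
Lemma cpartial_shpair K1 K2 v : shkernel K1 -> shkernel K2 ->
  v \in [:: coord2_1; coord2_2] -> exists K1' K2', [/\ shkernel K1', shkernel K2' &
  forall Phi, rapidc Phi -> cpartial v (shpair K1 K2 Phi) = shpair K1' K2' Phi /\
    forall x, cderivable (shpair K1 K2 Phi) x v].
Proof.
move=> s1 s2 vE; have [K1' s1' d1] := shkernel_derive s1 vE.
have [K2' s2' d2] := shkernel_derive s2 vE.
exists K1', K2'; split => // Phi [r1 r2].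
have DR x : is_derive x v (fun y => complex.Re (shpair K1 K2 Phi y) : R^o)
    (complex.Re (shpair K1' K2' Phi x)).
  by apply: is_deriveD; exact: is_derive_shoperator.
have DI x : is_derive x v (fun y => complex.Im (shpair K1 K2 Phi y) : R^o)
    (complex.Im (shpair K1' K2' Phi x)).
  by apply: is_deriveB; exact: is_derive_shoperator.
split; last by move=> x; split; [case: (DR x)|case: (DI x)].
apply/funext => x; apply: complex_ext; rewrite /cpartial.
  by have [_ <-] := DR x.
by have [_ <-] := DI x.
Qed.

Lemma cpartials_shpair K1 K2 s : shkernel K1 -> shkernel K2 ->
  {subset s <= [:: coord2_1; coord2_2]} -> exists K1' K2', [/\ shkernel K1', shkernel K2' &
  forall Phi, rapidc Phi -> cpartials s (shpair K1 K2 Phi) = shpair K1' K2' Phi].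
Proof.
move=> s1 s2; elim: s => [|v s IH] sE; first by exists K1, K2.
have [|L1 [L2 [l1 l2 E]]] := IH; first by move=> u us; apply: sE; rewrite inE us orbT.
have [|K1' [K2' [k1 k2 E']]] := @cpartial_shpair L1 L2 v l1 l2.
  by apply: sE; rewrite inE eqxx.
exists K1', K2'; split => // Phi rPhi.
by rewrite /= -/(cpartials s _) E//; have [] := E' Phi rPhi.
Qed.

Lemma smooth_shpair K1 K2 Phi : shkernel K1 -> shkernel K2 -> rapidc Phi ->
  smooth_on [:: coord2_1; coord2_2] setT (shpair K1 K2 Phi).
Proof.
move=> s1 s2 rPhi s sE x _; have [L1 [L2 [l1 l2 E]]] := cpartials_shpair s1 s2 sE.
rewrite E//; split; first exact: continuous_shpair.
move=> v vE; have [K1' [K2' [_ _ /(_ Phi rPhi) [_]]]] := cpartial_shpair l1 l2 vE.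
exact.
Qed.

Lemma shpair_bound K1 K2 (k : nat) : shkernel K1 -> shkernel K2 ->
  exists N C, 0 <= C /\ forall Phi A, rapidc Phi ->
  (forall p, shdom p -> shweight p ^+ N * cmod (Phi p) <= A) ->
  forall x, jap2 x ^+ k * cmod (shpair K1 K2 Phi x) <= C * A.
Proof.
move=> s1 s2; have [N1 [C1 [C10 H1]]] := shoperator_bound k s1.
have [N2 [C2 [C20 H2]]] := shoperator_bound k s2.
exists (N1 + N2)%N, (2 * (C1 + C2)); split; first by rewrite mulr_ge0// addr_ge0.
move=> Phi A [rR rI] HA x.
have bound N (P : S -> R) : (N <= N1 + N2)%N -> (forall p, `|P p| <= cmod (Phi p)) ->
    forall p, shdom p -> shweight p ^+ N * `|P p| <= A.
  move=> NN PP p Sp; apply: le_trans (HA p Sp).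
  have w1 := shweight_ge1 Sp.
  have w0 : 0 <= shweight p by exact: le_trans w1.
  by apply: ler_pM => //; [exact: exprn_ge0|exact: ler_weXn2l].
have RL p : `|complex.Re (Phi p)| <= cmod (Phi p) by exact: normr_Re_le.
have IL p : `|complex.Im (Phi p)| <= cmod (Phi p) by exact: normr_Im_le.
have A1 := H1 _ A rR (bound _ _ (leq_addr _ _) RL) x.
have A2 := H1 _ A rI (bound _ _ (leq_addr _ _) IL) x.
have A3 := H2 _ A rR (bound _ _ (leq_addl _ _) RL) x.
have A4 := H2 _ A rI (bound _ _ (leq_addl _ _) IL) x.
have j0 : 0 <= jap2 x ^+ k by rewrite exprn_ge0// sqrtr_ge0.
apply: (@le_trans _ _ (jap2 x ^+ k * (`|complex.Re (shpair K1 K2 Phi x)| +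
  `|complex.Im (shpair K1 K2 Phi x)|))); first by rewrite ler_wpM2l// cmod_le.
apply: (@le_trans _ _ (C1 * A + C2 * A + (C1 * A + C2 * A))); last lra.
rewrite mulrDr lerD//.
  apply: le_trans (_ : _ <= jap2 x ^+ k * (_ + _)) _.
    by apply: ler_wpM2l => //; exact: ler_normD.
  by rewrite mulrDr lerD.
apply: le_trans (_ : _ <= jap2 x ^+ k * (_ + _)) _.
  by apply: ler_wpM2l => //; exact: ler_normB.
by rewrite mulrDr lerD.
Qed.

End synthesis_pairs.

Section shschwartz_rapid.
Context {R : realType}.
Local Notation S := (R * R * R * R)%type.
Variable Phi : S -> R[i]^o.
Hypothesis SPhi : is_shschwartz Phi.

Definition shnorm0 (N : nat) : shnorm_index := ((N, N, N, N), (0, 0, 0, 0))%N.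

(** The factor [2 ^+ N] appears because |a| + 1/|a| is at most twice its larger term, and the [N]-th
    power of that term is one of the summands in the weight of [shnorm]. *)
Lemma shnorm0_bound (N : nat) p : shdom p ->
  shweight p ^+ N * cmod (Phi p) <= 2 ^+ N * fine (shnorm (shnorm0 N) Phi).
Proof.
move=> Sp; have [_ _ /(_ (shnorm0 N)) nPhi] := SPhi.
have w1 := shweight_ge1 Sp.
case: p Sp w1 => [[[b1 b2] s] a] a0 w1.
have H : ((jap1 b1 ^+ N * jap1 b2 ^+ N * jap1 s ^+ N * (`|a| ^+ N + (`|a| ^+ N)^-1)
    * cmod (Phi (b1, b2, s, a)))%:E <= shnorm (shnorm0 N) Phi)%E.
  by apply: ereal_sup_ubound; exists (b1, b2, s, a).
have f : shnorm (shnorm0 N) Phi \is a fin_num.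
  rewrite ge0_fin_numE//; apply: le_trans H.
  by rewrite lee_fin !mulr_ge0 ?exprn_ge0 ?sqrtr_ge0 ?cmod_ge0// addr_ge0// ?invr_ge0 exprn_ge0.
move: H; rewrite -[X in (_ <= X)%E](fineK f) lee_fin => H.
have e2 : (0 : R) <= 2 ^+ N by rewrite exprn_ge0.
apply: le_trans (ler_wpM2l e2 H); rewrite mulrA ler_wpM2r ?cmod_ge0//.
rewrite /shweight /= !exprMn mulrCA ler_wpM2l ?mulr_ge0 ?exprn_ge0 ?sqrtr_ge0//.
have : 0 < `|a| by rewrite normr_gt0.
move: `|a| => u u0.
have ui0 : 0 < u^-1 by rewrite invr_gt0.
rewrite -exprVn.
have [uv|/ltW uv] := leP u u^-1.
  apply: (@le_trans _ _ ((2 * u^-1) ^+ N)).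
    have h1 : 0 <= u + u^-1 by lra.
    have h2 : 0 <= 2 * u^-1 by lra.
    by rewrite lerXn2r ?nnegrE//; lra.
  by rewrite exprMn ler_wpM2l// lerDr exprn_ge0// ltW.
apply: (@le_trans _ _ ((2 * u) ^+ N)).
  have h1 : 0 <= u + u^-1 by lra.
  have h2 : 0 <= 2 * u by lra.
  by rewrite lerXn2r ?nnegrE//; lra.
by rewrite exprMn ler_wpM2l// lerDl exprn_ge0// ltW.
Qed.

Lemma shschwartz_rapidc : rapidc Phi.
Proof.
have [P0 sP _] := SPhi.
have cP p : shdom p -> {for p, continuous Phi}.
  by move=> Sp; have [//|] := sP [::] _ p Sp.
split; split.
- apply: shdom_continuous_measurable => [p /P0 -> //|p /cP h].
  exact: (continuous_comp h (@cRe_continuous _ _)).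
- by move=> p /P0 ->.
- move=> N; exists (2 ^+ N * fine (shnorm (shnorm0 N) Phi)) => p Sp.
  apply: le_trans (shnorm0_bound N Sp); rewrite ler_wpM2l ?normr_Re_le//.
  by rewrite exprn_ge0// (le_trans ler01)// shweight_ge1.
- apply: shdom_continuous_measurable => [p /P0 -> //|p /cP h].
  exact: (continuous_comp h (@cIm_continuous _ _)).
- by move=> p /P0 ->.
- move=> N; exists (2 ^+ N * fine (shnorm (shnorm0 N) Phi)) => p Sp.
  apply: le_trans (shnorm0_bound N Sp); rewrite ler_wpM2l ?normr_Im_le//.
  by rewrite exprn_ge0// (le_trans ler01)// shweight_ge1.
Qed.

End shschwartz_rapid.

(** * The synthesis operator as an integral over R^4 *)

Section synthesis_operator.
Context {R : realType}.
Local Notation mR := (measurableTypeR R).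
Local Notation mu := (@lebesgue_measure R).
Local Notation S := (R * R * R * R)%type.
Local Notation mS := (mR * mR * mR * mR)%type.

(** The explicit majorant gives integrability of every slice at fixed [a], so that Fubini can be
    applied again inside the outer integral. *)
Lemma Rintegral_lebesgue4 (F : mS -> R) (C : R) : measurable_fun setT F ->
  (forall p, `|F p| <= C * cauchy_weight4 p) ->
  \int[mu]_a \int[mu]_s \int[leb2]_b F (b, s, a) = \int[lebesgue4]_p F p.
Proof.
move=> mF HF.
have iF : lebesgue4.-integrable setT (EFin \o F).
  apply: (le_integrable _ _ _ (integrable_cauchy_weight4Z C)) => //.
    exact/measurable_EFinP.
  by move=> p _; rewrite /= lee_fin; exact: le_trans (HF p) (ler_norm _).
rewrite -(Rintegral_fubini21 iF); apply: eq_Rintegral => a _.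
have iFa : lebesgue3.-integrable setT (EFin \o (fun q => F (q, a))).
  apply: (@le_integrable _ _ _ lebesgue3 _ _ _ (EFin \o (fun q : mR * mR * mR =>
     (C * cauchy_weight a) *
     (cauchy_weight q.1.1 * cauchy_weight q.1.2 * cauchy_weight q.2)))) => //.
  - by apply/measurable_EFinP; apply: measurableT_comp mF _; exact: measurable_fun_pair.
  - move=> q _; rewrite /= lee_fin; apply: le_trans (HF (q, a)) _.
    rewrite (le_trans (ler_norm _))//; rewrite [X in X <= _](_ : _ = `|C * cauchy_weight a *
      (cauchy_weight q.1.1 * cauchy_weight q.1.2 * cauchy_weight q.2)|)//.
    by congr (`| _ |); rewrite /cauchy_weight4 /=; ring.
  - by apply: integrable_EFinZl => //; exact: integrable_cauchy_weight3.
by rewrite -(Rintegral_fubini21 iFa).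
Qed.

Lemma invmx_mx22 (a b c d : R) : a * d - b * c != 0 ->
  invmx (mx22 a b c d) = (a * d - b * c)^-1 *: mx22 d (- b) (- c) a.
Proof.
set D := a * d - b * c => D0.
have E : mx22 a b c d *m (D^-1 *: mx22 d (- b) (- c) a) = 1%:M.
  apply/matrixP => i j; rewrite !mxE !big_ord_recl big_ord0 !mxE /=.
  case: i => [[|[|//]] ?]; case: j => [[|[|//]] ?] /=; rewrite /D; field => //.
have [U _] := mulmx1_unit E.
by rewrite -[RHS](mulKmx U) E mulmx1.
Qed.

Lemma shearlet_coordE (b : R * R) (s a : R) (x : R * R) : a != 0 ->
  mx_app (invmx (dilation_mx a)) (mx_app (invmx (shear_mx s)) (x - b)) =
  shear_coord (b, s, a) x.
Proof.
move=> a0; have r0 : Num.sqrt `|a| != 0 by rewrite sqrtr_eq0 -ltNge normr_gt0.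
have rE : `|a| `^ (- 2^-1) = (Num.sqrt `|a|)^-1.
  by rewrite powRN powR12_sqrt.
have -> : dilation_mx a = mx22 a 0 0 (a * (Num.sqrt `|a|)^-1).
  apply/matrixP => i j; rewrite !mxE rE.
  by case: i => [[|[|//]] ?]; case: j => [[|[|//]] ?] /=; rewrite ?mulr1 ?mulr0.
rewrite /shear_mx !invmx_mx22; last 2 first.
- by rewrite mulr1 mulr0 subr0 oner_eq0.
- by rewrite mulr0 subr0 !mulf_neq0// invr_eq0.
rewrite /mx_app !mxE /= /shear_coord /shear_lin /=.
by congr pair; field; rewrite a0 r0.
Qed.

(** The normalisation of the shearlet times the density of the measure in the scale. *)
Definition synthesis_weight (p : S) : R := `|p.2| `^ (- (3 / 4)) / `|p.2| ^+ 3.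

(** The exponent 4 counts three powers of 1/|a| from the measure and one that dominates the
    normalisation, which is at most 1 or at most 1/|a|. *)
Lemma tempered_synthesis_weight : tempered synthesis_weight.
Proof.
have mn : measurable_fun setT (fun p : mS => `|p.2|).
  by apply: (measurableT_comp (@normr_measurable R setT)); exact: measurable_snd.
split.
  apply: (@measurable_funM _ mS).
    exact: (measurableT_comp (measurable_powR (- (3 / 4)))) mn.
  have [mi _] := @tempered_inv R.
  rewrite (_ : (fun p => _) = (fun p : mS => `|p.2^-1| ^+ 3)); last first.
    by apply/funext => p; rewrite normfV exprVn.
  by apply: measurable_funX; apply: (measurableT_comp (@normr_measurable R setT)).
exists 4%N, 1; split => // p Sp; rewrite mul1r /synthesis_weight normrM.
have [_ h _] := shweight_scale Sp; have w1 := shweight_ge1 Sp.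
have a0 : 0 < `|p.2| by rewrite normr_gt0.
rewrite normfV normrX normr_id -exprVn (exprS _ 3) ler_pM ?exprn_ge0 ?invr_ge0//; last first.
  by rewrite lerXn2r ?nnegrE ?invr_ge0// (le_trans ler01).
rewrite ger0_norm ?powR_ge0// powRN.
have [a1|a1] := leP 1 `|p.2|.
  rewrite (le_trans _ w1)// invf_le1 ?powR_gt0//.
  by rewrite -(powRr0 `|p.2|) ler_powR// divr_ge0.
apply: le_trans h; rewrite lef_pV2 ?posrE ?powR_gt0//.
rewrite -[leLHS](powRr1 (ltW a0)).
by rewrite ger_powR ?a0 ?(ltW a1)// ler_pdivrMr// mul1r ler_nat.
Qed.

Variable psi : R * R -> R[i]^o.
Hypothesis Spsi : is_schwartz2 psi.

Definition synthesis_kernel1 (p : S) x := synthesis_weight p * complex.Re (psi (shear_coord p x)).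
Definition synthesis_kernel2 (p : S) x := synthesis_weight p * complex.Im (psi (shear_coord p x)).

Lemma shkernel_synthesis1 : shkernel synthesis_kernel1.
Proof.
exact: (@shkernel_jet R synthesis_weight
  (fun n1 n2 x => complex.Re (cpartials (multi2 (n1, n2)) psi x)) 0 0
  tempered_synthesis_weight (schwartz_jet_Re Spsi)).
Qed.

Lemma shkernel_synthesis2 : shkernel synthesis_kernel2.
Proof.
exact: (@shkernel_jet R synthesis_weight
  (fun n1 n2 x => complex.Im (cpartials (multi2 (n1, n2)) psi x)) 0 0
  tempered_synthesis_weight (schwartz_jet_Im Spsi)).
Qed.

Lemma synthesis_integrandE (Phi : S -> R[i]) b s a x : (forall p, ~ shdom p -> Phi p = 0) ->
  Phi (b, s, a) * (shearlet psi b s a x)^*%C / ((`|a| ^+ 3)%:C)%C =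
  ((complex.Re (Phi (b, s, a)) * synthesis_kernel1 (b, s, a) x +
    complex.Im (Phi (b, s, a)) * synthesis_kernel2 (b, s, a) x) +i*
   (complex.Im (Phi (b, s, a)) * synthesis_kernel1 (b, s, a) x -
    complex.Re (Phi (b, s, a)) * synthesis_kernel2 (b, s, a) x))%C.
Proof.
move=> P0; have [->|a0] := eqVneq a 0.
  have -> : Phi (b, s, 0) = 0 by apply: P0; rewrite /shdom /= eqxx.
  by rewrite !mul0r addr0 subr0.
rewrite /shearlet shearlet_coordE// /synthesis_kernel1 /synthesis_kernel2.
case: (psi _) (Phi _) => q1 q2 [P1 P2]; rewrite -fmorphV /synthesis_weight /=.
set r := `|a| `^ _; set t := (`|a| ^+ 3)^-1.
by apply: complex_ext => /=; ring.
Qed.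

(** The domain of scales can be completed to the whole line because [Phi] vanishes at scale 0; the
    iterated integral then becomes a single integral over R^4. *)
Lemma synthesisE (Phi : S -> R[i]) : (forall p, ~ shdom p -> Phi p = 0) -> rapidc Phi ->
  synthesis psi Phi = shpair synthesis_kernel1 synthesis_kernel2 Phi.
Proof.
move=> P0 [rR rI]; apply/funext => x.
have s1 := shkernel_synthesis1; have s2 := shkernel_synthesis2.
have key (F : mS -> R) (C : R) : measurable_fun setT F ->
    (forall p, `|F p| <= C * cauchy_weight4 p) -> (forall p, ~ shdom p -> F p = 0) ->
    \int[leb1]_(a in [set a | a != 0]) \int[leb1]_s \int[leb2]_b F (b, s, a) =
    \int[lebesgue4]_p F p.
  move=> mF HF F0; rewrite -(Rintegral_lebesgue4 mF HF) Rintegral_mkcond.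
  apply: eq_Rintegral => a _; rewrite patchE; case: ifPn => //.
  rewrite notin_setE /= => /negP; rewrite negbK => /eqP ->.
  under eq_Rintegral.
    move=> s _; under eq_Rintegral do rewrite F0 /shdom /= ?eqxx//.
    rewrite Rintegral_cst//= mul0r; over.
  by rewrite Rintegral_cst//= mul0r.
set PR := fun p => complex.Re (Phi p); set PI := fun p => complex.Im (Phi p).
(* The sign [e] is 1 for the real part and -1 for the imaginary part. *)
have fin (P Q : S -> R) (e : R) : rapid P -> rapid Q -> `|e| <= 1 ->
    \int[leb1]_(a in [set a | a != 0]) \int[leb1]_s \int[leb2]_b
      (P (b, s, a) * synthesis_kernel1 (b, s, a) x +
       e * (Q (b, s, a) * synthesis_kernel2 (b, s, a) x)) =
    shoperator P synthesis_kernel1 x + e * shoperator Q synthesis_kernel2 x.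
  move=> rP rQ e1.
  have [C1 [C10 H1]] := shoperator_dominated rP s1.
  have [C2 [C20 H2]] := shoperator_dominated rQ s2.
  pose F p := P p * synthesis_kernel1 p x + e * (Q p * synthesis_kernel2 p x).
  rewrite -[LHS]/(\int[leb1]_(a in [set a | a != 0]) \int[leb1]_s \int[leb2]_b F (b, s, a)).
  rewrite (key F (C1 + C2)).
  - rewrite RintegralD//.
    + by rewrite RintegralZl//; exact: shoperator_integrable.
    + exact: shoperator_integrable.
    + by apply: integrable_EFinZl => //; exact: shoperator_integrable.
  - apply: measurable_funD; first exact: measurable_shoperator_integrand.
    by apply: measurable_funM => //; exact: measurable_shoperator_integrand.
  - move=> p; rewrite mulrDl (le_trans (ler_normD _ _))// lerD// normrM.
    by apply: le_trans (H2 p x); rewrite ler_piMl.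
  - move=> p Np; have [_ P0' _] := rP; have [_ Q0' _] := rQ.
    by rewrite /F P0'// Q0'// !mul0r mulr0 addr0.
apply: complex_ext.
  transitivity (\int[leb1]_(a in [set a | a != 0]) \int[leb1]_s \int[leb2]_b
      (PR (b, s, a) * synthesis_kernel1 (b, s, a) x +
       1 * (PI (b, s, a) * synthesis_kernel2 (b, s, a) x))).
    apply: eq_Rintegral => a _; apply: eq_Rintegral => s _; apply: eq_Rintegral => b _.
    by rewrite synthesis_integrandE//= mul1r.
  by rewrite fin ?normr1// mul1r.
transitivity (\int[leb1]_(a in [set a | a != 0]) \int[leb1]_s \int[leb2]_b
    (PI (b, s, a) * synthesis_kernel1 (b, s, a) x +
     (-1) * (PR (b, s, a) * synthesis_kernel2 (b, s, a) x))).
  apply: eq_Rintegral => a _; apply: eq_Rintegral => s _; apply: eq_Rintegral => b _.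
  by rewrite synthesis_integrandE//= mulN1r.
by rewrite fin ?normrN1// mulN1r.
Qed.

End synthesis_operator.

(** * Moments of the synthesis of a function *)

Section rapid_plane.
Context {R : realType}.
Local Notation mR := (measurableTypeR R).
Local Notation mu := (@lebesgue_measure R).
Local Notation S := (R * R * R * R)%type.
Local Notation mS := (mR * mR * mR * mR)%type.
Implicit Types (q : R * R -> R) (x : R * R).

Definition rapid2 q := measurable_fun setT (q : mR * mR -> R) /\
  forall k, exists M, forall x, jap2 x ^+ k * `|q x| <= M.

Lemma sqr_jap2 x : jap2 x ^+ 2 = 1 + (x.1 ^+ 2 + x.2 ^+ 2).
Proof. by rewrite sqr_sqrtr// !addr_ge0// sqr_ge0. Qed.

(** Each of 1 + x1^2 and 1 + x2^2 is at most [jap2 x ^+ 2]. *)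
Lemma cauchy_weight2_jap2 x : 1 <= cauchy_weight x.1 * cauchy_weight x.2 * jap2 x ^+ 4.
Proof.
rewrite (_ : 4 = 2 + 2)%N// exprD sqr_jap2 /cauchy_weight -invfM mulrC.
rewrite ler_pdivlMr ?mul1r; last by rewrite mulr_gt0// ltr_pwDl// sqr_ge0.
by rewrite ler_pM ?addr_ge0 ?sqr_ge0// lerD2l ?lerDl ?lerDr sqr_ge0.
Qed.

Lemma rapid2_bound q : rapid2 q ->
  exists M, 0 <= M /\ forall x, `|q x| <= M * (cauchy_weight x.1 * cauchy_weight x.2).
Proof.
move=> [_ /(_ 4%N) [M H]]; exists M; split.
  by apply: le_trans (H (0, 0)); rewrite mulr_ge0// exprn_ge0// sqrtr_ge0.
move=> x; have c0 : 0 <= cauchy_weight x.1 * cauchy_weight x.2.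
  by rewrite mulr_ge0// ltW// cauchy_weight_gt0.
apply: (@le_trans _ _ (cauchy_weight x.1 * cauchy_weight x.2 * jap2 x ^+ 4 * `|q x|)).
  by rewrite ler_peMl// cauchy_weight2_jap2.
by rewrite -mulrA mulrC ler_wpM2r.
Qed.

Lemma rapid2_integrable q : rapid2 q -> lebesgue2.-integrable setT (EFin \o (q : mR * mR -> R)).
Proof.
move=> rq; have [M [M0 H]] := rapid2_bound rq; have [mq _] := rq.
apply: (@le_integrable _ _ _ lebesgue2 _ _ _
  (EFin \o (fun x : mR * mR => M * (cauchy_weight x.1 * cauchy_weight x.2)))) => //.
- exact/measurable_EFinP.
- by move=> x _; rewrite /= lee_fin; exact: le_trans (H x) (ler_norm _).
- by apply: integrable_EFinZl => //; exact: integrable_cauchy_weight2.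
Qed.

Lemma rapid2_integrable1 q y : rapid2 q ->
  mu.-integrable setT (EFin \o (fun u : mR => q (u, y))).
Proof.
move=> rq; have [M [M0 H]] := rapid2_bound rq; have [mq _] := rq.
apply: (@le_integrable _ _ _ mu _ _ _
  (EFin \o (fun u : mR => (M * cauchy_weight y) * cauchy_weight u))) => //.
- apply/measurable_EFinP; apply: measurableT_comp mq _; exact: measurable_fun_pair.
- move=> u _; rewrite /= lee_fin; apply: le_trans (H (u, y)) _ => /=.
  by rewrite (mulrC (cauchy_weight u)) mulrA ler_norm.
- by apply: integrable_EFinZl => //; exact: integrable_cauchy_weight.
Qed.

Lemma rapid2D q1 q2 : rapid2 q1 -> rapid2 q2 -> rapid2 (fun x => q1 x + q2 x).
Proof.
move=> [m1 H1] [m2 H2]; split; first exact: measurable_funD.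
move=> k; have [M1 {}H1] := H1 k; have [M2 {}H2] := H2 k; exists (M1 + M2) => x.
apply: (@le_trans _ _ (jap2 x ^+ k * (`|q1 x| + `|q2 x|))).
  by rewrite ler_wpM2l ?exprn_ge0 ?sqrtr_ge0// ler_normD.
by rewrite mulrDr lerD.
Qed.

Lemma rapid2Z (c : R) q : rapid2 q -> rapid2 (fun x => c * q x).
Proof.
move=> [m1 H1]; split; first exact: measurable_funM.
move=> k; have [M1 {}H1] := H1 k; exists (`|c| * M1) => x.
by rewrite normrM mulrCA ler_wpM2l.
Qed.

Lemma rapid2_x1 q : rapid2 q -> rapid2 (fun x => x.1 * q x).
Proof.
move=> [m1 H1]; split; first by apply: measurable_funM => //; exact: measurable_fst.
move=> k; have [M1 {}H1] := H1 k.+1; exists M1 => x.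
apply: le_trans (H1 x); rewrite normrM mulrA exprSr ler_wpM2r// ler_wpM2l//.
  by rewrite exprn_ge0// sqrtr_ge0.
exact: ler_norm1_jap2.
Qed.

Lemma rapid2_x2 q : rapid2 q -> rapid2 (fun x => x.2 * q x).
Proof.
move=> [m1 H1]; split; first by apply: measurable_funM => //; exact: measurable_snd.
move=> k; have [M1 {}H1] := H1 k.+1; exists M1 => x.
apply: le_trans (H1 x); rewrite normrM mulrA exprSr ler_wpM2r// ler_wpM2l//.
  by rewrite exprn_ge0// sqrtr_ge0.
exact: ler_norm2_jap2.
Qed.

(** Undoing the shear turns monomials in [x] into powers of affine forms in the new variables, hence
    this shape. *)
Lemma rapid2_affine (a b c : R) q (n : nat) : rapid2 q ->
  rapid2 (fun x => (a + b * x.1 + c * x.2) ^+ n * q x).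
Proof.
move=> rq; elim: n => [|n IH]; first by under eq_fun do rewrite expr0 mul1r.
rewrite (_ : (fun x => _) = (fun x =>
  a * ((a + b * x.1 + c * x.2) ^+ n * q x) +
  (b * (x.1 * ((a + b * x.1 + c * x.2) ^+ n * q x)) +
   c * (x.2 * ((a + b * x.1 + c * x.2) ^+ n * q x))))); last first.
  by apply/funext => x; rewrite exprS; ring.
apply: rapid2D; first exact: rapid2Z.
by apply: rapid2D; apply: rapid2Z; [exact: rapid2_x1|exact: rapid2_x2].
Qed.

Lemma rapid2_monomial q (i j : nat) : rapid2 q -> rapid2 (fun x => x.1 ^+ i * x.2 ^+ j * q x).
Proof.
move=> rq; have := rapid2_affine 0 1 0 i (rapid2_affine 0 0 1 j rq).
congr rapid2; apply/funext => x; rewrite !mul0r !mul1r !add0r addr0; ring.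
Qed.

Lemma RintegralD2 q1 q2 : rapid2 q1 -> rapid2 q2 ->
  \int[lebesgue2]_x (q1 x + q2 x) = \int[lebesgue2]_x q1 x + \int[lebesgue2]_x q2 x.
Proof. by move=> r1 r2; rewrite RintegralD//; exact: rapid2_integrable. Qed.

Lemma RintegralZl2 (c : R) q : rapid2 q ->
  \int[lebesgue2]_x (c * q x) = c * \int[lebesgue2]_x q x.
Proof. by move=> r1; rewrite RintegralZl//; exact: rapid2_integrable. Qed.

Definition null_moments q := forall i j : nat,
  \int[lebesgue2]_x (x.1 ^+ i * x.2 ^+ j * q x) = 0.

Lemma null_momentsD q1 q2 : rapid2 q1 -> rapid2 q2 ->
  null_moments q1 -> null_moments q2 -> null_moments (fun x => q1 x + q2 x).
Proof.
move=> r1 r2 n1 n2 i j; under eq_Rintegral do rewrite mulrDr.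
by rewrite RintegralD2 ?n1 ?n2 ?addr0//; exact: rapid2_monomial.
Qed.

Lemma null_momentsZ (c : R) q : rapid2 q ->
  null_moments q -> null_moments (fun x => c * q x).
Proof.
move=> r1 n1 i j; under eq_Rintegral do rewrite mulrCA.
by rewrite RintegralZl2 ?n1 ?mulr0//; exact: rapid2_monomial.
Qed.

Lemma null_moments_x1 q : null_moments q -> null_moments (fun x => x.1 * q x).
Proof.
move=> n1 i j; rewrite -(n1 i.+1 j); apply: eq_Rintegral => x _.
by rewrite exprS; ring.
Qed.

Lemma null_moments_x2 q : null_moments q -> null_moments (fun x => x.2 * q x).
Proof.
move=> n1 i j; rewrite -(n1 i j.+1); apply: eq_Rintegral => x _.
by rewrite exprS; ring.
Qed.

Lemma null_moments_affine (a b c : R) q (n : nat) : rapid2 q -> null_moments q ->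
  null_moments (fun x => (a + b * x.1 + c * x.2) ^+ n * q x).
Proof.
move=> rq nq; elim: n => [|n IH]; first by under eq_fun do rewrite expr0 mul1r.
have rn := rapid2_affine a b c n rq.
rewrite (_ : (fun x => _) = (fun x =>
  a * ((a + b * x.1 + c * x.2) ^+ n * q x) +
  (b * (x.1 * ((a + b * x.1 + c * x.2) ^+ n * q x)) +
   c * (x.2 * ((a + b * x.1 + c * x.2) ^+ n * q x))))); last first.
  by apply/funext => x; rewrite exprS; ring.
have r1 := rapid2_x1 rn; have r2 := rapid2_x2 rn.
apply: null_momentsD; [exact: rapid2Z|by apply: rapid2D; exact: rapid2Z|exact: null_momentsZ|].
apply: null_momentsD; [exact: rapid2Z|exact: rapid2Z| |].
  by apply: null_momentsZ => //; exact: null_moments_x1.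
by apply: null_momentsZ => //; exact: null_moments_x2.
Qed.

Lemma rapid2_shear q (p : S) : shdom p -> (forall k, exists M, forall x, jap2 x ^+ k * `|q x| <= M) ->
  measurable_fun setT (q : mR * mR -> R) -> rapid2 (fun x => q (shear_coord p x)).
Proof.
move=> Sp H mq; split.
  apply: (measurableT_comp mq).
  have m : measurable_fun setT (fun x : mR * mR => (p : mS, x)).
    exact: measurable_fun_pair.
  exact: (measurableT_comp measurable_shear_coord m).
move=> k; have [M {}H] := H k.
exists ((6 * shweight p ^+ 2) ^+ k * M) => x.
have w0 : 0 <= 6 * shweight p ^+ 2.
  by rewrite mulr_ge0// exprn_ge0// (le_trans ler01)// shweight_ge1.
have j0 z : 0 <= jap2 z :> R by exact: sqrtr_ge0.
apply: (@le_trans _ _ ((6 * shweight p ^+ 2 * jap2 (shear_coord p x)) ^+ k *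
    `|q (shear_coord p x)|)).
  have wj : 0 <= 6 * shweight p ^+ 2 * jap2 (shear_coord p x) by exact: mulr_ge0.
  by apply: ler_wpM2r => //; apply: lerXn2r; rewrite ?nnegrE//; exact: jap2_shear_coord.
by rewrite exprMn -mulrA ler_wpM2l// exprn_ge0.
Qed.

(** With (u, v) the sheared point, x2 = c v + b2 and x1 = a u + b1 - s c v, which is handled as two
    successive one-variable substitutions. The monomial becomes a product of powers of affine forms
    in (u, v). *)
Lemma null_moments_shear q (p : S) : shdom p -> rapid2 q -> null_moments q ->
  null_moments (fun x => q (shear_coord p x)).
Proof.
move=> Sp rq nq m1 m2; have [mq Hq] := rq.
case: p Sp => [[[b1 b2] s] a] a0; rewrite /shdom /= in a0.
have r0 : Num.sqrt `|a| != 0 by rewrite sqrtr_eq0 -ltNge normr_gt0.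
pose c := a / Num.sqrt `|a|.
have c0 : c != 0 by rewrite mulf_neq0// invr_eq0.
pose f x := x.1 ^+ m1 * x.2 ^+ m2 * q (shear_coord (b1, b2, s, a) x).
pose g x := (b1 + a * x.1 + (- (s * c)) * x.2) ^+ m1 * ((b2 + 0 * x.1 + c * x.2) ^+ m2 * q x).
have rf : rapid2 f by apply: rapid2_monomial; exact: rapid2_shear.
have rg : rapid2 g by do 2 apply: rapid2_affine.
have ng : null_moments g.
  by apply: null_moments_affine; [exact: rapid2_affine|exact: null_moments_affine].
have fg u v : f (a * u + (b1 - s * (c * v)), c * v + b2) = g (u, v).
  rewrite /f /g /= (_ : shear_coord _ _ = (u, v)); last first.
    rewrite /shear_coord /shear_lin /=; congr pair; rewrite /c; field.
      by rewrite a0 r0.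
    by rewrite a0 r0.
  by rewrite -mulrA; congr (_ ^+ m1 * (_ ^+ m2 * _)); ring.
have mf2 (x2 : R) : measurable_fun setT (fun x1 : mR => f (x1, x2)).
  by have [mf _] := rf; apply: (measurableT_comp mf); exact: measurable_fun_pair.
have inner v : \int[mu]_x1 f (x1, c * v + b2) = `|a| * \int[mu]_u g (u, v).
  rewrite (@Rintegral_affine R a (b1 - s * (c * v)) a0)//.
    by congr (_ * _); apply: eq_Rintegral => u _; rewrite fg.
  have := rapid2_integrable1 v rg; apply: eq_integrable => // u _.
  by rewrite /= -fg.
have [M [M0 gM]] := rapid2_bound rg.
have mg : measurable_fun setT (fun v : mR => \int[mu]_u g (u, v)).
  apply: (@measurable_param_Rintegral _ _ _ _ R mu (fun z : mR * mR => g (z.2, z.1))).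
  by have [mg _] := rg; apply: (measurableT_comp mg); exact: measurable_fun_pair.
(* The outer substitution needs the inner integral to be integrable in [v]; the majorant of [g]
   provides this. *)
have ig : mu.-integrable setT (EFin \o (fun v : mR => \int[mu]_u g (u, v))).
  pose I1 : R := \int[mu]_u cauchy_weight u.
  apply: (@le_integrable _ _ _ mu _ _ _
    (EFin \o (fun v : mR => (M * I1) * cauchy_weight v))) => //.
  - exact/measurable_EFinP.
  - move=> v _; rewrite /= lee_fin; apply: le_trans (ler_norm _).
    apply: le_trans (le_normr_Rintegral measurableT (rapid2_integrable1 v rg)) _.
    rewrite [leRHS](_ : _ = \int[mu]_u ((M * cauchy_weight v) * cauchy_weight u)).
      apply: le_Rintegral => //.
      + by have /integrable_abse := rapid2_integrable1 v rg; apply: eq_integrable.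
      + by apply: integrable_EFinZl => //; exact: integrable_cauchy_weight.
      + by move=> u _; apply: le_trans (gM _) _ => /=; rewrite (mulrC (cauchy_weight u)) mulrA.
    by rewrite RintegralZl//; [rewrite /I1; ring|exact: integrable_cauchy_weight].
  - by apply: integrable_EFinZl => //; exact: integrable_cauchy_weight.
rewrite -[LHS]/(\int[sprod mu mu]_x f x) -Rintegral_fubini21; last exact: rapid2_integrable.
rewrite (@Rintegral_affine R c b2 c0); last 2 first.
- apply: (@measurable_param_Rintegral _ _ _ _ R mu (fun z : mR * mR => f (z.2, z.1))).
  by have [mf _] := rf; apply: (measurableT_comp mf); exact: measurable_fun_pair.
- have := integrable_EFinZl `|a| measurableT ig; apply: eq_integrable => // v _.
  by rewrite /= inner.
under eq_Rintegral do rewrite inner.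
rewrite RintegralZl// (Rintegral_fubini21 (rapid2_integrable rg)).
rewrite (_ : Rintegral _ _ _ = 0) ?mulr0//.
(* The monomial is already absorbed in [g], so only the moment of order zero is left. *)
by rewrite -(ng 0 0)%N; apply: eq_Rintegral => x _; rewrite !expr0 !mul1r.
Qed.

Lemma rapid2_shoperator (P : S -> R) (K : S -> R * R -> R) : rapid P -> shkernel K ->
  rapid2 (shoperator P K).
Proof.
move=> rP sK; split; first by apply: continuous_measurable_fun2; exact: continuous_shoperator.
move=> k; have [N [C [C0 H]]] := shoperator_bound k sK.
by have [_ _ /(_ N) [A HA]] := rP; exists (C * A) => x; exact: H.
Qed.

(** Exchanging the integrals in [p] and [x] leaves, for each fixed [p], a moment of the sheared
    [q]. *)
Lemma null_moments_shoperator (P c : S -> R) q : rapid P -> tempered c ->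
  rapid2 q -> null_moments q ->
  shkernel (fun p x => c p * q (shear_coord p x)) ->
  null_moments (shoperator P (fun p x => c p * q (shear_coord p x))).
Proof.
move=> rP tc rq nq sK m1 m2; set K := fun p x => _ in sK *.
pose F (z : mS * (mR * mR)) := z.2.1 ^+ m1 * z.2.2 ^+ m2 * (P z.1 * K z.1 z.2).
(* The monomial uses [m1 + m2] powers of [jap2 x]; the other 4 make the integrand integrable in
   [x]. *)
have [N [C [C0 HK]]] := shkernel_bound (m1 + m2 + 4) sK.
have [mP P0 /(_ (N + 2)%N) [A HA]] := rP.
have HF := shoperator_integrand_bound P0 HK C0 HA.
have mF : measurable_fun setT F.
  apply: measurable_funM.
    apply: measurable_funM; apply: measurable_funX.
      exact: measurableT_comp measurable_fst measurable_snd.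
    exact: measurableT_comp measurable_snd measurable_snd.
  apply: measurable_funM; first exact: measurableT_comp mP measurable_fst.
  exact: shkernel_measurable.
have FW z : `|F z| <= C * A * (cauchy_weight4 z.1 * (cauchy_weight z.2.1 * cauchy_weight z.2.2)).
  case: z => [p x]; rewrite /F /= normrM normrM !normrX.
  have j0 : 0 <= jap2 x by exact: sqrtr_ge0.
  have c0 : 0 <= cauchy_weight x.1 * cauchy_weight x.2.
    by rewrite mulr_ge0// ltW// cauchy_weight_gt0.
  have h1 : `|x.1| ^+ m1 * `|x.2| ^+ m2 <= jap2 x ^+ (m1 + m2).
    by rewrite exprD ler_pM ?exprn_ge0// lerXn2r ?nnegrE// ?ler_norm1_jap2// ler_norm2_jap2.
  apply: (@le_trans _ _ (cauchy_weight x.1 * cauchy_weight x.2 * (jap2 x ^+ (m1 + m2 + 4) * `|P p * K p x|))).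
    apply: (@le_trans _ _ (jap2 x ^+ (m1 + m2) * (`|P p| * `|K p x|))).
      by rewrite -normrM ler_wpM2r.
    rewrite (exprD _ (m1 + m2)%N) (normrM (P p)) [leRHS](_ : _ =
      (cauchy_weight x.1 * cauchy_weight x.2 * jap2 x ^+ 4) *
      (jap2 x ^+ (m1 + m2) * (`|P p| * `|K p x|))); last by ring.
    by rewrite ler_peMl ?mulr_ge0 ?exprn_ge0// cauchy_weight2_jap2.
  by rewrite [C * A * _]mulrA [leRHS]mulrC ler_wpM2l// HF.
have iF : (sprod lebesgue4 lebesgue2).-integrable setT (EFin \o F).
  apply: (@le_integrable _ _ _ (sprod lebesgue4 lebesgue2) _ _ _
    (EFin \o (fun z => C * A * (cauchy_weight4 z.1 * (cauchy_weight z.2.1 * cauchy_weight z.2.2))))) => //.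
  - exact/measurable_EFinP.
  - by move=> z _; rewrite /= lee_fin; exact: le_trans (FW z) (ler_norm _).
  - apply: integrable_EFinZl => //.
    apply: (@integrable_tensor _ _ _ _ R lebesgue4 lebesgue2 cauchy_weight4
      (fun x => cauchy_weight x.1 * cauchy_weight x.2)).
      exact: integrable_cauchy_weight4.
    exact: integrable_cauchy_weight2.
transitivity (\int[lebesgue2]_x \int[lebesgue4]_p F (p, x)).
  apply: eq_Rintegral => x _; rewrite /shoperator -RintegralZl//.
  exact: shoperator_integrable.
rewrite (Rintegral_fubini21 iF) -(Rintegral_fubini12 iF).
transitivity (\int[lebesgue4]_(p in setT) (0 : R)); last by rewrite /Rintegral integral0_eq.
apply: eq_Rintegral => p _; rewrite /F /K /=.
have [Sp|Np] := pselect (shdom p); last first.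
  by under eq_Rintegral do rewrite P0// mul0r mulr0; rewrite /Rintegral integral0_eq.
have rs : rapid2 (fun x => q (shear_coord p x)) by have [mq Hq] := rq; exact: rapid2_shear.
rewrite -(mulr0 (P p * c p)) -(null_moments_shear Sp rq nq m1 m2) -RintegralZl2; last first.
  exact: rapid2_monomial.
by apply: eq_Rintegral => x _; ring.
Qed.

End rapid_plane.

(** * The Fourier transform on L^2 tested against indicators of boxes *)

Section hoelder2.
Context d (T : measurableType d) (R : realType) (m : {measure set T -> \bar R}).
Implicit Types (X Y H : T -> R) (f g : T -> R[i]).

Lemma Lnorm2_lty H : m.-integrable setT (EFin \o (fun x => H x ^+ 2)) ->
  ('N[m]_2%:E[EFin \o H] < +oo)%E.
Proof.
move=> /integrableP[_ h]; have := poweR_Lnorm m (EFin \o H) (@lt0r_neq0 R 2 (ltr0n _ _)).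
have N0 := Lnorm_ge0 m 2%:E (EFin \o H).
case E : ('N[m]_2%:E[EFin \o H])%E N0 => [r| |]//= _; first by rewrite ltry.
rewrite pnatr_eq0 /= => E2; move: h.
rewrite (eq_integral (fun x => `|(EFin \o H) x| `^ 2)%E).
  by rewrite -E2.
by move=> x _ /=; rewrite normrX powR_mulrn.
Qed.

(** In the applications [X] is the real or imaginary part of a complex function and [Y] its modulus,
    the quantity measured by [Lpnorm]. *)
Lemma hoelder2_bound X Y H : measurable_fun setT X -> measurable_fun setT Y ->
  measurable_fun setT H -> (forall x, `|X x| <= Y x) ->
  ('N[m]_2%:E[EFin \o Y] < +oo)%E -> ('N[m]_2%:E[EFin \o H] < +oo)%E ->
  m.-integrable setT (EFin \o (fun x => X x * H x)) /\
  `|\int[m]_x (X x * H x)| <= fine ('N[m]_2%:E[EFin \o Y])%E * fine ('N[m]_2%:E[EFin \o H])%E.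
Proof.
move=> mX mY mH XY NY NH.
have hY := @hoelder _ _ _ m Y H 2 2 mY mH (ltr0n _ _) (ltr0n _ _).
have {}hY : ('N[m]_1[EFin \o (fun x => Y x * H x)%R] <=
    'N[m]_2%:E[EFin \o Y] * 'N[m]_2%:E[EFin \o H])%E.
  by apply: hY; rewrite [RHS]splitr !div1r.
have fY : ('N[m]_2%:E[EFin \o Y] \is a fin_num)%E by rewrite ge0_fin_numE ?Lnorm_ge0.
have fH : ('N[m]_2%:E[EFin \o H] \is a fin_num)%E by rewrite ge0_fin_numE ?Lnorm_ge0.
rewrite Lnorm1 in hY.
have iYH : m.-integrable setT (EFin \o (fun x => Y x * H x)).
  apply/integrableP; split; first by apply/measurable_EFinP; exact: measurable_funM.
  by apply: le_lt_trans hY _; rewrite -(fineK fY) -(fineK fH) -EFinM ltry.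
have le x : `|X x * H x| <= `|Y x * H x|.
  by rewrite !normrM ler_wpM2r// (le_trans (XY x))// ler_norm.
have iXH : m.-integrable setT (EFin \o (fun x => X x * H x)).
  apply: (le_integrable _ _ _ iYH) => //.
    by apply/measurable_EFinP; exact: measurable_funM.
  by move=> x _; rewrite /= lee_fin.
split => //.
apply: le_trans (le_normr_Rintegral measurableT iXH) _.
rewrite -lee_fin EFinM (fineK fY) (fineK fH); apply: le_trans hY.
rewrite /Rintegral fineK; last first.
  by apply: integrable_fin_num => //; exact: (integrable_abse iXH).
apply: ge0_le_integral => //.
- by apply/measurable_EFinP; apply: measurableT_comp => //; exact: measurable_funM.
- by apply: measurableT_comp => //; apply/measurable_EFinP; exact: measurable_funM.
- by move=> x _; rewrite /= lee_fin.
Qed.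

Lemma measurable_cmod f : measurable_fun setT (fun x => complex.Re (f x)) ->
  measurable_fun setT (fun x => complex.Im (f x)) ->
  measurable_fun setT (fun x => cmod (f x)).
Proof.
move=> mR mI.
rewrite (_ : (fun x => _) = (fun x => Num.sqrt (complex.Re (f x) ^+ 2 + complex.Im (f x) ^+ 2))).
  apply: (@measurableT_comp _ _ _ _ _ _ (@Num.sqrt R)).
    by apply: continuous_measurable_fun; exact: sqrt_continuous.
  by apply: measurable_funD; exact: measurable_funX.
by apply/funext => x; case: (f x).
Qed.

Lemma inL1_integrable f : inLp m 1%:E f ->
  m.-integrable setT (EFin \o (fun x => complex.Re (f x))) /\
  m.-integrable setT (EFin \o (fun x => complex.Im (f x))).
Proof.
move=> [mR mI]; rewrite /Lpnorm Lnorm1 => N1.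
have ic : m.-integrable setT (EFin \o (fun x => cmod (f x))).
  apply/integrableP; split => //; apply/measurable_EFinP; exact: measurable_cmod.
by split; apply: (le_integrable _ _ _ ic) => //; (try exact/measurable_EFinP);
  move=> x _; rewrite /= lee_fin (le_trans _ (ler_norm _))// ?normr_Re_le ?normr_Im_le.
Qed.

End hoelder2.

Lemma cvge0_lt (R : realType) (u : nat -> \bar R) (e : R) : 0 < e ->
  u @ \oo --> 0%E -> \forall n \near \oo, (u n < e%:E)%E.
Proof.
move=> e0 u0; have := u0 [set y | (y < e%:E)%E]; apply.
by apply: open_nbhs_nbhs; split; [exact: open_ereal_lt_ereal|rewrite /= lte_fin].
Qed.

Lemma ler_dist_sub (R : realDomainType) (A b c b' c' x y z : R) :
  `|b - c - A| <= x -> `|b - b'| <= y -> `|c - c'| <= z ->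
  `|A - (b' - c')| <= x + (y + z).
Proof.
move=> h1 h2 h3; rewrite distrC.
have -> : b' - c' - A = (b - c - A) - ((b - b') - (c - c')) by ring.
apply: le_trans (ler_normB _ _) _; rewrite lerD//.
by apply: le_trans (ler_normB _ _) _; rewrite lerD.
Qed.

Lemma ler_dist_add (R : realDomainType) (A b c b' c' x y z : R) :
  `|b + c - A| <= x -> `|b - b'| <= z -> `|c - c'| <= y ->
  `|A - (b' + c')| <= x + (y + z).
Proof.
move=> h1 h2 h3; rewrite distrC.
have -> : b' + c' - A = (b + c - A) - ((c - c') + (b - b')) by ring.
apply: le_trans (ler_normB _ _) _; rewrite lerD//.
by apply: le_trans (ler_normD _ _) _; rewrite lerD.
Qed.

Section fourier_pairing.
Context d (T : measurableType d) (R : realType) (m : {sigma_finite_measure set T -> \bar R}).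
Implicit Types (f g u : T -> R[i]) (q : T -> R).
Variable c s : T * T -> R.
Hypothesis mc : measurable_fun setT c.
Hypothesis ms : measurable_fun setT s.
Hypothesis c1 : forall z, `|c z| <= 1.
Hypothesis s1 : forall z, `|s z| <= 1.

(** With [c] and [s] the cosine and sine of [phase1] or [phase2], this is convertible to [fourier1]
    or [fourier2], so both dimensions share the proofs below. *)
Definition phase_transform u (xi : T) : R[i] :=
  cintegral m setT (fun x => u x * (c (xi, x) +i* s (xi, x))%C).

Variable h : T -> R.
Hypothesis ih : m.-integrable setT (EFin \o h).
Hypothesis h2 : ('N[m]_2%:E[EFin \o h] < +oo)%E.

(** Together with [sin_transform], the parts of the transform of the real test function [h]; the
    integration is in the frequency, the first argument of the phase. *)
Definition cos_transform (x : T) := \int[m]_xi (h xi * c (xi, x)).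
Definition sin_transform (x : T) := \int[m]_xi (h xi * s (xi, x)).

Let mh : measurable_fun setT h.
Proof. by apply/measurable_EFinP; exact: (measurable_int m). Qed.

Let mfst (k : T -> R) : measurable_fun setT k -> measurable_fun setT (fun z : T * T => k z.1).
Proof. by move=> mk; apply: (measurableT_comp mk); exact: measurable_fst. Qed.

Let msnd (k : T -> R) : measurable_fun setT k -> measurable_fun setT (fun z : T * T => k z.2).
Proof. by move=> mk; apply: (measurableT_comp mk); exact: measurable_snd. Qed.

Let swap : T * T -> T * T := fun z => (z.2, z.1).
Let mswap : measurable_fun setT swap.
Proof. by apply: measurable_fun_pair; [exact: measurable_snd|exact: measurable_fst]. Qed.

Lemma measurable_cos_transform : measurable_fun setT cos_transform.
Proof.
apply: (@measurable_param_Rintegral _ _ _ _ R m (fun z => h z.2 * c (swap z))).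
by apply: measurable_funM; [exact: msnd|exact: measurableT_comp mc mswap].
Qed.

Lemma measurable_sin_transform : measurable_fun setT sin_transform.
Proof.
apply: (@measurable_param_Rintegral _ _ _ _ R m (fun z => h z.2 * s (swap z))).
by apply: measurable_funM; [exact: msnd|exact: measurableT_comp ms mswap].
Qed.

Lemma measurable_Re_phase_transform u : measurable_fun setT (fun x => complex.Re (u x)) ->
  measurable_fun setT (fun x => complex.Im (u x)) ->
  measurable_fun setT (fun xi => complex.Re (phase_transform u xi)).
Proof.
move=> mR mI; rewrite (_ : (fun xi => _) = (fun xi => \int[m]_x
  (complex.Re (u x) * c (xi, x) - complex.Im (u x) * s (xi, x)))).
  apply: (@measurable_param_Rintegral _ _ _ _ R m (fun z =>
    complex.Re (u z.2) * c (z.1, z.2) - complex.Im (u z.2) * s (z.1, z.2))).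
  under eq_fun do rewrite -!surjective_pairing.
  apply: measurable_funB; apply: measurable_funM => //.
    exact: (msnd mR).
  exact: (msnd mI).
by apply/funext => xi; apply: eq_Rintegral => x _; case: (u x).
Qed.

Lemma measurable_Im_phase_transform u : measurable_fun setT (fun x => complex.Re (u x)) ->
  measurable_fun setT (fun x => complex.Im (u x)) ->
  measurable_fun setT (fun xi => complex.Im (phase_transform u xi)).
Proof.
move=> mR mI; rewrite (_ : (fun xi => _) = (fun xi => \int[m]_x
  (complex.Re (u x) * s (xi, x) + complex.Im (u x) * c (xi, x)))).
  apply: (@measurable_param_Rintegral _ _ _ _ R m (fun z =>
    complex.Re (u z.2) * s (z.1, z.2) + complex.Im (u z.2) * c (z.1, z.2))).
  under eq_fun do rewrite -!surjective_pairing.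
  apply: measurable_funD; apply: measurable_funM => //.
    exact: (msnd mR).
  exact: (msnd mI).
by apply/funext => xi; apply: eq_Rintegral => x _; case: (u x).
Qed.

Let integrable_phase (k : T * T -> R) q (x : T) : measurable_fun setT k ->
  (forall z, `|k z| <= 1) -> m.-integrable setT (EFin \o q) ->
  m.-integrable setT (EFin \o (fun y => q y * k (x, y))).
Proof.
move=> mk k1 iq; apply: (le_integrable _ _ _ iq) => //.
  apply/measurable_EFinP; apply: measurable_funM.
    by apply/measurable_EFinP; exact: (measurable_int m).
  by apply: (measurableT_comp mk); exact: measurable_fun_pair.
by move=> y _; rewrite /= lee_fin normrM ler_piMr.
Qed.

Let integrable_phase2 (k : T * T -> R) q : measurable_fun setT k ->
  (forall z, `|k z| <= 1) -> m.-integrable setT (EFin \o q) ->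
  (sprod m m).-integrable setT (EFin \o (fun z => h z.1 * (q z.2 * k z))).
Proof.
move=> mk k1 iq; apply: (le_integrable _ _ _ (integrable_tensor ih iq)) => //.
  apply/measurable_EFinP; apply: measurable_funM; first exact: mfst.
  by apply: measurable_funM => //; apply: msnd; apply/measurable_EFinP; exact: (measurable_int m).
by move=> y _; rewrite /= lee_fin !normrM ler_wpM2l// ler_piMr.
Qed.

Let swap_phase (k : T * T -> R) q : measurable_fun setT k ->
  (forall z, `|k z| <= 1) -> m.-integrable setT (EFin \o q) ->
  m.-integrable setT (EFin \o (fun xi => h xi * \int[m]_x (q x * k (xi, x)))) /\
  m.-integrable setT (EFin \o (fun x => q x * \int[m]_xi (h xi * k (xi, x)))) /\
  \int[m]_xi (h xi * \int[m]_x (q x * k (xi, x))) =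
  \int[m]_x (q x * \int[m]_xi (h xi * k (xi, x))).
Proof.
move=> mk k1 iq; have i2 := integrable_phase2 mk k1 iq.
have mq : measurable_fun setT q by apply/measurable_EFinP; exact: (measurable_int m).
have mk' : measurable_fun setT (fun z => k (swap z)) by exact: measurableT_comp mk mswap.
have ihk x : m.-integrable setT (EFin \o (fun xi => h xi * k (xi, x))).
  exact: (integrable_phase x mk' (fun z => k1 _) ih).
(* The inner integral is bounded by that of the majorant [w], independently of [x], so multiplying
   an integrable [a] by it preserves integrability. *)
have B (a : T -> R) (b : T -> T -> R) : measurable_fun setT (fun x => \int[m]_y b x y) ->
    (forall x, m.-integrable setT (EFin \o b x)) ->
    m.-integrable setT (EFin \o a) -> (exists w, m.-integrable setT (EFin \o w) /\
      forall x y, `|b x y| <= `|w y|) ->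
    m.-integrable setT (EFin \o (fun x => a x * \int[m]_y b x y)).
  move=> mb ib ia [w [iw bw]].
  pose W := \int[m]_y `|w y|.
  have iw' : m.-integrable setT (EFin \o (fun y => `|w y|)) by exact: (integrable_abse iw).
  apply: (le_integrable _ _ _ (integrable_EFinZl W measurableT ia)) => //.
    apply/measurable_EFinP; apply: measurable_funM => //.
    by apply/measurable_EFinP; exact: (measurable_int m).
  move=> x _; rewrite /= lee_fin !normrM mulrC ler_wpM2r//.
  apply: le_trans (le_normr_Rintegral measurableT (ib x)) _.
  apply: le_trans (ler_norm _); apply: le_Rintegral => //.
    exact: (integrable_abse (ib x)).
split.
  apply: B => //.
  - apply: (@measurable_param_Rintegral _ _ _ _ R m (fun z => q z.2 * k (z.1, z.2))).
    under eq_fun do rewrite -surjective_pairing.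
    by apply: measurable_funM => //; exact: msnd.
  - by move=> xi; exact: integrable_phase.
  - by exists q; split => // x y; rewrite normrM ler_piMr.
split.
  apply: B => //.
  - apply: (@measurable_param_Rintegral _ _ _ _ R m (fun z => h z.2 * k (swap z))).
    by apply: measurable_funM => //; exact: msnd.
  - by exists h; split => // x y; rewrite normrM ler_piMr.
transitivity (\int[m]_xi \int[m]_x (h xi * (q x * k (xi, x)))).
  by apply: eq_Rintegral => xi _; rewrite RintegralZl//; exact: integrable_phase.
rewrite (Rintegral_fubini12 i2) -(Rintegral_fubini21 i2).
apply: eq_Rintegral => x _; rewrite -RintegralZl//.
by apply: eq_Rintegral => xi _ /=; rewrite mulrCA.
Qed.

(** The multiplication formula: the transform moves from [u] to [h] by Fubini, the phase being
    bounded and both functions integrable. *)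
Lemma phase_transform_pairing u :
  m.-integrable setT (EFin \o (fun x => complex.Re (u x))) ->
  m.-integrable setT (EFin \o (fun x => complex.Im (u x))) ->
  (m.-integrable setT (EFin \o (fun xi => h xi * complex.Re (phase_transform u xi))) /\
   m.-integrable setT (EFin \o (fun xi => h xi * complex.Im (phase_transform u xi)))) /\
  (\int[m]_xi (h xi * complex.Re (phase_transform u xi)) =
   \int[m]_x (complex.Re (u x) * cos_transform x) -
   \int[m]_x (complex.Im (u x) * sin_transform x)) /\
  (\int[m]_xi (h xi * complex.Im (phase_transform u xi)) =
   \int[m]_x (complex.Re (u x) * sin_transform x) +
   \int[m]_x (complex.Im (u x) * cos_transform x)).
Proof.
move=> iR iI.
have [a1 [a2 a3]] := swap_phase mc c1 iR.
have [b1 [b2 b3]] := swap_phase ms s1 iR.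
have [e1 [e2 e3]] := swap_phase mc c1 iI.
have [f1 [f2 f3]] := swap_phase ms s1 iI.
have ER xi : complex.Re (phase_transform u xi) =
    \int[m]_x (complex.Re (u x) * c (xi, x)) - \int[m]_x (complex.Im (u x) * s (xi, x)).
  have i1 := integrable_phase xi mc c1 iR; have i2 := integrable_phase xi ms s1 iI.
  rewrite -(RintegralB measurableT i1 i2).
  by apply: eq_Rintegral => x _; case: (u x).
have EI xi : complex.Im (phase_transform u xi) =
    \int[m]_x (complex.Re (u x) * s (xi, x)) + \int[m]_x (complex.Im (u x) * c (xi, x)).
  have i1 := integrable_phase xi ms s1 iR; have i2 := integrable_phase xi mc c1 iI.
  rewrite -(RintegralD measurableT i1 i2).
  by apply: eq_Rintegral => x _; case: (u x).
have IR : m.-integrable setT (EFin \o (fun xi =>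
    h xi * \int[m]_x (complex.Re (u x) * c (xi, x)) -
    h xi * \int[m]_x (complex.Im (u x) * s (xi, x)))).
  exact: (integrableB measurableT a1 f1).
have II : m.-integrable setT (EFin \o (fun xi =>
    h xi * \int[m]_x (complex.Re (u x) * s (xi, x)) +
    h xi * \int[m]_x (complex.Im (u x) * c (xi, x)))).
  exact: (integrableD measurableT b1 e1).
split; first split.
- rewrite (_ : _ \o _ = EFin \o (fun xi =>
    h xi * \int[m]_x (complex.Re (u x) * c (xi, x)) -
    h xi * \int[m]_x (complex.Im (u x) * s (xi, x))))//.
  by apply/funext => xi; rewrite [LHS]/comp ER mulrBr.
- rewrite (_ : _ \o _ = EFin \o (fun xi =>
    h xi * \int[m]_x (complex.Re (u x) * s (xi, x)) +
    h xi * \int[m]_x (complex.Im (u x) * c (xi, x))))//.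
  by apply/funext => xi; rewrite [LHS]/comp EI mulrDr.
split.
- under eq_Rintegral do rewrite ER mulrBr.
  by rewrite (RintegralB measurableT a1 f1) a3 f3.
- under eq_Rintegral do rewrite EI mulrDr.
  by rewrite (RintegralD measurableT b1 e1) b3 e3.
Qed.

Hypothesis cos2 : ('N[m]_2%:E[EFin \o cos_transform] < +oo)%E.
Hypothesis sin2 : ('N[m]_2%:E[EFin \o sin_transform] < +oo)%E.

(** The multiplication formula holds for each term of the approximating sequence. By Hoelder's
    inequality both sides pass to the limit, since [h] and its two transforms are square integrable.
    The limit depends on [f] up to null sets only, so reading the formula backwards for the
    integrable version [psi] produces its Fourier integral. *)
Lemma L2_extension_pairing f g psi : L2_extension m phase_transform f g ->
  m.-integrable setT (EFin \o (fun x => complex.Re (psi x))) ->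
  m.-integrable setT (EFin \o (fun x => complex.Im (psi x))) ->
  {ae m, forall x, psi x = f x} ->
  (m.-integrable setT (EFin \o (fun xi => h xi * complex.Re (g xi))) /\
   m.-integrable setT (EFin \o (fun xi => h xi * complex.Im (g xi)))) /\
  \int[m]_xi (h xi * complex.Re (g xi)) =
  \int[m]_xi (h xi * complex.Re (phase_transform psi xi)) /\
  \int[m]_xi (h xi * complex.Im (g xi)) =
  \int[m]_xi (h xi * complex.Im (phase_transform psi xi)).
Proof.
move=> [[fR fI f2] [gR gI g2] [u [u12 uf ug]]] iR iI psif.
have mC := measurable_cos_transform; have mS := measurable_sin_transform.
have HB (k : T -> R[i]) (X H : T -> R) : measurable_fun setT (fun x => complex.Re (k x)) ->
    measurable_fun setT (fun x => complex.Im (k x)) -> measurable_fun setT X ->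
    measurable_fun setT H -> (forall x, `|X x| <= cmod (k x)) ->
    (Lpnorm m 2%:E k < +oo)%E -> ('N[m]_2%:E[EFin \o H] < +oo)%E ->
    m.-integrable setT (EFin \o (fun x => H x * X x)) /\
    `|\int[m]_x (H x * X x)| <= fine (Lpnorm m 2%:E k) * fine ('N[m]_2%:E[EFin \o H])%E.
  move=> kR kI mX mH Xk k2 H2.
  have := @hoelder2_bound _ _ _ m X (fun x => cmod (k x)) H mX (measurable_cmod kR kI) mH Xk k2 H2.
  rewrite /Lpnorm; have -> : (fun x => X x * H x) = (fun x => H x * X x) by apply/funext => x; rewrite mulrC.
  by [].
have igR := (HB g _ h gR gI gR mh (fun x => normr_Re_le _) g2 h2).1.
have igI := (HB g _ h gR gI gI mh (fun x => normr_Im_le _) g2 h2).1.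
have ifRC := (HB f _ _ fR fI fR mC (fun x => normr_Re_le _) f2 cos2).1.
have ifIC := (HB f _ _ fR fI fI mC (fun x => normr_Im_le _) f2 cos2).1.
have ifRS := (HB f _ _ fR fI fR mS (fun x => normr_Re_le _) f2 sin2).1.
have ifIS := (HB f _ _ fR fI fI mS (fun x => normr_Im_le _) f2 sin2).1.
(* Replacing a term of the sequence by its limit costs at most [e] times each of these three
   norms. *)
pose K := fine ('N[m]_2%:E[EFin \o h])%E + (fine ('N[m]_2%:E[EFin \o cos_transform])%E +
  fine ('N[m]_2%:E[EFin \o sin_transform])%E).
have K0 : 0 <= K by rewrite !addr_ge0// fine_ge0// Lnorm_ge0.
have ae_eqI (H : T -> R) (X Y : T -> R) : measurable_fun setT X -> measurable_fun setT Y ->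
    measurable_fun setT H ->
    {ae m, forall x, X x = Y x} -> \int[m]_x (H x * X x) = \int[m]_x (X x * H x) /\
    \int[m]_x (X x * H x) = \int[m]_x (H x * Y x).
  move=> mX mY mH XY; split; first by apply: eq_Rintegral => x _; rewrite mulrC.
  rewrite /Rintegral; congr fine; apply: ae_eq_integral => //.
  - by apply/measurable_EFinP; exact: measurable_funM.
  - by apply/measurable_EFinP; exact: measurable_funM.
  - by apply: filterS XY => x -> _; rewrite mulrC.
have mpR : measurable_fun setT (fun x => complex.Re (psi x)).
  by apply/measurable_EFinP; exact: (measurable_int m).
have mpI : measurable_fun setT (fun x => complex.Im (psi x)).
  by apply/measurable_EFinP; exact: (measurable_int m).
have pR : {ae m, forall x, complex.Re (psi x) = complex.Re (f x)} by apply: filterS psif => x ->.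
have pI : {ae m, forall x, complex.Im (psi x) = complex.Im (f x)} by apply: filterS psif => x ->.
have [_ [PR PI]] := phase_transform_pairing iR iI.
rewrite PR PI (ae_eqI _ _ _ mpR fR mC pR).2 (ae_eqI _ _ _ mpI fI mS pI).2.
rewrite (ae_eqI _ _ _ mpR fR mS pR).2 (ae_eqI _ _ _ mpI fI mC pI).2.
split; first by split.
have lim (A B : R) : (forall e, 0 < e -> `|A - B| <= e * K) -> A = B.
  move=> AB; apply/eqP; rewrite -subr_eq0 -normr_le0; apply/ler_addgt0Pr => e e0.
  rewrite add0r; have K1 : 0 < K + 1 by rewrite ltr_wpDl.
  apply: le_trans (AB (e / (K + 1)) _) _; first exact: divr_gt0.
  by rewrite mulrAC ler_pdivrMr// ler_wpM2l ?(ltW e0)// lerDl.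
have key e : 0 < e -> exists n,
   [/\ (Lpnorm m 2%:E (fun x => u n x - f x)%R < e%:E)%E &
       (Lpnorm m 2%:E (fun x => phase_transform (u n) x - g x)%R < e%:E)%E].
  move=> e0; have [N1 _ H1] := cvge0_lt e0 uf; have [N2 _ H2] := cvge0_lt e0 ug.
  exists (maxn N1 N2); split; [apply: H1|apply: H2] => /=.
    exact: leq_maxl.
  exact: leq_maxr.
have lefine (x : \bar R) (e : R) : (0 <= x)%E -> (x < e%:E)%E -> (x < +oo)%E /\ fine x <= e.
  by case: x => //= r _; rewrite lte_fin ltry => /ltW.
have ReB (a b : R[i]) : complex.Re (a - b) = complex.Re a - complex.Re b by case: a b => [? ?] [].
have ImB (a b : R[i]) : complex.Im (a - b) = complex.Im a - complex.Im b by case: a b => [? ?] [].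
have step n e : 0 < e -> (Lpnorm m 2%:E (fun x => u n x - f x)%R < e%:E)%E ->
    (Lpnorm m 2%:E (fun x => phase_transform (u n) x - g x)%R < e%:E)%E ->
    `|\int[m]_xi (h xi * complex.Re (g xi)) -
      (\int[m]_x (cos_transform x * complex.Re (f x)) -
       \int[m]_x (sin_transform x * complex.Im (f x)))| <= e * K /\
    `|\int[m]_xi (h xi * complex.Im (g xi)) -
      (\int[m]_x (sin_transform x * complex.Re (f x)) +
       \int[m]_x (cos_transform x * complex.Im (f x)))| <= e * K.
  move=> e0 n1 n2.
  have [u1 [uR uI u2]] := u12 n.
  have [iuR iuI] := inL1_integrable u1.
  have [[jR jI] [EqR EqI]] := phase_transform_pairing iuR iuI.
  have mFR := measurable_Re_phase_transform uR uI.
  have mFI := measurable_Im_phase_transform uR uI.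
  have [n1y n1e] := lefine _ _ (Lnorm_ge0 _ _ _) n1.
  have [n2y n2e] := lefine _ _ (Lnorm_ge0 _ _ _) n2.
  have mufR : measurable_fun setT (fun x => complex.Re (u n x - f x)).
    by under eq_fun do rewrite ReB; exact: measurable_funB.
  have mufI : measurable_fun setT (fun x => complex.Im (u n x - f x)).
    by under eq_fun do rewrite ImB; exact: measurable_funB.
  have mFgR : measurable_fun setT (fun x => complex.Re (phase_transform (u n) x - g x)).
    by under eq_fun do rewrite ReB; exact: measurable_funB.
  have mFgI : measurable_fun setT (fun x => complex.Im (phase_transform (u n) x - g x)).
    by under eq_fun do rewrite ImB; exact: measurable_funB.
  have iuC := (HB (u n) _ _ uR uI uR mC (fun x => normr_Re_le _) u2 cos2).1.
  have iuIC := (HB (u n) _ _ uR uI uI mC (fun x => normr_Im_le _) u2 cos2).1.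
  have iuS := (HB (u n) _ _ uR uI uR mS (fun x => normr_Re_le _) u2 sin2).1.
  have iuIS := (HB (u n) _ _ uR uI uI mS (fun x => normr_Im_le _) u2 sin2).1.
  have dif (H X Y : T -> R) (P : R) : m.-integrable setT (EFin \o (fun x => H x * X x)) ->
     m.-integrable setT (EFin \o (fun x => H x * Y x)) ->
     `|\int[m]_x (H x * (X x - Y x))| <= P ->
     `|\int[m]_x (H x * X x) - \int[m]_x (H x * Y x)| <= P.
    by move=> i1 i2; under eq_Rintegral do rewrite mulrBr; rewrite RintegralB.
  have HBe (k : T -> R[i]) (X H : T -> R) : measurable_fun setT (fun x => complex.Re (k x)) ->
    measurable_fun setT (fun x => complex.Im (k x)) -> measurable_fun setT X ->
    measurable_fun setT H -> (forall x, `|X x| <= cmod (k x)) ->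
    (Lpnorm m 2%:E k < +oo)%E -> fine (Lpnorm m 2%:E k) <= e -> ('N[m]_2%:E[EFin \o H] < +oo)%E ->
    `|\int[m]_x (H x * X x)| <= e * fine ('N[m]_2%:E[EFin \o H])%E.
    move=> k1 k2 k3 k4 k5 k6 k7 k8; apply: le_trans (HB _ _ _ k1 k2 k3 k4 k5 k6 k8).2 _.
    by rewrite ler_wpM2r// fine_ge0// Lnorm_ge0.
  have d1 := dif _ _ _ _ jR igR (HBe (fun x => phase_transform (u n) x - g x) _ _ mFgR mFgI
    (measurable_funB mFR gR) mh (fun x => _) n2y n2e h2).
  have d2 := dif _ _ _ _ jI igI (HBe (fun x => phase_transform (u n) x - g x) _ _ mFgR mFgI
    (measurable_funB mFI gI) mh (fun x => _) n2y n2e h2).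
  have d3 := dif _ _ _ _ iuC ifRC (HBe (fun x => u n x - f x) _ _ mufR mufI
    (measurable_funB uR fR) mC (fun x => _) n1y n1e cos2).
  have d4 := dif _ _ _ _ iuIC ifIC (HBe (fun x => u n x - f x) _ _ mufR mufI
    (measurable_funB uI fI) mC (fun x => _) n1y n1e cos2).
  have d5 := dif _ _ _ _ iuS ifRS (HBe (fun x => u n x - f x) _ _ mufR mufI
    (measurable_funB uR fR) mS (fun x => _) n1y n1e sin2).
  have d6 := dif _ _ _ _ iuIS ifIS (HBe (fun x => u n x - f x) _ _ mufR mufI
    (measurable_funB uI fI) mS (fun x => _) n1y n1e sin2).
  have comm (X Y : T -> R) : \int[m]_x (X x * Y x) = \int[m]_x (Y x * X x).
    by apply: eq_Rintegral => x _; rewrite mulrC.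
  have {}d1 := d1 (fun x => eq_ind _ (fun z => `|z| <= _) (normr_Re_le (phase_transform (u n) x - g x)) _ (ReB _ _)).
  have {}d2 := d2 (fun x => eq_ind _ (fun z => `|z| <= _) (normr_Im_le (phase_transform (u n) x - g x)) _ (ImB _ _)).
  have {}d3 := d3 (fun x => eq_ind _ (fun z => `|z| <= _) (normr_Re_le (u n x - f x)) _ (ReB _ _)).
  have {}d4 := d4 (fun x => eq_ind _ (fun z => `|z| <= _) (normr_Im_le (u n x - f x)) _ (ImB _ _)).
  have {}d5 := d5 (fun x => eq_ind _ (fun z => `|z| <= _) (normr_Re_le (u n x - f x)) _ (ReB _ _)).
  have {}d6 := d6 (fun x => eq_ind _ (fun z => `|z| <= _) (normr_Im_le (u n x - f x)) _ (ImB _ _)).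
  rewrite EqR ![\int[m]_x (complex.Re (u n x) * _)]comm ![\int[m]_x (complex.Im (u n x) * _)]comm in d1.
  rewrite EqI ![\int[m]_x (complex.Re (u n x) * _)]comm ![\int[m]_x (complex.Im (u n x) * _)]comm in d2.
  rewrite /K !mulrDr.
  by split; [exact: ler_dist_sub d1 d3 d6|exact: ler_dist_add d2 d5 d4].
split; apply: lim => e e0; have [n [n1 n2]] := key e e0.
  exact: (step n e e0 n1 n2).1.
exact: (step n e e0 n1 n2).2.
Qed.

End fourier_pairing.

(** * Moments and the order of vanishing of an oscillatory integral *)

Section trig_taylor.
Context {R : realType}.

(* The pair of the [k]-th Taylor coefficients at 0 of [cos] and [sin] *)
Fixpoint trig_coef (k : nat) : R * R :=
  if k is j.+1 then (- (trig_coef j).2 / j.+1%:R, (trig_coef j).1 / j.+1%:R)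
  else (1, 0).

(** The vanishing of a complex Taylor coefficient is a linear system in two real moments, whose
    determinant is this sum of squares. *)
Lemma trig_coef_neq0 k : (trig_coef k).1 ^+ 2 + (trig_coef k).2 ^+ 2 != 0.
Proof.
elim: k => [|k IH] /=; first by rewrite expr1n expr0n addr0 oner_eq0.
rewrite !mulNr sqrrN !exprMn -mulrDl mulf_neq0 ?expf_neq0 ?invr_eq0 ?pnatr_eq0//.
by rewrite addrC.
Qed.

Lemma is_derive_sum_power (a : nat -> R) (N : nat) (u : R) :
  is_derive u (1 : R) (fun v : R => \sum_(k < N.+1) a k * v ^+ k : R^o)
    (\sum_(k < N) k.+1%:R * a k.+1 * u ^+ k).
Proof.
elim: N => [|N IH].
  rewrite big_ord0; under eq_fun do rewrite big_ord1 expr0.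
  exact: is_derive_cst.
rewrite big_ord_recr /=; under eq_fun do rewrite big_ord_recr /=.
apply: is_deriveD.
have H : is_derive u (1 : R) (fun v : R => v ^+ N.+1 : R^o) (N.+1%:R * u ^+ N).
  have := @is_deriveX R R^o id N.+1 u 1 1 (is_derive_id u 1).
  rewrite /GRing.scale /= mulr1.
  by rewrite (_ : id ^+ N.+1 = (fun v : R => v ^+ N.+1 : R^o))// exprfctE.
have := is_deriveZ (a N.+1) H; rewrite /GRing.scale /= mulrA [a _ * _]mulrC.
exact.
Qed.

(** The derivative of each remainder of order [N.+1] is, up to sign, the remainder of order [N] of
    the other function, so one mean value gives the induction step. *)
Lemma trig_taylor (N : nat) (u : R) :
  `|cos u - \sum_(k < N) (trig_coef k).1 * u ^+ k| <= `|u| ^+ N /\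
  `|sin u - \sum_(k < N) (trig_coef k).2 * u ^+ k| <= `|u| ^+ N.
Proof.
elim: N u => [|N IH] u; first by rewrite !big_ord0 !subr0 expr0 cos_max sin_max.
have dc (t : R) : is_derive t (1 : R)
    (fun v : R => cos v - \sum_(k < N.+1) (trig_coef k).1 * v ^+ k : R^o)
    (- (sin t - \sum_(k < N) (trig_coef k).2 * t ^+ k)).
  have := is_deriveB (is_derive_cos t) (is_derive_sum_power (fun k => (trig_coef k).1) N t).
  suff -> : \sum_(k < N) k.+1%:R * (trig_coef k.+1).1 * t ^+ k =
      - \sum_(k < N) (trig_coef k).2 * t ^+ k by rewrite opprK [- (sin t - _)]opprB [_ - sin t]addrC.
  rewrite -sumrN; apply: eq_bigr => k _ /=.
  by rewrite mulrCA mulfV ?pnatr_eq0// mulr1 mulNr.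
have ds (t : R) : is_derive t (1 : R)
    (fun v : R => sin v - \sum_(k < N.+1) (trig_coef k).2 * v ^+ k : R^o)
    (cos t - \sum_(k < N) (trig_coef k).1 * t ^+ k).
  have := is_deriveB (is_derive_sin t) (is_derive_sum_power (fun k => (trig_coef k).2) N t).
  suff -> : \sum_(k < N) k.+1%:R * (trig_coef k.+1).2 * t ^+ k =
      \sum_(k < N) (trig_coef k).1 * t ^+ k by [].
  apply: eq_bigr => k _ /=.
  by rewrite mulrCA mulfV ?pnatr_eq0// mulr1.
have z0 (a : nat -> R) : \sum_(k < N.+1) a k * 0 ^+ k = a 0%N.
  rewrite big_ord_recl /= expr0 mulr1 big1 ?addr0// => k _.
  by rewrite expr0n /= mulr0.
have le (c : R) : `|c - 0| <= `|u - 0| -> `|c| ^+ N * `|u| <= `|u| ^+ N.+1.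
  by rewrite !subr0 exprSr => cu; rewrite ler_wpM2r// lerXn2r ?nnegrE.
split.
- have [c [cu]] := MVT_between 0 u dc.
  rewrite (z0 (fun k => (trig_coef k).1)) cos0 /= subrr !subr0 => ->; rewrite normrM normrN.
  by apply: le_trans (le _ cu); rewrite ler_wpM2r//; case: (IH c).
- have [c [cu]] := MVT_between 0 u ds.
  rewrite (z0 (fun k => (trig_coef k).2)) sin0 /= subrr !subr0 => ->; rewrite normrM.
  by apply: le_trans (le _ cu); rewrite ler_wpM2r//; case: (IH c).
Qed.

(** Letting [t] tend to 0 gives [a 0 = 0]; dividing by [t] then lowers the order for the shifted
    coefficients. *)
Lemma sum_power_eq0 (N : nat) (a : nat -> R) (C : R) :
  (forall t : R, 0 < t <= 1 -> `|\sum_(k < N) a k * t ^+ k| <= C * t ^+ N) ->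
  forall k, (k < N)%N -> a k = 0.
Proof.
elim: N a => [//|N IH] a H.
have E t : \sum_(k < N.+1) a k * t ^+ k = a 0%N + t * \sum_(k < N) a k.+1 * t ^+ k.
  rewrite big_ord_recl expr0 mulr1 mulr_sumr; congr (_ + _).
  by apply: eq_bigr => k _; rewrite /= exprS mulrCA.
have a0 : a 0%N = 0.
  pose M := `|C| + \sum_(k < N) `|a k.+1|.
  have M0 : 0 <= M by rewrite addr_ge0// sumr_ge0.
  have bd (t : R) : 0 < t <= 1 -> `|a 0%N| <= t * M.
    move=> /andP[t0 t1]; have := H t; rewrite t0 t1 E => /(_ isT) Ht.
    rewrite -[a 0%N](addrK (t * \sum_(k < N) a k.+1 * t ^+ k)).
    apply: le_trans (ler_normB _ _) _; rewrite /M mulrDr lerD//.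
      apply: le_trans Ht _; rewrite exprS mulrCA ler_wpM2l ?(ltW t0)//.
      apply: (@le_trans _ _ (`|C| * t ^+ N)).
        by rewrite ler_wpM2r ?exprn_ge0 ?(ltW t0)// ler_norm.
      by rewrite ler_piMr// exprn_ile1 ?(ltW t0).
    rewrite normrM (gtr0_norm t0) ler_wpM2l ?(ltW t0)//.
    apply: le_trans (ler_norm_sum _ _ _) _; apply: ler_sum => k _.
    by rewrite normrM ler_piMr// normrX (gtr0_norm t0) exprn_ile1 ?(ltW t0).
  apply/eqP; rewrite -normr_le0; apply/ler_addgt0Pr => e e0; rewrite add0r.
  pose t := Num.min 1 (e / (M + 1)).
  have M1 : 0 < M + 1 by rewrite ltr_wpDl.
  have t0 : 0 < t by rewrite /t lt_min ltr01 divr_gt0.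
  have t1 : t <= 1 by rewrite /t ge_min lexx.
  have te : t <= e / (M + 1) by rewrite /t ge_min lexx orbT.
  have := bd t; rewrite t0 t1 => /(_ isT)/le_trans; apply.
  apply: (@le_trans _ _ (e / (M + 1) * M)); first by rewrite ler_wpM2r.
  by rewrite mulrAC ler_pdivrMr// ler_wpM2l ?(ltW e0)// lerDl.
case=> [//|k]; rewrite ltnS => kN.
apply: (IH (fun k => a k.+1)) => // t /andP[t0 t1].
have := H t; rewrite t0 t1 E a0 add0r normrM (gtr0_norm t0) exprS mulrCA => /(_ isT).
by rewrite ler_pM2l.
Qed.

End trig_taylor.

Section oscillatory_taylor.
Context d (T : measurableType d) (R : realType) (m : {measure set T -> \bar R}).
Variables q1 q2 l : T -> R.
Hypothesis ml : measurable_fun setT l.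
Hypothesis i1 : forall k, m.-integrable setT (EFin \o (fun x => l x ^+ k * q1 x)).
Hypothesis i2 : forall k, m.-integrable setT (EFin \o (fun x => l x ^+ k * q2 x)).

(** The [k]-th Taylor coefficient at [t = 0] of the integral of [q1 cos(t l) - q2 sin(t l)]. When
    [q1] and [q2] are the parts of a complex function, this integral is the real part of its
    oscillatory integral; the pair [q2], [- q1] gives the imaginary part. *)
Definition moment_coef (k : nat) : R :=
  (trig_coef k).1 * (\int[m]_x (l x ^+ k * q1 x)) -
  (trig_coef k).2 * (\int[m]_x (l x ^+ k * q2 x)).

Let P (f : nat -> R) N (u : R) := \sum_(k < N) f k * u ^+ k.

Let integrable_sum_power (f : nat -> R) (q : T -> R) (t : R) N :
  (forall k, m.-integrable setT (EFin \o (fun x => l x ^+ k * q x))) ->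
  m.-integrable setT (EFin \o (fun x => P f N (t * l x) * q x)) /\
  \int[m]_x (P f N (t * l x) * q x) =
  \sum_(k < N) f k * t ^+ k * (\int[m]_x (l x ^+ k * q x)).
Proof.
move=> iq; elim: N => [|N [IH1 IH2]].
  rewrite /P; split.
    under eq_fun do rewrite big_ord0 mul0r; exact: integrable0.
  rewrite big_ord0; under eq_Rintegral do rewrite big_ord0 mul0r.
  by rewrite /Rintegral integral0_eq.
have iN := integrable_EFinZl (f N * t ^+ N) measurableT (iq N).
have E : (fun x => P f N.+1 (t * l x) * q x) =
    (fun x => P f N (t * l x) * q x + f N * t ^+ N * (l x ^+ N * q x)).
  by apply/funext => x; rewrite /P big_ord_recr /= exprMn; ring.
rewrite E; split; first exact: (integrableD measurableT IH1 iN).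
by rewrite (RintegralD measurableT IH1 iN) IH2 RintegralZl// big_ord_recr.
Qed.

Lemma oscillatory_taylor (N : nat) (t : R) :
  `|\int[m]_x (q1 x * cos (t * l x) - q2 x * sin (t * l x)) -
    \sum_(k < N) moment_coef k * t ^+ k| <=
  `|t| ^+ N * \int[m]_x (`|l x| ^+ N * (`|q1 x| + `|q2 x|)).
Proof.
have [c1 c2] := integrable_sum_power (fun k => (trig_coef k).1) t N i1.
have [s1 s2] := integrable_sum_power (fun k => (trig_coef k).2) t N i2.
have E : \sum_(k < N) moment_coef k * t ^+ k =
    \int[m]_x (P (fun k => (trig_coef k).1) N (t * l x) * q1 x -
               P (fun k => (trig_coef k).2) N (t * l x) * q2 x).
  rewrite (RintegralB measurableT c1 s1) c2 s2 -sumrB; apply: eq_bigr => k _.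
  by rewrite /moment_coef; ring.
have mq (q : T -> R) : (forall k, m.-integrable setT (EFin \o (fun x => l x ^+ k * q x))) ->
    measurable_fun setT q /\ m.-integrable setT (EFin \o q).
  move=> /(_ 0%N) iq; have -> : q = (fun x => l x ^+ 0 * q x).
    by apply/funext => x; rewrite expr0 mul1r.
  by split => //; apply/measurable_EFinP; exact: (measurable_int m).
have [mq1 iq1] := mq _ i1; have [mq2 iq2] := mq _ i2.
have mtl : measurable_fun setT (fun x => t * l x) by exact: measurable_funM.
have trig (q k : _ -> R) : measurable_fun setT q -> m.-integrable setT (EFin \o q) ->
    continuous k -> (forall u, `|k u| <= 1) ->
    m.-integrable setT (EFin \o (fun x => q x * k (t * l x))).
  move=> mq0 iq0 ck k1; apply: (le_integrable _ _ _ iq0) => //.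
    apply/measurable_EFinP; apply: measurable_funM => //.
    apply: (@measurableT_comp _ _ _ _ _ _ k) => //; exact: continuous_measurable_fun.
  by move=> x _; rewrite /= lee_fin normrM ler_piMr.
have ic := trig q1 cos mq1 iq1 (@continuous_cos R) (@cos_max R).
have is_ := trig q2 sin mq2 iq2 (@continuous_sin R) (@sin_max R).
have iA := integrableB measurableT ic is_.
have iB := integrableB measurableT c1 s1.
rewrite E -(RintegralB measurableT iA iB).
have iD := integrableB measurableT iA iB.
apply: le_trans (le_normr_Rintegral measurableT iD) _.
have iN : m.-integrable setT (EFin \o (fun x => `|l x| ^+ N * (`|q1 x| + `|q2 x|))).
  have := integrableD measurableT (integrable_abse (i1 N)) (integrable_abse (i2 N)).
  rewrite (_ : (_ \+ _)%E = EFin \o (fun x => `|l x| ^+ N * (`|q1 x| + `|q2 x|)))//.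
  by apply/funext => x; rewrite /= -EFinD !normrM normrX mulrDr.
rewrite -RintegralZl//; apply: le_Rintegral => //.
- exact: (integrable_abse iD).
- exact: integrable_EFinZl.
move=> x _; have [hc hs] := trig_taylor N (t * l x).
rewrite [X in `|X|](_ : _ = q1 x * (cos (t * l x) - P (fun k => (trig_coef k).1) N (t * l x)) -
  q2 x * (sin (t * l x) - P (fun k => (trig_coef k).2) N (t * l x))); last by ring.
apply: le_trans (ler_normB _ _) _; rewrite (normrM (q1 x)) (normrM (q2 x)) mulrA mulrDr.
by rewrite -exprMn -(normrM t); apply: lerD; rewrite mulrC ler_wpM2r.
Qed.

End oscillatory_taylor.

(** * Square integrability of the transforms of intervals and boxes *)

Section interval_transform.
Context {R : realType}.
Local Notation mR := (measurableTypeR R).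
Local Notation mu := (@lebesgue_measure R).
Implicit Types (a b : R) (A : set R).

Lemma Rintegral_indic_mull (A : set mR) (f : mR -> R) :
  \int[mu]_x (\1_A x * f x) = \int[mu]_(x in A) f x.
Proof.
rewrite [RHS]Rintegral_mkcond; apply: eq_Rintegral => x _.
by rewrite patch_indic /= mulrC.
Qed.

Lemma integrable_indic_mull (A : set mR) (f : mR -> R) : measurable A ->
  mu.-integrable A (EFin \o f) -> mu.-integrable setT (EFin \o (fun x => \1_A x * f x)).
Proof.
move=> mA ifA; have := (integrable_mkcond (EFin \o f) mA).1 ifA.
apply: eq_integrable => // x _.
by rewrite epatch_indic /= -EFinM mulrC.
Qed.

Lemma Rintegral_is_derive (f F : R -> R) a b : a < b ->
  (forall x, is_derive x (1 : R) (F : R -> R^o) (f x)) -> continuous f ->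
  \int[mu]_(x in `[a, b]) f x = F b - F a.
Proof.
move=> ab dF cf; have cF x : {for x, continuous F}.
  by apply: differentiable_continuous; apply/derivable1_diffP; case: (dF x).
rewrite /Rintegral (@continuous_FTC2 _ f F)//.
- exact: continuous_subspaceT.
- split=> [x _| |]; first by case: (dF x).
    exact: cvg_at_right_filter (cF a).
  exact: cvg_at_left_filter (cF b).
- by move=> x _; rewrite derive1E; exact: derive_val.
Qed.

Lemma integrable_indic_itv a b : mu.-integrable setT (EFin \o (\1_`[a, b] : R -> R)).
Proof.
have H : mu.-integrable `[a, b] (EFin \o (fun=> 1 : R)).
  apply: continuous_compact_integrable; first exact: segment_compact.
  by apply: continuous_subspaceT => x; exact: cvg_cst.
have := integrable_indic_mull (measurable_itv _) H.
by apply: eq_integrable => // x _; rewrite /= mulr1.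
Qed.

Definition phase1 (z : R * R) : R := - (2 * pi * (z.1 * z.2)).
Definition phase2 (z : (R * R) * (R * R)) : R :=
  - (2 * pi * (z.1.1 * z.2.1 + z.1.2 * z.2.2)).

Lemma measurable_phase1 : measurable_fun setT (phase1 : mR * mR -> R).
Proof.
apply: measurableT_comp => //; apply: measurable_funM => //.
by apply: measurable_funM; [exact: measurable_fst|exact: measurable_snd].
Qed.

Lemma measurable_phase2 : measurable_fun setT (phase2 : (mR * mR) * (mR * mR) -> R).
Proof.
have m1 : measurable_fun setT (fun z : (mR * mR) * (mR * mR) => z.1) by exact: measurable_fst.
have m2 : measurable_fun setT (fun z : (mR * mR) * (mR * mR) => z.2) by exact: measurable_snd.
apply: measurableT_comp => //; apply: measurable_funM => //.
apply: measurable_funD; apply: measurable_funM.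
- exact: (measurableT_comp measurable_fst m1).
- exact: (measurableT_comp measurable_fst m2).
- exact: (measurableT_comp measurable_snd m1).
- exact: (measurableT_comp measurable_snd m2).
Qed.

Lemma measurable_cosf d (T : measurableType d) (f : T -> R) :
  measurable_fun setT f -> measurable_fun setT (fun x => cos (f x)).
Proof.
apply: (@measurableT_comp _ _ _ _ _ _ (@cos R)).
by apply: continuous_measurable_fun; exact: continuous_cos.
Qed.

Lemma measurable_sinf d (T : measurableType d) (f : T -> R) :
  measurable_fun setT f -> measurable_fun setT (fun x => sin (f x)).
Proof.
apply: (@measurableT_comp _ _ _ _ _ _ (@sin R)).
by apply: continuous_measurable_fun; exact: continuous_sin.
Qed.

Lemma bounded_mull_integrable d (T : measurableType d) (m : {measure set T -> \bar R})
    (h k : T -> R) : m.-integrable setT (EFin \o h) -> measurable_fun setT k ->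
  (forall x, `|k x| <= 1) -> m.-integrable setT (EFin \o (fun x => h x * k x)).
Proof.
move=> ih mk k1; apply: (le_integrable _ _ _ ih) => //.
  apply/measurable_EFinP; apply: measurable_funM => //.
  by apply/measurable_EFinP; exact: (measurable_int m).
by move=> y _; rewrite /= lee_fin normrM ler_piMr.
Qed.

(** The transform [T] is bounded by the integral of the indicator, and [x * T] by means of an
    explicit primitive; adding the two squares produces the factor [1 + x ^+ 2]. *)
Let trig (k K : R -> R) a b : a < b -> continuous k -> (forall t, `|k t| <= 1) ->
  (forall t, `|K t| <= 1) -> (forall t, is_derive t (1 : R) (K : R -> R^o) (k t)) ->
  exists M, 0 <= M /\ forall x : R,
    (\int[mu]_xi (\1_`[a, b] xi * k (phase1 (xi, x)))) ^+ 2 <= M * cauchy_weight x.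
Proof.
move=> ab ck k1 K1 dK.
pose B := \int[mu]_xi `|\1_`[a, b] xi : R|; exists (B ^+ 2 + 1).
have B0 : 0 <= B ^+ 2 by exact: sqr_ge0.
split=> [|x]; first by rewrite addr_ge0.
set T := \int[mu]_xi _.
have kcont : continuous (fun xi : R => k (phase1 (xi, x))).
  move=> xi; apply: (@continuous_comp _ _ _ (fun xi : R => phase1 (xi, x)) k); last exact: ck.
  apply: continuousN; apply: continuousM; first exact: cst_continuous.
  by apply: continuousM; [exact: cvg_id|exact: cst_continuous].
have TB : T ^+ 2 <= B ^+ 2.
  have iT := bounded_mull_integrable (integrable_indic_itv a b)
    (continuous_measurable_fun kcont) (fun _ => k1 _).
  rewrite -(real_normK (num_real T)) lerXn2r ?nnegrE//; first by apply: Rintegral_ge0.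
  apply: le_trans (le_normr_Rintegral measurableT iT) _.
  apply: le_Rintegral => //.
  - exact: (integrable_abse iT).
  - exact: (integrable_abse (integrable_indic_itv a b)).
  - by move=> xi _; rewrite normrM ler_piMr.
have xT : (x * T) ^+ 2 <= 1.
  have [->|x0] := eqVneq x 0; first by rewrite mul0r expr0n.
  (* The phase is linear in [xi] with slope [c], so [K] of the phase divided by [c] is a
     primitive. *)
  pose c := - (2 * pi * x) : R.
  have c0 : c != 0 by rewrite oppr_eq0 !mulf_neq0// gt_eqF// pi_gt0.
  have dF t : is_derive t (1 : R) (fun xi : R => c^-1 * K (phase1 (xi, x)) : R^o)
      (k (phase1 (t, x))).
    have E : (fun xi : R => phase1 (xi, x)) = (fun xi : R => c * xi).
      by apply/funext => xi; rewrite /phase1 /c /=; ring.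
    have dl : is_derive t (1 : R) (fun xi : R => phase1 (xi, x) : R^o) c.
      rewrite E; have := is_deriveZ c (is_derive_id t (1 : R)).
      by rewrite /GRing.scale /= mulr1.
    have := is_deriveZ c^-1 (@is_derive1_comp R K (fun xi => phase1 (xi, x)) t _ _ (dK _) dl).
    by rewrite /GRing.scale /= mulrCA mulVf// mulr1.
  have TE : x * T = - (2 * pi)^-1 * (K (phase1 (b, x)) - K (phase1 (a, x))).
    rewrite /T Rintegral_indic_mull (Rintegral_is_derive ab dF kcont) -mulrBr mulrA.
    congr (_ * _); rewrite /c invrN invfM mulrN mulrCA mulrC.
    by rewrite divff// mul1r.
  rewrite TE -real_normK ?num_real// -[leRHS](expr1n _ 2) lerXn2r ?nnegrE// normrM normrN.
  (* The two values of [K] contribute at most 2, less than [2 * pi]. *)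
  have p2 : 2 <= pi :> R by exact: pi_ge2.
  have pp : 0 < 2 * pi :> R by rewrite mulr_gt0// pi_gt0.
  rewrite normfV (gtr0_norm pp) mulrC ler_pdivrMr// mul1r.
  apply: le_trans (ler_normB _ _) _; apply: (@le_trans _ _ (1 + 1)); first exact: lerD.
  lra.
rewrite /cauchy_weight ler_pdivlMr ?ltr_pwDl ?sqr_ge0//.
by rewrite mulrDr mulr1 lerD// mulrC -exprMn.
Qed.

Let c1 (z : mR * mR) := cos (phase1 z).
Let s1 (z : mR * mR) := sin (phase1 z).
Let c2 (z : (mR * mR) * (mR * mR)) := cos (phase2 z).
Let s2 (z : (mR * mR) * (mR * mR)) := sin (phase2 z).

Lemma cos_transform_itv a b : a < b -> exists M, 0 <= M /\ forall x : mR,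
  (cos_transform mu c1 \1_`[a, b] x) ^+ 2 <= M * cauchy_weight x.
Proof.
move=> ab; apply: (@trig cos sin) => //.
- exact: continuous_cos.
- by move=> t; exact: cos_max.
- by move=> t; exact: sin_max.
Qed.

Lemma sin_transform_itv a b : a < b -> exists M, 0 <= M /\ forall x : mR,
  (sin_transform mu s1 \1_`[a, b] x) ^+ 2 <= M * cauchy_weight x.
Proof.
move=> ab; apply: (@trig sin (fun t => - cos t)) => //.
- exact: continuous_sin.
- by move=> t; exact: sin_max.
- by move=> t; rewrite normrN; exact: cos_max.
- by move=> t; have := is_deriveN (is_derive_cos t); rewrite opprK.
Qed.

Lemma Lnorm2_lty_bound d (T : measurableType d) (m : {measure set T -> \bar R})
    (F W : T -> R) (M : R) : measurable_fun setT F -> m.-integrable setT (EFin \o W) ->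
  (forall x : T, F x ^+ 2 <= M * W x) -> ('N[m]_2%:E[EFin \o F] < +oo)%E.
Proof.
move=> mF iW FW; apply: Lnorm2_lty.
apply: (le_integrable _ _ _ (integrable_EFinZl M measurableT iW)) => //.
  by apply/measurable_EFinP; exact: measurable_funX.
by move=> x _; rewrite /= lee_fin (ger0_norm (sqr_ge0 _)) (le_trans (FW x))// ler_norm.
Qed.

Definition box_indic (I J : R * R) : mR * mR -> R :=
  fun x => \1_`[I.1, I.2] x.1 * \1_`[J.1, J.2] x.2.

Lemma box_indic_ge0 I J x : 0 <= box_indic I J x.
Proof. by rewrite mulr_ge0// indicE. Qed.

Lemma box_indic_le1 I J x : box_indic I J x <= 1.
Proof. by rewrite mulr_ile1// indicE// lern1 leq_b1. Qed.

Lemma integrable_box_indic I J : lebesgue2.-integrable setT (EFin \o box_indic I J).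
Proof.
by apply: (@integrable_tensor _ _ _ _ R mu mu \1_`[I.1, I.2] \1_`[J.1, J.2]);
  exact: integrable_indic_itv.
Qed.

Let mc1 : measurable_fun setT c1. Proof. exact: measurable_cosf measurable_phase1. Qed.
Let ms1 : measurable_fun setT s1. Proof. exact: measurable_sinf measurable_phase1. Qed.
Let mc2 : measurable_fun setT c2. Proof. exact: measurable_cosf measurable_phase2. Qed.
Let ms2 : measurable_fun setT s2. Proof. exact: measurable_sinf measurable_phase2. Qed.

Lemma Lnorm2_itv a b : a < b ->
  [/\ ('N[mu]_2%:E[EFin \o (\1_`[a, b] : R -> R)] < +oo)%E,
      ('N[mu]_2%:E[EFin \o cos_transform mu c1 \1_`[a, b]] < +oo)%E &
      ('N[mu]_2%:E[EFin \o sin_transform mu s1 \1_`[a, b]] < +oo)%E].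
Proof.
move=> ab; have ih := integrable_indic_itv a b.
have mh : measurable_fun setT (\1_`[a, b] : mR -> R).
  by apply/measurable_EFinP; exact: (measurable_int mu).
have [M [M0 HM]] := cos_transform_itv ab; have [N [N0 HN]] := sin_transform_itv ab.
split.
- apply: (Lnorm2_lty_bound mh ih (M := 1)) => x.
  by rewrite indicE; case: (_ \in _); rewrite ?expr1n ?expr0n mul1r.
- exact: (Lnorm2_lty_bound (measurable_cos_transform mc1 ih) integrable_cauchy_weight HM).
- exact: (Lnorm2_lty_bound (measurable_sin_transform ms1 ih) integrable_cauchy_weight HN).
Qed.

(** The addition formulas express the transform of a box through products of one-dimensional
    transforms; the factor 2 in the constants comes from (u + v)^2 being at most 2 (u^2 + v^2). *)
Lemma Lnorm2_box I J : I.1 < I.2 -> J.1 < J.2 ->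
  [/\ ('N[lebesgue2]_2%:E[EFin \o box_indic I J] < +oo)%E,
      ('N[lebesgue2]_2%:E[EFin \o cos_transform lebesgue2 c2 (box_indic I J)] < +oo)%E &
      ('N[lebesgue2]_2%:E[EFin \o sin_transform lebesgue2 s2 (box_indic I J)] < +oo)%E].
Proof.
move=> hI hJ; have ih := integrable_box_indic I J.
have mh : measurable_fun setT (box_indic I J).
  by apply/measurable_EFinP; exact: (measurable_int lebesgue2).
have [A [A0 HA]] := cos_transform_itv hI; have [B [B0 HB]] := sin_transform_itv hI.
have [C [C0 HC]] := cos_transform_itv hJ; have [D [D0 HD]] := sin_transform_itv hJ.
set CI := cos_transform mu c1 _ in HA; set SI := sin_transform mu s1 _ in HB.
set CJ := cos_transform mu c1 _ in HC; set SJ := sin_transform mu s1 _ in HD.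
have ph (z x : mR * mR) : phase2 (z, x) = phase1 (z.1, x.1) + phase1 (z.2, x.2).
  by rewrite /phase2 /phase1 /=; ring.
have it (k l : mR * mR -> R) (x : mR * mR) : measurable_fun setT k -> measurable_fun setT l ->
    (forall z, `|k z| <= 1) -> (forall z, `|l z| <= 1) ->
    lebesgue2.-integrable setT (EFin \o (fun z : mR * mR =>
      (\1_`[I.1, I.2] z.1 * k (z.1, x.1)) * (\1_`[J.1, J.2] z.2 * l (z.2, x.2)))) /\
    \int[lebesgue2]_z ((\1_`[I.1, I.2] z.1 * k (z.1, x.1)) * (\1_`[J.1, J.2] z.2 * l (z.2, x.2))) =
    (\int[mu]_u (\1_`[I.1, I.2] u * k (u, x.1))) * (\int[mu]_u (\1_`[J.1, J.2] u * l (u, x.2))).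
  move=> mk ml k1 l1.
  have ik : mu.-integrable setT (EFin \o (fun u : mR => \1_`[I.1, I.2] u * k (u, x.1))).
    apply: bounded_mull_integrable => //; first exact: integrable_indic_itv.
    by apply: (measurableT_comp mk); exact: measurable_fun_pair.
  have il : mu.-integrable setT (EFin \o (fun u : mR => \1_`[J.1, J.2] u * l (u, x.2))).
    apply: bounded_mull_integrable => //; first exact: integrable_indic_itv.
    by apply: (measurableT_comp ml); exact: measurable_fun_pair.
  split; first exact: (@integrable_tensor _ _ _ _ R mu mu _ _ ik il).
  exact: (@Rintegral_tensor _ _ _ _ R mu mu _ _ ik il).
have c1b z : `|c1 z| <= 1 by exact: cos_max.
have s1b z : `|s1 z| <= 1 by exact: sin_max.
have EC x : cos_transform lebesgue2 c2 (box_indic I J) x = CI x.1 * CJ x.2 - SI x.1 * SJ x.2.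
  have [i1 e1] := it _ _ x mc1 mc1 c1b c1b; have [i2 e2] := it _ _ x ms1 ms1 s1b s1b.
  rewrite -e1 -e2 -(RintegralB measurableT i1 i2); apply: eq_Rintegral => z _.
  by rewrite /c2 ph cosD /box_indic /c1 /s1; ring.
have ES x : sin_transform lebesgue2 s2 (box_indic I J) x = SI x.1 * CJ x.2 + CI x.1 * SJ x.2.
  have [i1 e1] := it _ _ x ms1 mc1 s1b c1b; have [i2 e2] := it _ _ x mc1 ms1 c1b s1b.
  rewrite -e1 -e2 -(RintegralD measurableT i1 i2); apply: eq_Rintegral => z _.
  by rewrite /s2 ph sinD /box_indic /c1 /s1; ring.
have iw := @integrable_cauchy_weight2 R.
have bd (a b c d P Q P' Q' u v : R) : 0 <= P -> 0 <= Q -> a ^+ 2 <= P * u -> b ^+ 2 <= P' * v ->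
   c ^+ 2 <= Q * u -> d ^+ 2 <= Q' * v -> 
   (a * b - c * d) ^+ 2 <= 2 * (P * P' + Q * Q') * (u * v) /\
   (a * b + c * d) ^+ 2 <= 2 * (P * P' + Q * Q') * (u * v).
  move=> P0 Q0 h1 h2 h3 h4.
  have k1 : (a * b) ^+ 2 <= P * P' * (u * v).
    by rewrite exprMn (mulrACA P) ler_pM ?sqr_ge0.
  have k2 : (c * d) ^+ 2 <= Q * Q' * (u * v).
    by rewrite exprMn (mulrACA Q) ler_pM ?sqr_ge0.
  have s1' := sqr_ge0 (a * b - c * d); have s2' := sqr_ge0 (a * b + c * d).
  by split; lra.
split.
- apply: (Lnorm2_lty_bound mh ih (M := 1)) => x.
  by rewrite mul1r expr2 ler_piMl ?box_indic_ge0 ?box_indic_le1.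
- apply: (Lnorm2_lty_bound (measurable_cos_transform mc2 ih) iw (M := 2 * (A * C + B * D))).
  by move=> x; rewrite EC; exact: (bd _ _ _ _ _ _ _ _ _ _ A0 B0 (HA _) (HC _) (HB _) (HD _)).1.
- apply: (Lnorm2_lty_bound (measurable_sin_transform ms2 ih) iw (M := 2 * (B * C + A * D))).
  by move=> x; rewrite ES; exact: (bd _ _ _ _ _ _ _ _ _ _ B0 A0 (HB _) (HC _) (HA _) (HD _)).2.
Qed.

End interval_transform.

(** * Vanishing moments of the shearlet *)

Section almost_everywhere.
Context {R : realType}.
Local Notation mR := (measurableTypeR R).
Local Notation mu := (@lebesgue_measure R).

(** The primitive of [D] starting at [- n] vanishes to the right of [- n], and its derivative is [D]
    almost everywhere; the half-lines obtained for all [n] cover the line. *)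
Lemma ae_eq0_itv (D : mR -> R) : measurable_fun setT D ->
  (forall a b : R, a < b ->
     mu.-integrable setT (EFin \o (fun x => \1_`[a, b] x * D x)) /\
     \int[mu]_x (\1_`[a, b] x * D x) = 0) ->
  {ae mu, forall x, D x = 0}.
Proof.
move=> mD H.
have iD (a b : R) : a < b -> mu.-integrable `[a, b] (EFin \o D).
  move=> ab; apply: (integrable_mkcond (EFin \o D) (measurable_itv _)).2.
  by apply: eq_integrable (H a b ab).1 => // x _; rewrite epatch_indic /= -EFinM mulrC.
have iDle (a b : R) : mu.-integrable `[a, b] (EFin \o D).
  (* The interval may be empty or a point; moving its right end to at least [a + 1] makes the
     hypothesis applicable. *)
  apply: integrableS (iD a (Num.max b (a + 1)) _) => //.
    by apply: subset_itvl; rewrite bnd_simp le_max lexx.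
  by rewrite lt_max ltrDl ltr01 orbT.
have locD : locally_integrable [set: R] D.
  split=> //; first exact: openT.
  move=> K _ cK; have [M [_ HM]] := compact_bounded cK.
  have KM : K `<=` `[- (M + 1), M + 1]%classic.
    move=> x Kx; have := HM (M + 1) (ltr_pwDr ltr01 (lexx _)) x Kx.
    by rewrite /= in_itv /= ler_norml.
  have /integrableP[_ iM] := iDle (- (M + 1)) (M + 1).
  apply: le_lt_trans iM; apply: ge0_subset_integral => //.
  - exact: closed_measurable (compact_closed (@norm_hausdorff _ _) cK).
  - by apply/measurable_EFinP; apply: measurableT_comp => //; exact: measurable_funTS.
have key (n : nat) : {ae mu, forall x : R, - n%:R < x -> D x = 0}.
  have := FTC1 (a := BLeft (- n%:R)) (fun y => iDle _ _) locD.
  apply: (@filterS _ _ (ae_filter_ringOfSetsType mu)) => x /= Hx nx; have [] := Hx nx.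
  move=> _ <-; rewrite derive1E.
  rewrite (@near_eq_derive _ _ _ _ (cst 0) x 1); first exact: derive_cst.
  have : nbhs (x : R) [set y : R | - n%:R < y].
    by apply: open_nbhs_nbhs; split; [exact: open_gt|].
  by apply: filterS => y ny; rewrite /= -Rintegral_indic_mull (H _ _ ny).2.
have := ae_foralln key; apply: filterS => x Hx.
apply: (Hx (Num.truncn `|x|).+1); rewrite ltrNl (le_lt_trans (ler_norm _))//.
by rewrite normrN truncnS_gt.
Qed.

(** The product of a null set with the whole line is null, since [0 * +oo = 0] in the extended
    reals. *)
Lemma ae_fst (P : mR -> Prop) : {ae mu, forall x, P x} -> {ae lebesgue2, forall z, P z.1}.
Proof.
move=> [A [mA A0 PA]]; exists (A `*` setT); split.
- exact: measurableX.
- transitivity (mu A * mu setT)%E; first exact: product_measure1E.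
  by rewrite [mu A]A0 mul0e.
- by move=> z Pz; split => //; exact: PA.
Qed.

Lemma ae_neq0 : {ae mu, forall x : R, x != 0}.
Proof.
exists [set (0 : R)]; split; [exact: measurable_set1|exact: lebesgue_measure_set1|].
by move=> x /= /negP; rewrite negbK => /eqP.
Qed.

End almost_everywhere.

(** * Order of vanishing of F chi_1 and F psi_1 at the origin *)

Section lizorkin_line.
Context {R : realType}.
Local Notation mR := (measurableTypeR R).
Local Notation mu := (@lebesgue_measure R).

Lemma schwartz1_decay (f : R -> R[i]^o) k : is_schwartz1 f ->
  exists M, 0 <= M /\ forall x : R, `|x| ^+ k * cmod (f x) <= M * cauchy_weight x.
Proof.
move=> [_ /(_ (k + 2, 0)%N) /wsup_ltyP[M H]]; exists M.
have {}H (x : R) : jap1 x ^+ (k + 2) * cmod (f x) <= M by exact: H.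
split=> [|x].
  by apply: le_trans (H 0); rewrite mulr_ge0 ?cmod_ge0// exprn_ge0// sqrtr_ge0.
rewrite /cauchy_weight ler_pdivlMr ?ltr_pwDl ?sqr_ge0// -sqr_jap1 mulrAC.
apply: le_trans (H x); rewrite ler_wpM2r ?cmod_ge0// exprD ler_wpM2r ?sqr_ge0//.
by rewrite lerXn2r ?nnegrE ?sqrtr_ge0// ler_norm_jap1.
Qed.

Lemma schwartz1_continuous (f : R -> R[i]^o) : is_schwartz1 f ->
  continuous (fun x => complex.Re (f x)) /\ continuous (fun x => complex.Im (f x)).
Proof.
move=> [sf _]; have cf x : {for x, continuous f} by have [//|] := sf [::] _ x I.
by split=> x; apply: (continuous_comp (cf x)); [exact: cRe_continuous|exact: cIm_continuous].
Qed.

Lemma schwartz1_moment_integrable (f : R -> R[i]^o) k : is_schwartz1 f ->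
  mu.-integrable setT (EFin \o (fun x : mR => x ^+ k * complex.Re (f x))) /\
  mu.-integrable setT (EFin \o (fun x : mR => x ^+ k * complex.Im (f x))).
Proof.
move=> Sf; have [M [M0 HM]] := schwartz1_decay k Sf.
have [cR cI] := schwartz1_continuous Sf.
have iW := integrable_EFinZl M measurableT (@integrable_cauchy_weight R).
have I (q : mR -> R) : continuous (q : R -> R) -> (forall x, `|q x| <= cmod (f x)) ->
    mu.-integrable setT (EFin \o (fun x : mR => x ^+ k * q x)).
  move=> cq qf; apply: (le_integrable _ _ _ iW) => //.
    apply/measurable_EFinP; apply: measurable_funM; first exact: measurable_funX.
    exact: continuous_measurable_fun.
  move=> x _; rewrite /= lee_fin normrM normrX; apply: le_trans (ler_norm _).
  by apply: le_trans (HM x); rewrite ler_wpM2l// exprn_ge0.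
by split; apply: I => // x; [exact: normr_Re_le|exact: normr_Im_le].
Qed.

Lemma lizorkin1_moments (f : R -> R[i]^o) k : is_lizorkin1 f ->
  \int[mu]_x (x ^+ k * complex.Re (f x)) = 0 /\
  \int[mu]_x (x ^+ k * complex.Im (f x)) = 0.
Proof.
move=> [_ /(_ k)]; rewrite /cintegral => -[h1 h2]; split.
  by rewrite -[RHS]h1; apply: eq_Rintegral => x _; case: (f x) => u v /=; rewrite mul0r subr0.
by rewrite -[RHS]h2; apply: eq_Rintegral => x _; case: (f x) => u v /=; rewrite mul0r addr0.
Qed.

(** All Taylor coefficients at 0 vanish with the moments, so the whole transform is its own
    remainder of order [N]. *)
Lemma fourier1_lizorkin (f : R -> R[i]^o) N : is_lizorkin1 f ->
  exists C, forall t, `|complex.Re (fourier1 f t)| <= C * `|t| ^+ N /\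
                      `|complex.Im (fourier1 f t)| <= C * `|t| ^+ N.
Proof.
move=> Lf; have [Sf _] := Lf.
pose l (x : mR) : R := - (2 * pi * x).
have ml : measurable_fun setT l by apply: measurableT_comp => //; exact: measurable_funM.
pose q1 (x : mR) : R := complex.Re (f x); pose q2 (x : mR) : R := complex.Im (f x).
have lE k (q : mR -> R) : (fun x => l x ^+ k * q x) =
    (fun x => (- (2 * pi)) ^+ k * (x ^+ k * q x)).
  by apply/funext => x; rewrite /l -mulNr exprMn mulrA.
have i1 k : mu.-integrable setT (EFin \o (fun x => l x ^+ k * q1 x)).
  by rewrite lE; apply: integrable_EFinZl => //; exact: (schwartz1_moment_integrable k Sf).1.
have i2 k : mu.-integrable setT (EFin \o (fun x => l x ^+ k * q2 x)).
  by rewrite lE; apply: integrable_EFinZl => //; exact: (schwartz1_moment_integrable k Sf).2.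
have z1 k : \int[mu]_x (l x ^+ k * q1 x) = 0.
  rewrite lE RintegralZl//; last exact: (schwartz1_moment_integrable k Sf).1.
  by rewrite (lizorkin1_moments k Lf).1 mulr0.
have z2 k : \int[mu]_x (l x ^+ k * q2 x) = 0.
  rewrite lE RintegralZl//; last exact: (schwartz1_moment_integrable k Sf).2.
  by rewrite (lizorkin1_moments k Lf).2 mulr0.
(* The imaginary part is the oscillatory integral of the pair [q2], [- q1]. *)
have i3 k : mu.-integrable setT (EFin \o (fun x => l x ^+ k * - q1 x)).
  rewrite (_ : (fun x => _) = (fun x => -1 * (l x ^+ k * q1 x))).
    exact: integrable_EFinZl.
  by apply/funext => x; rewrite mulN1r mulrN.
have z3 k : \int[mu]_x (l x ^+ k * - q1 x) = 0.
  rewrite (_ : (fun x => _) = (fun x => -1 * (l x ^+ k * q1 x))).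
    by rewrite RintegralZl// z1 mulr0.
  by apply/funext => x; rewrite mulN1r mulrN.
pose A := \int[mu]_x (`|l x| ^+ N * (`|q1 x| + `|q2 x|)).
have mc0 (p1 p2 : mR -> R) k : \int[mu]_x (l x ^+ k * p1 x) = 0 ->
    \int[mu]_x (l x ^+ k * p2 x) = 0 -> moment_coef mu p1 p2 l k = 0.
  by move=> h1 h2; rewrite /moment_coef h1 h2 !mulr0 subr0.
exists A => t; split.
- have := oscillatory_taylor ml i1 i2 N t.
  rewrite big1 ?subr0; last by move=> k _; rewrite mc0 ?mul0r.
  rewrite mulrC; congr (`|_| <= _); apply: eq_Rintegral => x _.
  rewrite /q1 /q2 /cexpi (_ : t * l x = - (2 * pi * (t * x))); last by rewrite /l; ring.
  by case: (f x).
- have := oscillatory_taylor ml i2 i3 N t.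
  rewrite big1 ?subr0; last by move=> k _; rewrite mc0 ?mul0r.
  have -> : \int[mu]_x (`|l x| ^+ N * (`|q2 x| + `|- q1 x|)) = A.
    by apply: eq_Rintegral => x _; rewrite (normrN (q1 x)) [X in _ * X]addrC.
  rewrite mulrC; congr (`|_| <= _); apply: eq_Rintegral => x _.
  rewrite /q1 /q2 /cexpi (_ : t * l x = - (2 * pi * (t * x))); last by rewrite /l; ring.
  by case: (f x) => u v /=; rewrite mulNr opprK addrC.
Qed.

(** Here [chi] is its own integrable version, so pairing with all intervals identifies its L^2
    transform with its Fourier integral almost everywhere. *)
Lemma L2_fourier1_lizorkin (chi F : R -> R[i]^o) N :
  is_fourierL2_1 chi (fun tau : R => (`|tau|%:C)%C * F tau) -> is_lizorkin1 chi ->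
  exists C, {ae mu, forall t : R, cmod (F t) <= C * `|t| ^+ N}.
Proof.
move=> Fchi Lchi; have [Schi _] := Lchi.
(* Order [N.+1] prepares the division by |t|; [C + C] arises from bounding a modulus by the absolute
   values of its two parts. *)
have [C HC] := fourier1_lizorkin N.+1 Lchi; exists (C + C).
pose g (tau : mR) : R[i] := (`|tau|%:C)%C * F tau.
have [_ [mgR mgI _] _] := Fchi.
have [iR iI] := schwartz1_moment_integrable 0 Schi.
have {}iR : mu.-integrable setT (EFin \o (fun x : mR => complex.Re (chi x))).
  by apply: eq_integrable iR => // x _; rewrite /= mul1r.
have {}iI : mu.-integrable setT (EFin \o (fun x : mR => complex.Im (chi x))).
  by apply: eq_integrable iI => // x _; rewrite /= mul1r.
pose c (z : mR * mR) := cos (phase1 z); pose s (z : mR * mR) := sin (phase1 z).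
have mc : measurable_fun setT c by exact: measurable_cosf (@measurable_phase1 R).
have ms : measurable_fun setT s by exact: measurable_sinf (@measurable_phase1 R).
have c1 z : `|c z| <= 1 by exact: cos_max.
have s1 z : `|s z| <= 1 by exact: sin_max.
have mchiR : measurable_fun setT (fun x : mR => complex.Re (chi x)).
  by apply/measurable_EFinP; exact: (measurable_int mu).
have mchiI : measurable_fun setT (fun x : mR => complex.Im (chi x)).
  by apply/measurable_EFinP; exact: (measurable_int mu).
have mRe := @measurable_Re_phase_transform _ _ R mu c s mc ms chi
  mchiR mchiI.
have mIm := @measurable_Im_phase_transform _ _ R mu c s mc ms chi
  mchiR mchiI.
have chichi : {ae mu, forall x, chi x = chi x} by exact: aeW.
have pair (a b : R) : a < b ->
    (mu.-integrable setT (EFin \o (fun t => \1_`[a, b] t * complex.Re (g t))) /\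
     mu.-integrable setT (EFin \o (fun t => \1_`[a, b] t * complex.Im (g t)))) /\
    \int[mu]_t (\1_`[a, b] t * complex.Re (g t)) =
    \int[mu]_t (\1_`[a, b] t * complex.Re (fourier1 chi t)) /\
    \int[mu]_t (\1_`[a, b] t * complex.Im (g t)) =
    \int[mu]_t (\1_`[a, b] t * complex.Im (fourier1 chi t)).
  move=> /Lnorm2_itv[h2 hc hs].
  exact: (L2_extension_pairing mc ms c1 s1 (integrable_indic_itv a b) h2 hc hs Fchi iR iI chichi).
have pt (a b : R) (ab : a < b) := phase_transform_pairing mc ms c1 s1
  (integrable_indic_itv a b) iR iI.
have aeR : {ae mu, forall t : R, complex.Re (g t) - complex.Re (fourier1 chi t) = 0}.
  apply: ae_eq0_itv; first exact: measurable_funB.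
  move=> a b ab; have [[p1 p2] [p3 p4]] := pair a b ab; have [[q1 q2] _] := pt a b ab.
  under [X in _ \o X]eq_fun do rewrite mulrBr.
  under eq_Rintegral do rewrite mulrBr.
  split; first exact: (integrableB measurableT p1 q1).
  by rewrite (RintegralB measurableT p1 q1) p3 subrr.
have aeI : {ae mu, forall t : R, complex.Im (g t) - complex.Im (fourier1 chi t) = 0}.
  apply: ae_eq0_itv; first exact: measurable_funB.
  move=> a b ab; have [[p1 p2] [p3 p4]] := pair a b ab; have [[q1 q2] _] := pt a b ab.
  under [X in _ \o X]eq_fun do rewrite mulrBr.
  under eq_Rintegral do rewrite mulrBr.
  split; first exact: (integrableB measurableT p2 q2).
  by rewrite (RintegralB measurableT p2 q2) p4 subrr.
apply: (@filterS3 _ _ (ae_filter_ringOfSetsType mu) _ _ _ _ _ aeR aeI (@ae_neq0 R)) => t /subr0_eq hR /subr0_eq hI t0.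
have [CR CI] := HC t; rewrite -hR in CR; rewrite -hI in CI.
have gR : complex.Re (g t) = `|t| * complex.Re (F t).
  by rewrite /g; case: (F t) => u v /=; rewrite mul0r subr0.
have gI : complex.Im (g t) = `|t| * complex.Im (F t).
  by rewrite /g; case: (F t) => u v /=; rewrite mul0r addr0.
have tp : 0 < `|t| by rewrite normr_gt0.
have cut (y : R) : `|(`|t| * y)| <= C * `|t| ^+ N.+1 -> `|y| <= C * `|t| ^+ N.
  by rewrite normrM normr_id exprS mulrCA ler_pM2l.
apply: le_trans (cmod_le _) _; rewrite mulrDl lerD//; apply: cut.
  by rewrite -gR.
by rewrite -gI.
Qed.

Lemma schwartz1_bounded (f : R -> R[i]^o) : is_schwartz1 f ->
  exists C, 0 <= C /\ forall x, cmod (f x) <= C.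
Proof.
move=> [_ /(_ (0, 0)%N) /wsup_ltyP[M H]]; exists M.
have {}H (x : R) : cmod (f x) <= M by have := H x I; rewrite expr0 mul1r.
by split=> //; apply: le_trans (H 0); exact: cmod_ge0.
Qed.

End lizorkin_line.

(** * Moments of the shearlet from the decay of its Fourier transform in xi_1 *)

Section vanishing_moments.
Context {R : realType}.
Local Notation mR := (measurableTypeR R).
Local Notation mu := (@lebesgue_measure R).
Implicit Types (I J : R * R).

Lemma Rintegral_box_indic I J : I.1 < I.2 -> J.1 < J.2 ->
  \int[lebesgue2]_x box_indic I J x = (I.2 - I.1) * (J.2 - J.1).
Proof.
move=> hI hJ; have len (a b : R) : a < b -> \int[mu]_x (\1_`[a, b] x : R) = b - a.
  move=> ab; rewrite -(@Rintegral_is_derive R (fun=> 1) id a b ab)//.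
    by rewrite -(Rintegral_indic_mull `[a, b] (fun=> 1)); apply: eq_Rintegral => x _; rewrite mulr1.
  by move=> x; exact: cvg_cst.
rewrite -(len _ _ hI) -(len _ _ hJ).
exact: (@Rintegral_tensor _ _ _ _ R mu mu _ _ (integrable_indic_itv _ _) (integrable_indic_itv _ _)).
Qed.

(** If [D x0] were positive, [D] would exceed half of it on a small box, and the integral over that
    box would be positive. *)
Lemma le0_box (D : R * R -> R) (x0 : R * R) : {for x0, continuous D} ->
  (forall I J, I.1 < I.2 -> J.1 < J.2 ->
    lebesgue2.-integrable setT (EFin \o (fun x => box_indic I J x * D x)) /\
    \int[lebesgue2]_x (box_indic I J x * D x) <= 0) ->
  D x0 <= 0.
Proof.
move=> cD H; rewrite leNgt; apply/negP => D0.
have : nbhs x0 [set y | D x0 / 2 < D y].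
  have := cD [set u | D x0 / 2 < u]; apply; apply: open_nbhs_nbhs; split; first exact: open_gt.
  by rewrite /= ltr_pdivrMr// ltr_pMr// ltr1n.
move=> /nbhs_ballP[e /= e0 He].
pose I : R * R := (x0.1 - e / 2, x0.1 + e / 2).
pose J : R * R := (x0.2 - e / 2, x0.2 + e / 2).
have e2 : 0 < e / 2 by rewrite divr_gt0.
have hI : I.1 < I.2 by rewrite /= ltrD2l gtrN.
have hJ : J.1 < J.2 by rewrite /= ltrD2l gtrN.
have [iD DI] := H I J hI hJ.
have iB := integrable_EFinZl (D x0 / 2) measurableT (integrable_box_indic I J).
have : \int[lebesgue2]_x (D x0 / 2 * box_indic I J x) <=
    \int[lebesgue2]_x (box_indic I J x * D x).
  apply: le_Rintegral => //.
  move=> y _; rewrite mulrC /box_indic !indicE.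
  have [y1|] := boolP (y.1 \in _); last by rewrite !mul0r.
  have [y2|] := boolP (y.2 \in _); last by rewrite !mulr0 !mul0r.
  rewrite !mul1r ltW//; apply: He.
  have near0 (u v : R) : v \in `[u - e / 2, u + e / 2]%classic -> ball u e v.
    move=> /set_mem /=; rewrite in_itv /= => /andP[h1 h2]; rewrite /ball /= ltr_distlC.
    by apply/andP; split; lra.
  by split; exact: near0.
rewrite RintegralZl//; last exact: integrable_box_indic.
rewrite Rintegral_box_indic// => h; have := le_trans h DI.
by rewrite leNgt !mulr_gt0// subr_gt0.
Qed.

Lemma ge0_Rintegral_ae d (T : measurableType d) (m : {measure set T -> \bar R}) (f : T -> R) :
  m.-integrable setT (EFin \o f) -> {ae m, forall x, 0 <= f x} -> 0 <= \int[m]_x f x.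
Proof.
move=> intf f0; have mf : measurable_fun setT f.
  by apply/measurable_EFinP; exact: (measurable_int m).
rewrite (_ : \int[m]_x f x = \int[m]_x `|f x|); first by apply: Rintegral_ge0.
rewrite /Rintegral; congr fine; apply: ae_eq_integral => //.
- exact/measurable_EFinP.
- by apply/measurable_EFinP; apply: measurableT_comp.
- by apply: filterS f0 => x f0 _ /=; rewrite ger0_norm.
Qed.

Lemma lipschitz_cos (a b : R) : `|cos b - cos a| <= `|b - a|.
Proof.
have [c [_ ->]] := MVT_between a b (fun t => is_derive_cos t).
by rewrite normrM normrN ler_piMl// sin_max.
Qed.

Lemma lipschitz_sin (a b : R) : `|sin b - sin a| <= `|b - a|.
Proof.
have [c [_ ->]] := MVT_between a b (fun t => is_derive_sin t).
by rewrite normrM ler_piMl// cos_max.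
Qed.

(** The increments are controlled by [2 * pi] times the first absolute moments of [q], which are
    finite by its decay. *)
Lemma continuous_phase_integral (q : R * R -> R) (k : R -> R) : rapid2 q -> continuous k ->
  (forall a, `|k a| <= 1) -> (forall a b, `|k b - k a| <= `|b - a|) ->
  continuous (fun xi : R * R => \int[lebesgue2]_x (q x * k (phase2 (xi, x)))).
Proof.
move=> rq ck k1 kL xi; set T := fun xi => _.
have mk eta : measurable_fun setT (fun x : mR * mR => k (phase2 (eta, x))).
  apply: (@measurableT_comp _ _ _ _ _ _ k); first exact: continuous_measurable_fun.
  by apply: (measurableT_comp (@measurable_phase2 R)); exact: measurable_fun_pair.
have ik eta := bounded_mull_integrable (rapid2_integrable rq) (mk eta) (fun _ => k1 _).
have i1 : lebesgue2.-integrable setT (EFin \o (fun x : mR * mR => `|x.1 * q x|)).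
  exact: (integrable_abse (rapid2_integrable (rapid2_x1 rq))).
have i2 : lebesgue2.-integrable setT (EFin \o (fun x : mR * mR => `|x.2 * q x|)).
  exact: (integrable_abse (rapid2_integrable (rapid2_x2 rq))).
pose K1 := \int[lebesgue2]_x `|x.1 * q x|; pose K2 := \int[lebesgue2]_x `|x.2 * q x|.
have K10 : 0 <= K1 by apply: Rintegral_ge0.
have K20 : 0 <= K2 by apply: Rintegral_ge0.
have p0 : 0 <= 2 * pi :> R by rewrite mulr_ge0// pi_ge0.
have L eta : `|T xi - T eta| <=
    2 * pi * `|xi.1 - eta.1| * K1 + 2 * pi * `|xi.2 - eta.2| * K2.
  rewrite /T -(RintegralB measurableT (ik xi) (ik eta)).
  have iB := integrableB measurableT (ik xi) (ik eta).
  apply: le_trans (le_normr_Rintegral measurableT iB) _.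
  have j1 := integrable_EFinZl (2 * pi * `|xi.1 - eta.1|) measurableT i1.
  have j2 := integrable_EFinZl (2 * pi * `|xi.2 - eta.2|) measurableT i2.
  rewrite -!RintegralZl// -(RintegralD measurableT j1 j2).
  apply: le_Rintegral => //.
  - exact: (integrable_abse iB).
  - exact: (integrableD measurableT j1 j2).
  move=> x _; rewrite -mulrBr normrM.
  have -> : 2 * pi * `|xi.1 - eta.1| * `|x.1 * q x| + 2 * pi * `|xi.2 - eta.2| * `|x.2 * q x| =
      `|q x| * (2 * pi * (`|(xi.1 - eta.1) * x.1| + `|(xi.2 - eta.2) * x.2|)).
    by rewrite !normrM; ring.
  rewrite ler_wpM2l//; apply: le_trans (kL _ _) _.
  have -> : phase2 (xi, x) - phase2 (eta, x) =
      - (2 * pi * ((xi.1 - eta.1) * x.1 + (xi.2 - eta.2) * x.2)) by rewrite /phase2 /=; ring.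
  by rewrite normrN normrM (ger0_norm p0) ler_wpM2l// ler_normD.
apply/cvgrPdist_lt => e e0.
pose K := 2 * pi * K1 + 2 * pi * K2.
have K0 : 0 <= K by rewrite addr_ge0// mulr_ge0.
have Kr (a b r : R) : a <= r -> b <= r ->
    2 * pi * a * K1 + 2 * pi * b * K2 <= K * r.
  move=> ar br; rewrite /K [leRHS]mulrDl (mulrAC _ a) (mulrAC _ b).
  by apply: lerD; rewrite ler_wpM2l// mulr_ge0.
have eK : 0 < e / (K + 1) by rewrite divr_gt0// ltr_wpDl.
apply: (filterS _ (nbhsx_ballx xi _ eK)) => eta [b1 b2]; apply: le_lt_trans (L eta) _.
apply: (@le_lt_trans _ _ (K * (e / (K + 1)))).
  exact: Kr (ltW b1) (ltW b2).
by rewrite mulrA ltr_pdivrMr ?ltr_wpDl// mulrC ltr_pM2l// ltrDl.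
Qed.

Section fourier2.
Variable psi : R * R -> R[i].
Let q1 (x : R * R) : R := complex.Re (psi x).
Let q2 (x : R * R) : R := complex.Im (psi x).
Hypothesis r1 : rapid2 q1.
Hypothesis r2 : rapid2 q2.

Let mcos (xi : R * R) (k : R -> R) : continuous k ->
  measurable_fun setT (fun x : mR * mR => k (phase2 (xi, x))).
Proof.
move=> ck; apply: (@measurableT_comp _ _ _ _ _ _ k); first exact: continuous_measurable_fun.
by apply: (measurableT_comp (@measurable_phase2 R)); exact: measurable_fun_pair.
Qed.

Lemma Re_fourier2 (xi : R * R) : complex.Re (fourier2 psi xi) =
  \int[lebesgue2]_x (q1 x * cos (phase2 (xi, x)) - q2 x * sin (phase2 (xi, x))).
Proof. by apply: eq_Rintegral => x _; rewrite /q1 /q2; case: (psi x). Qed.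

Lemma Im_fourier2 (xi : R * R) : complex.Im (fourier2 psi xi) =
  \int[lebesgue2]_x (q1 x * sin (phase2 (xi, x)) + q2 x * cos (phase2 (xi, x))).
Proof. by apply: eq_Rintegral => x _; rewrite /q1 /q2; case: (psi x). Qed.

Let i1c xi := bounded_mull_integrable (rapid2_integrable r1) (mcos xi (@continuous_cos R))
  (fun _ => cos_max _).
Let i1s xi := bounded_mull_integrable (rapid2_integrable r1) (mcos xi (@continuous_sin R))
  (fun _ => sin_max _).
Let i2c xi := bounded_mull_integrable (rapid2_integrable r2) (mcos xi (@continuous_cos R))
  (fun _ => cos_max _).
Let i2s xi := bounded_mull_integrable (rapid2_integrable r2) (mcos xi (@continuous_sin R))
  (fun _ => sin_max _).

Lemma continuous_Re_fourier2 : continuous (fun xi : R * R => complex.Re (fourier2 psi xi)).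
Proof.
under eq_fun do rewrite Re_fourier2 (RintegralB measurableT (i1c _) (i2s _)).
move=> xi; apply: cvgB.
  exact: (continuous_phase_integral r1 (@continuous_cos R) (@cos_max R) lipschitz_cos).
exact: (continuous_phase_integral r2 (@continuous_sin R) (@sin_max R) lipschitz_sin).
Qed.

Lemma continuous_Im_fourier2 : continuous (fun xi : R * R => complex.Im (fourier2 psi xi)).
Proof.
under eq_fun do rewrite Im_fourier2 (RintegralD measurableT (i1s _) (i2c _)).
move=> xi; apply: cvgD.
  exact: (continuous_phase_integral r1 (@continuous_sin R) (@sin_max R) lipschitz_sin).
exact: (continuous_phase_integral r2 (@continuous_cos R) (@cos_max R) lipschitz_cos).
Qed.

(** An almost everywhere bound on [g] becomes a bound everywhere on the continuous Fourier integral: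
    both have the same integrals over boxes, and [le0_box] excludes any point where the bound is
    exceeded. *)
Lemma fourier2_bound (f g : R * R -> R[i]) (C : R) N : is_fourierL2_2 f g ->
  {ae lebesgue2, forall x, psi x = f x} ->
  {ae lebesgue2, forall xi : mR * mR, cmod (g xi) <= C * `|xi.1| ^+ N} ->
  forall xi : R * R, `|complex.Re (fourier2 psi xi)| <= C * `|xi.1| ^+ N /\
                     `|complex.Im (fourier2 psi xi)| <= C * `|xi.1| ^+ N.
Proof.
move=> Ff psif gC xi.
pose c (z : (mR * mR) * (mR * mR)) := cos (phase2 z).
pose s (z : (mR * mR) * (mR * mR)) := sin (phase2 z).
have mc : measurable_fun setT c by exact: measurable_cosf (@measurable_phase2 R).
have ms : measurable_fun setT s by exact: measurable_sinf (@measurable_phase2 R).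
have c1 z : `|c z| <= 1 by exact: cos_max.
have s1 z : `|s z| <= 1 by exact: sin_max.
have iR := rapid2_integrable r1; have iI := rapid2_integrable r2.
have pw I J : lebesgue2.-integrable setT
    (EFin \o (fun x : mR * mR => box_indic I J x * (C * `|x.1| ^+ N))).
  have ip : mu.-integrable setT (EFin \o (fun u : mR => \1_`[I.1, I.2] u * (C * `|u| ^+ N))).
    apply: integrable_indic_mull => //; apply: continuous_compact_integrable.
      exact: segment_compact.
    apply: continuous_subspaceT => u; apply: cvgM; first exact: cvg_cst.
    apply: (@continuous_comp _ _ _ (fun u : R => `|u|) (fun v => v ^+ N)).
      exact: norm_continuous.
    exact: exprn_continuous.
  have := @integrable_tensor _ _ _ _ R mu mu _ _ ip (integrable_indic_itv J.1 J.2).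
  by apply: eq_integrable => // x _; rewrite /box_indic /= mulrAC.
have key (G P : mR * mR -> R) : (forall xi, `|G xi| <= cmod (g xi)) ->
    continuous (P : R * R -> R) ->
    (forall I J, I.1 < I.2 -> J.1 < J.2 ->
      [/\ lebesgue2.-integrable setT (EFin \o (fun x => box_indic I J x * G x)),
          lebesgue2.-integrable setT (EFin \o (fun x => box_indic I J x * P x)) &
          \int[lebesgue2]_x (box_indic I J x * G x) = \int[lebesgue2]_x (box_indic I J x * P x)]) ->
    forall xi, `|P xi| <= C * `|xi.1| ^+ N.
  move=> Gg cP HGP {}xi.
  have cw : {for xi, continuous (fun x : R * R => C * `|x.1| ^+ N)}.
    apply: cvgM; first exact: cvg_cst.
    apply: (@continuous_comp _ _ _ (fun u : R * R => `|u.1|) (fun v => v ^+ N)).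
      apply: (@continuous_comp _ _ _ (fun u : R * R => u.1) (fun v : R => `|v|)).
        exact: cvg_fst.
      exact: norm_continuous.
    exact: exprn_continuous.
  (* [e] is a sign, encoded by its square, so that both inequalities of the absolute value are
     treated at once. *)
  have bd (e : R) : e ^+ 2 = 1 -> e * P xi <= C * `|xi.1| ^+ N.
    move=> e1; rewrite -subr_le0.
    apply: (@le0_box (fun x => e * P x - C * `|x.1| ^+ N)).
      by apply: cvgB => //; apply: cvgM; [exact: cvg_cst|exact: cP].
    move=> I J hI hJ; have [iG iP EGP] := HGP I J hI hJ.
    have jG := integrable_EFinZl e measurableT iG.
    have jP := integrable_EFinZl e measurableT iP.
    have E (Q : mR * mR -> R) : (fun x : mR * mR => box_indic I J x * (e * Q x - C * `|x.1| ^+ N)) =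
        (fun x => e * (box_indic I J x * Q x) - box_indic I J x * (C * `|x.1| ^+ N)).
      by apply/funext => x; ring.
    rewrite E; split; first exact: (integrableB measurableT jP (pw I J)).
    rewrite (RintegralB measurableT jP (pw I J)) RintegralZl// -EGP.
    rewrite -RintegralZl// -oppr_ge0 opprB -(RintegralB measurableT (pw I J) jG).
    apply: ge0_Rintegral_ae; first exact: (integrableB measurableT (pw I J) jG).
    apply: filterS gC => x gx; rewrite (mulrCA e) -mulrBr mulr_ge0 ?box_indic_ge0// subr_ge0.
    apply: le_trans gx; apply: le_trans (Gg x); apply: le_trans (ler_norm _) _.
    rewrite normrM (_ : `|e| = 1) ?mul1r//; apply/eqP.
    by rewrite -(@eqrXn2 _ 2) ?normr_ge0 ?ler01// expr1n real_normK ?num_real// e1.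
  rewrite ler_norml lerNl -mulN1r bd ?sqrrN ?expr1n//.
  by rewrite -[P xi]mul1r bd// expr1n.
have [hR hI] := (key (fun xi => complex.Re (g xi)) (fun xi => complex.Re (fourier2 psi xi)),
  key (fun xi => complex.Im (g xi)) (fun xi => complex.Im (fourier2 psi xi))).
have pairs I J : I.1 < I.2 -> J.1 < J.2 ->
  ((lebesgue2.-integrable setT (EFin \o (fun x => box_indic I J x * complex.Re (g x))) /\
    lebesgue2.-integrable setT (EFin \o (fun x => box_indic I J x * complex.Im (g x)))) /\
   \int[lebesgue2]_x (box_indic I J x * complex.Re (g x)) =
   \int[lebesgue2]_x (box_indic I J x * complex.Re (fourier2 psi x)) /\
   \int[lebesgue2]_x (box_indic I J x * complex.Im (g x)) =
   \int[lebesgue2]_x (box_indic I J x * complex.Im (fourier2 psi x))) /\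
  (lebesgue2.-integrable setT (EFin \o (fun x => box_indic I J x * complex.Re (fourier2 psi x))) /\
   lebesgue2.-integrable setT (EFin \o (fun x => box_indic I J x * complex.Im (fourier2 psi x)))).
  move=> hhI hhJ; have [h2 hc hs] := Lnorm2_box hhI hhJ; split.
    exact: (L2_extension_pairing mc ms c1 s1 (integrable_box_indic I J) h2 hc hs Ff iR iI psif).
  exact: (phase_transform_pairing mc ms c1 s1 (integrable_box_indic I J) iR iI).1.
split.
- apply: hR => [{}xi||I J hhI hhJ]; [exact: normr_Re_le|exact: continuous_Re_fourier2|].
  by have [[[? ?] [? ?]] [? ?]] := pairs I J hhI hhJ.
- apply: hI => [{}xi||I J hhI hhJ]; [exact: normr_Im_le|exact: continuous_Im_fourier2|].
  by have [[[? ?] [? ?]] [? ?]] := pairs I J hhI hhJ.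
Qed.

End fourier2.

Lemma rapid2_sum (n : nat) (c : nat -> R) (p : nat -> R * R -> R) :
  (forall i, rapid2 (p i)) ->
  rapid2 (fun x => \sum_(i < n) c i * p i x) /\
  \int[lebesgue2]_x (\sum_(i < n) c i * p i x) = \sum_(i < n) c i * \int[lebesgue2]_x p i x.
Proof.
move=> rp; elim: n => [|n [IH1 IH2]].
  under eq_fun do rewrite big_ord0.
  rewrite big_ord0; split; last by rewrite /Rintegral integral0_eq// => x _; rewrite big_ord0.
  split; first exact: measurable_cst.
  by move=> k; exists 0 => x; rewrite normr0 mulr0.
have rn : rapid2 (fun x => c n * p n x) by exact: rapid2Z.
have E : (fun x => \sum_(i < n.+1) c i * p i x) =
    (fun x => \sum_(i < n) c i * p i x + c n * p n x).
  by apply/funext => x; rewrite big_ord_recr.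
rewrite E; split; first exact: rapid2D.
by rewrite RintegralD2// IH2 RintegralZl2// big_ord_recr.
Qed.

(** In each degree the integral is a polynomial in [v] that vanishes identically; its coefficient of
    [v ^+ j] is a nonzero binomial number times a moment. *)
Lemma null_moments_rays (q : R * R -> R) : rapid2 q ->
  (forall (k : nat) (v : R), \int[lebesgue2]_x ((x.1 + v * x.2) ^+ k * q x) = 0) ->
  null_moments q.
Proof.
move=> rq H i j.
pose p (l : nat) (x : R * R) : R := x.1 ^+ (i + j - l) * x.2 ^+ l * q x.
have rp l : rapid2 (p l) by exact: rapid2_monomial.
pose a l : R := 'C(i + j, l)%:R * \int[lebesgue2]_x p l x.
have Z (v : R) : \sum_(l < (i + j).+1) a l * v ^+ l = 0.
  rewrite -[RHS](H (i + j)%N v).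
  have -> : (fun x : mR * mR => (x.1 + v * x.2) ^+ (i + j) * q x) =
      (fun x => \sum_(l < (i + j).+1) ('C(i + j, l)%:R * v ^+ l) * p l x).
    apply/funext => x; rewrite exprDn mulr_suml; apply: eq_bigr => l _.
    by rewrite exprMn -mulr_natl /p; ring.
  rewrite (rapid2_sum _ (fun l => 'C(i + j, l)%:R * v ^+ l) rp).2.
  by apply: eq_bigr => l _; rewrite /a mulrAC.
have aj : a j = 0.
  apply: (@sum_power_eq0 R (i + j).+1 a 0 _ j); last by rewrite ltnS leq_addl.
  by move=> t _; rewrite Z normr0 mul0r.
move/eqP: aj; rewrite /a mulf_eq0 pnatr_eq0 -leqn0 leqNgt bin_gt0 leq_addl /= => /eqP.
by rewrite /p addnK.
Qed.

(** On the ray of slope [v] the transform is an oscillatory integral in [t] with the linear form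
    [l]. Being smaller than every power of [t], it has zero Taylor coefficients, for its real and
    its imaginary part. *)
Lemma null_moments_fourier2 (psi : R * R -> R[i]) :
  rapid2 (fun x => complex.Re (psi x)) -> rapid2 (fun x => complex.Im (psi x)) ->
  (forall N, exists C, forall xi : R * R,
     `|complex.Re (fourier2 psi xi)| <= C * `|xi.1| ^+ N /\
     `|complex.Im (fourier2 psi xi)| <= C * `|xi.1| ^+ N) ->
  null_moments (fun x => complex.Re (psi x)) /\ null_moments (fun x => complex.Im (psi x)).
Proof.
move=> r1 r2 H.
pose q1 x := complex.Re (psi x); pose q2 x := complex.Im (psi x).
suff M k v : \int[lebesgue2]_x ((x.1 + v * x.2) ^+ k * q1 x) = 0 /\
             \int[lebesgue2]_x ((x.1 + v * x.2) ^+ k * q2 x) = 0.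
  by split; apply: null_moments_rays => // k v; have [] := M k v.
pose l (x : mR * mR) : R := - (2 * pi * (x.1 + v * x.2)).
have ml : measurable_fun setT l.
  apply: measurableT_comp => //; apply: measurable_funM => //.
  by apply: measurable_funD; [exact: measurable_fst|apply: measurable_funM].
have ra (n : nat) q : rapid2 q -> rapid2 (fun x => (x.1 + v * x.2) ^+ n * q x).
  by move=> rq; have := rapid2_affine 0 1 v n rq; under eq_fun do rewrite add0r mul1r.
have lE n (q : mR * mR -> R) : (fun x => l x ^+ n * q x) =
    (fun x => (- (2 * pi)) ^+ n * ((x.1 + v * x.2) ^+ n * q x)).
  by apply/funext => x; rewrite /l -mulNr exprMn mulrA.
have rl q n : rapid2 q -> rapid2 (fun x => l x ^+ n * q x).
  by move=> rq; rewrite lE; apply: rapid2Z; exact: ra.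
have r1N : rapid2 (fun x => - q1 x).
  by have := rapid2Z (-1) r1; under eq_fun do rewrite mulN1r.
pose I (q : R * R -> R) : R := \int[lebesgue2]_x (l x ^+ k * q x).
have IN : I (fun x => - q1 x) = - I q1.
  rewrite -mulN1r /I -RintegralZl2; last exact: rl.
  by apply: eq_Rintegral => x _; rewrite mulrN mulN1r.
have phE (t : R) (x : mR * mR) : t * l x = phase2 ((t, t * v), x).
  by rewrite /l /phase2 /=; ring.
have coef (p1 p2 : R * R -> R) : rapid2 p1 -> rapid2 p2 ->
    (forall N, exists C, forall t : R,
      `|\int[lebesgue2]_x (p1 x * cos (t * l x) - p2 x * sin (t * l x))| <= C * `|t| ^+ N) ->
    moment_coef lebesgue2 p1 p2 l k = 0.
  (* Order [k.+1] is the first whose Taylor polynomial contains coefficient [k]. *)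
  move=> rp1 rp2 /(_ k.+1)[C HC].
  have T t := oscillatory_taylor ml (fun n => rapid2_integrable (rl _ n rp1))
    (fun n => rapid2_integrable (rl _ n rp2)) k.+1 t.
  set A := \int[lebesgue2]_x _ in T.
  apply: (@sum_power_eq0 R k.+1 (moment_coef lebesgue2 p1 p2 l) (C + A)) => // t /andP[t0 t1].
  have := ler_normB (\int[lebesgue2]_x (p1 x * cos (t * l x) - p2 x * sin (t * l x)))
    (\int[lebesgue2]_x (p1 x * cos (t * l x) - p2 x * sin (t * l x)) -
     \sum_(n < k.+1) moment_coef lebesgue2 p1 p2 l n * t ^+ n).
  rewrite opprB addrC subrK => /le_trans; apply.
  have := HC t; have := T t; rewrite (gtr0_norm t0) => h1 h2.
  by rewrite mulrDl lerD// mulrC.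
have c1 : moment_coef lebesgue2 q1 q2 l k = 0.
  apply: coef => // N; have [C HC] := H N; exists C => t.
  have [+ _] := HC (t, t * v); rewrite Re_fourier2.
  by under eq_Rintegral do rewrite -phE.
have c2 : moment_coef lebesgue2 q2 (fun x => - q1 x) l k = 0.
  apply: coef => // N; have [C HC] := H N; exists C => t.
  have [_] := HC (t, t * v); rewrite Im_fourier2; congr (`|_| <= _).
  by apply: eq_Rintegral => x _; rewrite -phE mulNr opprK addrC.
have a0 := trig_coef_neq0 (R := R) k.
move: c1 c2; rewrite /moment_coef -!/(I _) IN; set a := (trig_coef k).1 in a0 *.
set b := (trig_coef k).2 in a0 * => c1 c2.
(* Elimination in the linear system formed by [c1] and [c2]. *)
have z1 : (a ^+ 2 + b ^+ 2) * I q1 = 0.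
  by transitivity (a * (a * I q1 - b * I q2) + b * (a * I q2 - b * - I q1));
    [ring|rewrite c1 c2 !mulr0 addr0].
have z2 : (a ^+ 2 + b ^+ 2) * I q2 = 0.
  by transitivity (a * (a * I q2 - b * - I q1) - b * (a * I q1 - b * I q2));
    [ring|rewrite c1 c2 !mulr0 subr0].
have fin q : rapid2 q -> (a ^+ 2 + b ^+ 2) * I q = 0 ->
    \int[lebesgue2]_x ((x.1 + v * x.2) ^+ k * q x) = 0.
  move=> rq /eqP; rewrite mulf_eq0 (negPf a0) /= /I lE RintegralZl2; last exact: ra.
  by rewrite mulf_eq0 expf_eq0 oppr_eq0 mulf_eq0 pnatr_eq0 (gt_eqF (pi_gt0 R)) andbF => /eqP.
by split; exact: fin.
Qed.

Lemma rapid2_schwartz (psi : R * R -> R[i]^o) : is_schwartz2 psi ->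
  rapid2 (fun x => complex.Re (psi x)) /\ rapid2 (fun x => complex.Im (psi x)).
Proof.
move=> Sp; have [_ _ cR bR] := schwartz_jet_Re Sp; have [_ _ cI bI] := schwartz_jet_Im Sp.
split; split; [|exact: (bR 0 0)%N| |exact: (bI 0 0)%N].
  exact: continuous_measurable_fun2 (cR 0 0)%N.
exact: continuous_measurable_fun2 (cI 0 0)%N.
Qed.

(** The bound on [Fpsi1] holds for almost every first coordinate, and [phi2] is bounded everywhere,
    including at the default value of [xi.2 / xi.1] on the line [xi.1 = 0]. *)
Lemma wavelet_null_moments (psi0 psi : R * R -> R[i]^o) (chi1 Fpsi1 phi2 : R -> R[i]^o) :
  is_fourierL2_2 psi0 (fun xi : R * R => Fpsi1 xi.1 * phi2 (xi.2 / xi.1)) ->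
  is_fourierL2_1 chi1 (fun tau : R => (`|tau|%:C)%C * Fpsi1 tau) ->
  is_lizorkin1 chi1 -> is_schwartz1 phi2 -> is_schwartz2 psi ->
  {ae leb2, forall x, psi x = psi0 x} ->
  null_moments (fun x => complex.Re (psi x)) /\ null_moments (fun x => complex.Im (psi x)).
Proof.
move=> F0 Fchi Lchi Sphi Spsi psi0E; have [r1 r2] := rapid2_schwartz Spsi.
have [B [B0 HB]] := schwartz1_bounded Sphi.
apply: null_moments_fourier2 => // N.
have [C HC] := L2_fourier1_lizorkin N Fchi Lchi; exists (C * B).
apply: (fourier2_bound r1 r2 F0 psi0E).
apply: filterS (ae_fst HC) => xi hxi.
rewrite ComplexField.Normc.normcM mulrAC; apply: ler_pM => //; exact: cmod_ge0.
Qed.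

End vanishing_moments.

(** * The shearlet transform *)

Section shearlet_synthesis.
Context {R : realType}.
Local Notation mR := (measurableTypeR R).
Local Notation S := (R * R * R * R)%type.
Local Notation mS := (mR * mR * mR * mR)%type.
Variable psi : R * R -> R[i]^o.
Hypothesis Spsi : is_schwartz2 psi.
Hypothesis nRe : null_moments (fun x => complex.Re (psi x)).
Hypothesis nIm : null_moments (fun x => complex.Im (psi x)).

Let K1 := synthesis_kernel1 psi.
Let K2 := synthesis_kernel2 psi.
Let sK1 : shkernel K1. Proof. exact: shkernel_synthesis1. Qed.
Let sK2 : shkernel K2. Proof. exact: shkernel_synthesis2. Qed.

(** The seminorm of index [shnorm0 N] is determined by the kernels of the differentiated synthesis;
    the factor [2 ^+ N] is that of [shnorm0_bound]. *)
Lemma synthesis_seminorm_bound (i : nat * (nat * nat)) :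
  exists j (C : R), 0 <= C /\ forall Phi : S -> R[i]^o, is_shschwartz Phi ->
    (schwartz2_norm i (synthesis psi Phi) <= C%:E * shnorm j Phi)%E.
Proof.
have [|L1 [L2 [l1 l2 E]]] := @cpartials_shpair R K1 K2 (multi2 i.2) sK1 sK2.
  by move=> v; rewrite /multi2 mem_cat !mem_nseq !inE; case/orP => /andP[_ ->]; rewrite ?orbT.
have [N [C [C0 H]]] := shpair_bound i.1 l1 l2.
exists (shnorm0 N), (C * 2 ^+ N); split; first by rewrite mulr_ge0// exprn_ge0.
move=> Phi SPhi; have rPhi := shschwartz_rapidc SPhi; have [P0 _ nPhi] := SPhi.
have nN := nPhi (shnorm0 N).
have n0 : (0 <= shnorm (shnorm0 N) Phi)%E.
  apply: (@le_trans _ _ (jap1 0 ^+ N * jap1 0 ^+ N * jap1 0 ^+ N *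
      (`|1| ^+ N + (`|1| ^+ N)^-1) * cmod (Phi (0, 0, 0, 1)) : R)%:E).
    by rewrite lee_fin !mulr_ge0 ?exprn_ge0 ?sqrtr_ge0 ?cmod_ge0// addr_ge0// ?invr_ge0 exprn_ge0.
  by apply: ereal_sup_ubound; exists (0, 0, 0, 1 : R) => //; rewrite /shdom /= oner_eq0.
apply: ge_ereal_sup => _ [x _ <-].
rewrite (synthesisE Spsi P0 rPhi) E//.
have fN : shnorm (shnorm0 N) Phi \is a fin_num by rewrite ge0_fin_numE.
rewrite -(fineK fN) -EFinM lee_fin -mulrA.
by apply: H => // p Sp; exact: shnorm0_bound.
Qed.

Lemma synthesis_schwartz2 (Phi : S -> R[i]^o) : is_shschwartz Phi ->
  is_schwartz2 (synthesis psi Phi).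
Proof.
move=> SPhi; have rPhi := shschwartz_rapidc SPhi; have [P0 _ nPhi] := SPhi.
split; first by rewrite (synthesisE Spsi P0 rPhi); exact: smooth_shpair.
move=> i; have [j [C [C0 H]]] := synthesis_seminorm_bound i.
apply: le_lt_trans (H _ SPhi) _.
have := nPhi j; case: (shnorm j Phi) => [r| |]// _; first by rewrite -EFinM ltry.
by apply: (@le_lt_trans _ _ 0%E) => //; exact: mule_ge0_le0.
Qed.

Lemma synthesis_vanishing_moments (Phi : S -> R[i]^o) : is_shschwartz Phi ->
  vanishing_moments2 (synthesis psi Phi).
Proof.
move=> SPhi m; have rPhi := shschwartz_rapidc SPhi; have [P0 _ nPhi] := SPhi.
have [rR rI] := rPhi; have [r1 r2] := rapid2_schwartz Spsi.
rewrite (synthesisE Spsi P0 rPhi).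
have tw := @tempered_synthesis_weight R.
have n1 P : rapid P -> null_moments (shoperator P K1).
  by move=> rP; exact: (null_moments_shoperator rP tw r1 nRe sK1).
have n2 P : rapid P -> null_moments (shoperator P K2).
  by move=> rP; exact: (null_moments_shoperator rP tw r2 nIm sK2).
have d1 P : rapid P -> rapid2 (shoperator P K1) by move=> rP; exact: rapid2_shoperator.
have d2 P : rapid P -> rapid2 (shoperator P K2) by move=> rP; exact: rapid2_shoperator.
apply: complex_ext.
  rewrite -[RHS](null_momentsD (d1 _ rR) (d2 _ rI) (n1 _ rR) (n2 _ rI) m.1 m.2).
  by apply: eq_Rintegral => x _; rewrite /= mul0r subr0.
rewrite -[RHS](null_momentsD (d1 _ rI) (rapid2Z (-1) (d2 _ rR)) (n1 _ rI)
  (null_momentsZ (-1) (d2 _ rR) (n2 _ rR)) m.1 m.2).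
by apply: eq_Rintegral => x _; rewrite /= mul0r addr0 mulN1r.
Qed.

Let St_schwartz (Phi : shschwartz R) : synthesis psi Phi \in @schwartz2_pred R.
Proof. by apply/mem_set/synthesis_schwartz2/set_mem; exact: valP. Qed.

Let St_moments (Phi : shschwartz R) : Schwartz2 (St_schwartz Phi) \in @lizorkin2_pred R.
Proof. by apply/mem_set/synthesis_vanishing_moments/set_mem; exact: valP. Qed.

Definition shearlet_synthesis (Phi : shschwartz R) : lizorkin2 R := Lizorkin2 (St_moments Phi).

Lemma shoperator_lin (a b : R) (P Q T : S -> R) K x : rapid P -> rapid Q -> rapid T -> shkernel K ->
  shoperator (fun p => a * P p - b * Q p + T p) K x =
  a * shoperator P K x - b * shoperator Q K x + shoperator T K x.
Proof.
move=> rP rQ rT sK; have i1 := integrable_EFinZl a measurableT (shoperator_integrable x rP sK).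
have i2 := integrable_EFinZl b measurableT (shoperator_integrable x rQ sK).
have i3 := shoperator_integrable x rT sK.
rewrite /shoperator -!RintegralZl//; [|exact: shoperator_integrable..].
rewrite -(RintegralB measurableT i1 i2).
rewrite -(RintegralD measurableT (integrableB measurableT i1 i2) i3).
by apply: eq_Rintegral => p _; ring.
Qed.

Lemma linear_shearlet_synthesis : linear shearlet_synthesis.
Proof.
move=> a f g; apply: val_inj; apply: val_inj; apply/funext => x.
have Sf : is_shschwartz f by exact: set_mem (valP f).
have Sg : is_shschwartz g by exact: set_mem (valP g).
pose h : S -> R[i]^o := a *: (f : S -> R[i]^o) + (g : S -> R[i]^o).
have Sh : is_shschwartz h.
  by have [_ /(_ a _ _ (valP f) (valP g)) /set_mem] := @shschwartz_pred_submod R.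
rewrite -[LHS]/(synthesis psi h x) -[RHS]/(a * synthesis psi f x + synthesis psi g x).
have [[fR fI] [gR gI]] := (shschwartz_rapidc Sf, shschwartz_rapidc Sg).
have [f0 _ _] := Sf; have [g0 _ _] := Sg; have [h0 _ _] := Sh.
rewrite (synthesisE Spsi f0 (shschwartz_rapidc Sf)) (synthesisE Spsi g0 (shschwartz_rapidc Sg)).
rewrite (synthesisE Spsi h0 (shschwartz_rapidc Sh)).
rewrite -[synthesis_kernel1 psi]/K1 -[synthesis_kernel2 psi]/K2 /shpair.
have hE p : h p = a * f p + g p by [].
have ReL (c u v : R[i]) : complex.Re (c * u + v) =
    complex.Re c * complex.Re u - complex.Im c * complex.Im u + complex.Re v.
  by case: c u v => ? ? [? ?] [].
(* The double negation gives the imaginary part the shape expected by [shoperator_lin]. *)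
have ImL (c u v : R[i]) : complex.Im (c * u + v) =
    complex.Re c * complex.Im u - (- complex.Im c) * complex.Re u + complex.Im v.
  by case: c u v => ? ? [? ?] [? ?] /=; ring.
have ER : (fun p => complex.Re (h p)) =
    (fun p => complex.Re a * complex.Re (f p) - complex.Im a * complex.Im (f p) + complex.Re (g p)).
  by apply/funext => p; rewrite hE ReL.
have EI : (fun p => complex.Im (h p)) =
    (fun p => complex.Re a * complex.Im (f p) - (- complex.Im a) * complex.Re (f p) + complex.Im (g p)).
  by apply/funext => p; rewrite hE ImL.
rewrite ER EI !shoperator_lin//; case: a {h Sh h0 hE ER EI} => a1 a2.
by apply: complex_ext => /=; ring.
Qed.

End shearlet_synthesis.
Theorem proposition9 (R : realType)
    (psi0 : R * R -> R[i]^o) (psi1 psi2 chi1 Fpsi1 phi2 : R -> R[i]^o)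
    (psi0_admissible : admissible psi0)
    (Fpsi1P : is_fourierL2_1 psi1 Fpsi1)
    (phi2P : is_fourierL2_1 psi2 phi2)
    (Fpsi0P : is_fourierL2_2 psi0
      (fun xi : R * R => Fpsi1 xi.1 * phi2 (xi.2 / xi.1)))
    (chi1P : is_fourierL2_1 chi1 (fun tau : R => (`|tau|%:C)%C * Fpsi1 tau))
    (chi1_lizorkin : is_lizorkin1 chi1)
    (phi2_schwartz : is_schwartz1 phi2)
    (psi : R * R -> R[i]^o)
    (psi_schwartz : is_schwartz2 psi)
    (psiE : {ae leb2, forall x, psi x = psi0 x}) :
  exists (St : shschwartz R -> lizorkin2 R)
         (Spsi : dual (lizorkin2 R) -> dual (shschwartz R)),
    [/\ forall Phi x, St Phi x = synthesis psi Phi x,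
        forall f Phi, Spsi f Phi = f (St Phi),
        linear Spsi &
        continuous Spsi].

Proof.
have [nRe nIm] := wavelet_null_moments Fpsi0P chi1P chi1_lizorkin phi2_schwartz psi_schwartz psiE.
have St_bound i : exists j (C : R), 0 <= C /\ forall Phi : shschwartz R,
    (schwartz2_norm i (lizorkin2_schwartz (shearlet_synthesis psi_schwartz nRe nIm Phi)) <=
     C%:E * shnorm j Phi)%E.
  have [j [C [C0 H]]] := synthesis_seminorm_bound psi_schwartz i; exists j, C; split => // Phi.
  by apply: H; exact: set_mem (valP Phi).
have St_lin := linear_shearlet_synthesis psi_schwartz nRe nIm.
exists (shearlet_synthesis psi_schwartz nRe nIm), (dual_comp St_lin St_bound).
split=> //; first exact: dual_comp_linear.
exact: dual_comp_continuous.
Qed.
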